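(* For inputs $T_G$ and $x$, where $T_G$ is the cotree of a cograph $G$ of order $n$ having adjacency matrix $A$, and $x \in \mathbb{R}$, the algorithm Diagonalize (specified in full in the context) computes a diagonal matrix $D$, which is congruent to $A + xI$, using $O(n)$ time and space.
   Context: Graphs are undirected. Cographs are the smallest class of graphs containing $K_1$ and closed under disjoint union $\cup$ and join $\otimes$ (equivalently, graphs with no induced path on four vertices). The cotree $T_G$ of a cograph $G$ is the unique rooted tree whose leaves are the vertices $v_1,\dots,v_n$ of $G$, whose interior nodes each have at least two children and are labelled $\cup$ or $\otimes$ with labels alternating along every root-to-leaf path, and such that two distinct vertices are adjacent in $G$ if and only if their least common ancestor in $T_G$ is labelled $\otimes$; the cotree of a one-vertex graph is a single leaf. For a vertex $v$, $T_G - v$ denotes the cotree of the cograph $G - v$ (the empty tree if no vertex is left). In particular, let $\{v,u\}$ be two leaves of greatest depth with a common parent $w$. If $w$ has more than two children, $T_G - v$ is obtained by removing $v$. If $w$ has exactly two children and is not the root, $T_G - v$ is obtained by making $u$ a child of the parent of $w$ and removing $v$ and $w$. If $w$ has exactly two children and is the root, $T_G - v$ is the single leaf $u$. Two vertices are called siblings if they are leaves with the same parent in the cotree. The adjacency matrix $A=[a_{ij}]$ is the $n\times n$ $0/1$ matrix with $a_{ij}=1$ if and only if $v_i$ is adjacent to $v_j$. Real symmetric matrices $R$ and $S$ are congruent if $R = P^T S P$ for some nonsingular matrix $P$. Algorithm Diagonalize$(T_G,x)$. It does not store the matrix $A+xI$; it keeps only the cotree and the diagonal values $d_1,\dots,d_n$,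 where $d_i$ belongs to $v_i$. Initialize $d_i \leftarrow x$ for all $i$. While the current cotree $T$ has at least two leaves, select a sibling pair $\{v_k, v_l\}$ of maximum depth in $T$, with parent $w$, set $\alpha \leftarrow d_k$, $\beta \leftarrow d_l$, and do the following. If $w=\otimes$: (1a) if $\alpha+\beta \neq 2$: $d_k \leftarrow \alpha+\beta-2$, $d_l \leftarrow \frac{\alpha\beta-1}{\alpha+\beta-2}$, $T \leftarrow T - v_k$; (1b) if $\alpha+\beta=2$ and $\beta=1$: $d_k \leftarrow 0$, $d_l \leftarrow 1$, $T \leftarrow T - v_k$; (1c) if $\alpha+\beta=2$ and $\beta\neq 1$: $d_k \leftarrow -(1-\beta)^2$, $d_l \leftarrow 1$, $T \leftarrow T - v_k$, $T \leftarrow T - v_l$. If $w=\cup$: (2a) if $\alpha+\beta\neq 0$: $d_k \leftarrow \alpha+\beta$, $d_l \leftarrow \frac{\alpha\beta}{\alpha+\beta}$, $T \leftarrow T - v_k$; (2b) if $\alpha+\beta=0$ and $\beta=0$: $d_k \leftarrow 0$, $d_l \leftarrow 0$, $T \leftarrow T - v_k$; (2c) if $\alpha+\beta=0$ and $\beta\neq 0$: $d_k \leftarrow -\beta$, $d_l \leftarrow \beta$, $T \leftarrow T - v_k$, $T \leftarrow T - v_l$. The value $d_i$ of a vertex removed from the cotree is permanent. When the loop ends, the output is the diagonal matrix $D$ with diagonal entries $d_1,\dots,d_n$ (represented by the list of these entries). Each arithmetic operation on, and storage of, a real number counts as constant cost. *)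

(* Defs.v *)
(* MathComp world; the real numbers are an abstract [R : realType]. *)
From mathcomp Require Import all_boot all_order all_algebra reals.

Set Implicit Arguments.
Unset Strict Implicit.
Unset Printing Implicit Defensive.

Import GRing.Theory.
Local Open Scope ring_scope.

(** * Cographs *)

(* [b = false]: disjoint union; [b = true]: join. *)
Definition sum_graph (b : bool) (V W : finType) (e : rel V) (f : rel W) :
    rel (V + W)%type :=
  fun u v => match u, v with
             | inl u1, inl v1 => e u1 v1
             | inr u2, inr v2 => f u2 v2
             | _, _ => b
             end.

(* A graph on [V] is its adjacency relation; the relations below are
   automatically symmetric and irreflexive. *)
Inductive cograph : forall V : finType, rel V -> Prop :=
| CographK1 : @cograph unit (fun _ _ => false)
| CographUnion (V W : finType) (e : rel V) (f : rel W) :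
    cograph e -> cograph f -> cograph (sum_graph false e f)
| CographJoin (V W : finType) (e : rel V) (f : rel W) :
    cograph e -> cograph f -> cograph (sum_graph true e f)
| CographIso (V W : finType) (e : rel V) (f : rel W) (h : V -> W) :
    bijective h -> (forall u v, f (h u) (h v) = e u v) ->
    cograph e -> cograph f.

(** * Cotrees *)

(* In [Node b ts], [b = true] is the label join and [b = false] the label
   union. The children of a node are listed in an arbitrary order: an unordered
   rooted tree is represented by any of its orderings. *)
Inductive cotree (V : Type) : Type :=
| Leaf (v : V)
| Node (b : bool) (ts : seq (cotree V)).

Fixpoint leaves (V : Type) (t : cotree V) : seq V :=
  match t with
  | Leaf v => [:: v]
  | Node _ ts => flatten (map (@leaves V) ts)
  end.

Definition labelled (V : Type) (b : bool) (t : cotree V) : bool :=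
  if t is Node c _ then c == b else false.

Fixpoint well_formed (V : Type) (t : cotree V) : bool :=
  match t with
  | Leaf _ => true
  | Node b ts => [&& (1 < size ts)%N, ~~ has (labelled b) ts
                   & all (@well_formed V) ts]
  end.

(* [occurs t d s]: [s] is the subtree of [t] rooted at some node of depth [d]. *)
Inductive occurs (V : Type) : cotree V -> nat -> cotree V -> Prop :=
| OccursRoot t : occurs t 0 t
| OccursChild b ts1 t ts2 d s :
    occurs t d s -> occurs (Node b (ts1 ++ t :: ts2)) d.+1 s.

(* [s] is the subtree rooted at the least common ancestor of [u] and [v]. *)
Definition is_lca (V : eqType) (t : cotree V) (u v : V) (s : cotree V) : Prop :=
  exists d, [/\ occurs t d s, u \in leaves s, v \in leaves s
    & forall d' s', occurs t d' s' -> u \in leaves s' -> v \in leaves s' ->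
        (d' <= d)%N].

(* [t] is the cotree of the subgraph of [e] induced by [S]. *)
Definition cotree_on (V : finType) (e : rel V) (S : {set V}) (t : cotree V) :
    Prop :=
  [/\ well_formed t, uniq (leaves t), leaves t =i S
    & forall u v, u \in S -> v \in S -> u != v ->
        (e u v <-> exists ts, is_lca t u v (Node true ts))].

(* [t'] is [t - v]; the empty tree is [None]. *)
Definition cotree_minus (V : finType) (e : rel V) (t : cotree V) (v : V)
    (t' : option (cotree V)) : Prop :=
  let S := [set u in leaves t] :\ v in
  if t' is Some s then cotree_on e S s else S = set0.

Definition is_leaf (V : eqType) (v : V) (t : cotree V) : bool :=
  if t is Leaf u then u == v else false.

(* [k] and [l] are distinct leaves whose common parent is a node of depth [d]
   labelled [b]. *)
Definition sibling_pair (V : eqType) (t : cotree V) (d : nat) (b : bool)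
    (k l : V) : Prop :=
  exists ts, [/\ occurs t d (Node b ts), has (is_leaf k) ts,
                 has (is_leaf l) ts & k != l].

Definition deepest_sibling_pair (V : eqType) (t : cotree V) (b : bool)
    (k l : V) : Prop :=
  exists2 d, sibling_pair t d b k l
    & forall d' b' k' l', sibling_pair t d' b' k' l' -> (d' <= d)%N.

(** * Matrices *)

Definition adjacency (R : realType) (n : nat) (e : rel 'I_n) : 'M[R]_n :=
  \matrix_(i, j) (e i j)%:R.

Definition congruent (R : realType) (n : nat) (M N : 'M[R]_n) : Prop :=
  exists2 P : 'M[R]_n, P \in unitmx & M = P^T *m N *m P.

(** * The algorithm Diagonalize *)

(* The new values of [d_k] and [d_l], and whether [v_l] is removed too. *)
Definition new_values (R : realType) (b : bool) (alpha beta : R) :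
    R * R * bool :=
  if b then
    if alpha + beta != 2 then
      (alpha + beta - 2, (alpha * beta - 1) / (alpha + beta - 2), false)
    else if beta == 1 then (0, 1, false)
    else (- (1 - beta) ^+ 2, 1, true)
  else
    if alpha + beta != 0 then
      (alpha + beta, alpha * beta / (alpha + beta), false)
    else if beta == 0 then (0, 0, false)
    else (- beta, beta, true).

Definition diag_state (R : realType) (n : nat) : Type :=
  (option (cotree 'I_n) * {ffun 'I_n -> R})%type.

Definition num_leaves (V : Type) (T : option (cotree V)) : nat :=
  if T is Some t then size (leaves t) else 0%N.

(* One iteration of the loop, with the assignments it makes to the [d_i]. *)
Inductive diag_step (R : realType) (n : nat) (e : rel 'I_n) :
    diag_state R n -> seq ('I_n * R) -> diag_state R n -> Prop :=
| DiagStep (t t1 : cotree 'I_n) (T : option (cotree 'I_n))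
    (d : {ffun 'I_n -> R}) (b : bool) (k l : 'I_n) (dk dl : R) (rem_l : bool) :
    (1 < num_leaves (Some t))%N ->
    deepest_sibling_pair t b k l ->
    new_values b (d k) (d l) = (dk, dl, rem_l) ->
    cotree_minus e t k (Some t1) ->
    (if rem_l then cotree_minus e t1 l T else T = Some t1) ->
    diag_step e (Some t, d) [:: (k, dk); (l, dl)]
      (T, [ffun i => if i == k then dk else if i == l then dl else d i]).

Inductive diag_run (R : realType) (n : nat) (e : rel 'I_n) :
    diag_state R n -> seq ('I_n * R) -> diag_state R n -> Prop :=
| DiagRunNil s : diag_run e s [::] s
| DiagRunStep s1 tr s2 tr' s3 :
    diag_step e s1 tr s2 -> diag_run e s2 tr' s3 ->
    diag_run e s1 (tr ++ tr') s3.

Definition diag_start (R : realType) (n : nat) (t : cotree 'I_n) (x : R) :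
    diag_state R n :=
  (Some t, [ffun=> x]).

Definition diag_init_trace (R : realType) (n : nat) (x : R) :
    seq ('I_n * R) :=
  [seq (i, x) | i <- enum 'I_n].

(** * Cost model: a real RAM

   Registers (finitely many occur in a program) and an array of cells, both for
   integers and for reals. Integers are natural numbers, with truncated
   subtraction. Every instruction and every test takes one unit of time. A machine of
   size [S] has [S] integer cells and [S] real cells, and its integers are
   [< S]; an access outside the arrays, an integer [>= S] and a division by
   zero are errors. *)

Inductive instr : Type :=
| IConst (r c : nat)
| IAdd (r a b : nat)
| ISub (r a b : nat)
| ILoad (r a : nat)
| IStore (a r : nat)
| RConst (r c : nat)
| RAdd (r a b : nat)
| RSub (r a b : nat)
| RMul (r a b : nat)
| RDiv (r a b : nat)
| RLoad (r a : nat)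
| RStore (a r : nat).

Inductive test : Type :=
| ILt (a b : nat)
| IEq (a b : nat)
| REq (a b : nat).

Inductive prog : Type :=
| Skip
| Do (i : instr)
| Seq (p q : prog)
| If (c : test) (p q : prog)
| While (c : test) (p : prog).

(* [log] is not readable by programs: it is the history of the writes to
   [rmem], oldest first. *)
Record memory (R : realType) : Type := Memory {
  ireg : nat -> nat;
  imem : nat -> nat;
  rreg : nat -> R;
  rmem : nat -> R;
  log : seq (nat * R) }.

Definition upd (T : Type) (f : nat -> T) (a : nat) (v : T) : nat -> T :=
  fun i => if i == a then v else f i.

Definition set_ireg (R : realType) (S : nat) (m : memory R) (r v : nat) :
    option (memory R) :=
  if (v < S)%N
  then Some (Memory (upd (ireg m) r v) (imem m) (rreg m) (rmem m) (log m))
  else None.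

Definition set_rreg (R : realType) (m : memory R) (r : nat) (v : R) :
    option (memory R) :=
  Some (Memory (ireg m) (imem m) (upd (rreg m) r v) (rmem m) (log m)).

Definition exec (R : realType) (S : nat) (i : instr) (m : memory R) :
    option (memory R) :=
  match i with
  | IConst r c => set_ireg S m r c
  | IAdd r a b => set_ireg S m r (ireg m a + ireg m b)
  | ISub r a b => set_ireg S m r (ireg m a - ireg m b)
  | ILoad r a =>
      if (ireg m a < S)%N then set_ireg S m r (imem m (ireg m a)) else None
  | IStore a r =>
      if (ireg m a < S)%N
      then Some (Memory (ireg m) (upd (imem m) (ireg m a) (ireg m r))
                   (rreg m) (rmem m) (log m))
      else None
  | RConst r c => set_rreg m r c%:R
  | RAdd r a b => set_rreg m r (rreg m a + rreg m b)
  | RSub r a b => set_rreg m r (rreg m a - rreg m b)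
  | RMul r a b => set_rreg m r (rreg m a * rreg m b)
  | RDiv r a b =>
      if rreg m b == 0 then None else set_rreg m r (rreg m a / rreg m b)
  | RLoad r a =>
      if (ireg m a < S)%N then set_rreg m r (rmem m (ireg m a)) else None
  | RStore a r =>
      if (ireg m a < S)%N
      then Some (Memory (ireg m) (imem m) (rreg m)
                   (upd (rmem m) (ireg m a) (rreg m r))
                   (rcons (log m) (ireg m a, rreg m r)))
      else None
  end.

Definition holds (R : realType) (c : test) (m : memory R) : bool :=
  match c with
  | ILt a b => (ireg m a < ireg m b)%N
  | IEq a b => ireg m a == ireg m b
  | REq a b => rreg m a == rreg m b
  end.

(* [runs S p m c m']: on a machine of size [S], [p] started in [m] halts in
   [m'] after time [c], without error. *)
Inductive runs (R : realType) (S : nat) :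
    prog -> memory R -> nat -> memory R -> Prop :=
| RunSkip m : runs S Skip m 1 m
| RunDo i m m' : exec S i m = Some m' -> runs S (Do i) m 1 m'
| RunSeq p q m1 c m2 c' m3 :
    runs S p m1 c m2 -> runs S q m2 c' m3 -> runs S (Seq p q) m1 (c + c') m3
| RunIf t p q m c m' :
    runs S (if holds t m then p else q) m c m' -> runs S (If t p q) m c.+1 m'
| RunWhileFalse t p m : ~~ holds t m -> runs S (While t p) m 1 m
| RunWhileTrue t p m1 c m2 c' m3 :
    holds t m1 -> runs S p m1 c m2 -> runs S (While t p) m2 c' m3 ->
    runs S (While t p) m1 (c + c').+1 m3.

(* The cotree as a bracketed word: the opening bracket of a node is its label
   (0 or 1), the closing bracket is 2, the leaf [v_i] is [i + 3]. *)
Fixpoint encode (n : nat) (t : cotree 'I_n) : seq nat :=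
  match t with
  | Leaf v => [:: (v + 3)%N]
  | Node b ts => nat_of_bool b :: flatten (map (@encode n) ts) ++ [:: 2%N]
  end.

(* Integer cells: the encoded cotree, followed by zeros. Integer registers: the
   order [n] and the length of the code. Real register 0: the number [x]. *)
Definition input (R : realType) (n : nat) (t : cotree 'I_n) (x : R) :
    memory R :=
  Memory (nth 0%N [:: n; size (encode t)]) (nth 0%N (encode t))
    (nth 0 [:: x]) (fun=> 0) [::].

(* Main.v *)
From HB Require Import structures.
Require Import Defs.
From mathcomp Require Import all_boot all_order all_algebra reals.
From mathcomp Require Import boolp zify ring.

(** Every run is correct. Two siblings [v_k] and [v_l] below a node labelled [b]
   are twins: a third vertex is adjacent to both or to neither. Subtracting row
   and column [l] from row and column [k] therefore clears row [k] outside the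
   block of [k] and [l], and what remains to be done inside that block gives
   the assigned values; in the third case of each label the off-diagonal
   entry of the block is the pivot that clears row [l] as well. So the matrix
   that is [A + xI] on the vertices of the current cotree and diagonal elsewhere
   keeps its congruence class ([new_values_congruent], [diag_run_sound]). Each
   iteration deletes a vertex, and an iteration is possible as long as two
   vertices are left, because an interior node of greatest depth has only
   leaves below it ([deepest_exists]) and the tree without a leaf has a normal
   form that is a cotree ([norm], [prune]). Throughout, the condition on least
   common ancestors is replaced by the recursive condition [represents].

   For linear time, a program cannot keep the cotree itself: when a node
   loses all but one of its children, the last child is merged into its
   grandparent, and the depths of a whole subtree drop. The program keeps
   a lazy tree instead, which consists of the interior nodes of the input with
   their parents, their labels, the numbers of their children and linked lists
   of the leaves that hang from them. It handles the nodes by decreasing depth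
   in the input, so that a node [w] has only leaves below it when its turn comes.
   Let [p] be the parent of [w].
   - If [w] and [p] have the same label, the leaves of [w] are handed to [p].
   - Otherwise, if [w] is the only child of [p], then [p] takes over the label and
     the leaves of [w].
   - Otherwise the leaves of [w] are reduced in pairs until at most one is left,
     and that one is handed to [p].
   Lists are concatenated in constant time through a pointer to their last
   element, whence the bound.

   The cotree of the run is the normal form of the lazy tree. In the third
   case every ancestor of [w] still has two children and a label that differs
   from the label of its parent, so that the path from the root to [w] survives
   normalization and two leaves of [w] are siblings of greatest depth
   ([deepest_assembled]). Cotrees being unique up to the order of children
   ([sibling_pair_unique]), they are also siblings of greatest depth in
   whichever cotree the run has reached, in particular in the input
   ([reduce_step]).

   A sentinel node above the root, with a label of its own, receives the last
   leaf; thanks to it, neither the root nor a tree with a single vertex is a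
   special case. *)

Set Implicit Arguments.
Unset Strict Implicit.
Unset Printing Implicit Defensive.

Import GRing.Theory Num.Theory.
Local Open Scope nat_scope.

(** * Nested induction on trees *)

(** Membership in a list of trees needs a decision of equality; the classical
    one will do, as nothing is computed with it. *)
HB.instance Definition _ (V : Type) := gen_eqMixin (cotree V).

Lemma cotree_nested_ind (V : Type) (P : cotree V -> Prop) :
  (forall v, P (Leaf v)) ->
  (forall b ts, {in ts, forall c, P c} -> P (Node b ts)) ->
  forall t, P t.
Proof.
move=> Pl Pn; fix IH 1 => -[v|b ts]; first exact: Pl.
apply: Pn; elim: ts => [|c ts IHts] x; rewrite ?in_nil; first discriminate.
rewrite in_cons => /predU1P[->|]; [exact: IH|exact: IHts].
Qed.

Section CotreeOccurrences.
Variable V : eqType.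
Implicit Types (t c s : cotree V) (ts cs : seq (cotree V)) (u v : V).

Definition forest_leaves ts : seq V := flatten (map (@leaves V) ts).

Lemma mem_forest ts u :
  reflect (exists2 c, c \in ts & u \in leaves c) (u \in forest_leaves ts).
Proof. exact: flatten_mapP. Qed.

Lemma mem_forest_of ts c u :
  c \in ts -> u \in leaves c -> u \in forest_leaves ts.
Proof. by move=> cts uc; apply/mem_forest; exists c. Qed.

Lemma forest_leaves_cat ts cs :
  forest_leaves (ts ++ cs) = forest_leaves ts ++ forest_leaves cs.
Proof. by rewrite /forest_leaves map_cat flatten_cat. Qed.

Lemma leaves_nodeE b ts : leaves (Node b ts) = forest_leaves ts.
Proof. by []. Qed.

(** * Occurrences and least common ancestors *)

Lemma occurs_node b ts d s : occurs (Node b ts) d s ->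
  (d = 0 /\ s = Node b ts) \/
  exists d' c, [/\ d = d'.+1, c \in ts & occurs c d' s].
Proof.
move=> H; inversion H as [|b' ts1 t' ts2 d' s' H']; subst; [by left|right].
by exists d', t'; split=> //; rewrite mem_cat mem_head orbT.
Qed.

Lemma occurs_child b ts c d s :
  c \in ts -> occurs c d s -> occurs (Node b ts) d.+1 s.
Proof. by move=> /path.splitPr[ts1 ts2] H; constructor. Qed.

Lemma occurs_below t d b ts c :
  occurs t d (Node b ts) -> c \in ts -> occurs t d.+1 c.
Proof.
move=> + cts; move es: (Node b ts) => s H.
elim: H es => {t d s} [t <-|b' ts1 t ts2 d s _ IH es].
  by apply: occurs_child cts _; constructor.
by apply: occurs_child (IH es); rewrite mem_cat mem_head orbT.
Qed.

Lemma occurs_leaves t d s : occurs t d s -> {subset leaves s <= leaves t}.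
Proof.
elim=> {t d s} [t|b ts1 t ts2 d s _ IH] u // /IH ut.
by apply/mem_forest; exists t; rewrite // mem_cat mem_head orbT.
Qed.

Lemma occurs_wf t d s : occurs t d s -> well_formed t -> well_formed s.
Proof.
elim=> {t d s} [t|b ts1 t ts2 d s _ IH] //= /and3P[_ _].
by rewrite all_cat /= => /and3P[_ /IH].
Qed.

Lemma uniq_child ts c c' u : uniq (forest_leaves ts) -> c \in ts -> c' \in ts ->
  u \in leaves c -> u \in leaves c' -> c = c'.
Proof.
elim: ts => //= a ts IH; rewrite /forest_leaves /= cat_uniq.
case/and3P=> _ /hasPn dis uts; rewrite !in_cons.
move=> /predU1P[->|cts] /predU1P[->|cts'] // uc uc'; last exact: IH.
- by have /dis := mem_forest_of cts' uc'; rewrite /= uc.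
- by have /dis := mem_forest_of cts uc; rewrite /= uc'.
Qed.

Lemma uniq_leaves_child b ts c :
  uniq (leaves (Node b ts)) -> c \in ts -> uniq (leaves c).
Proof.
move=> ut cts; case/path.splitPr: cts ut => ts1 ts2.
by rewrite leaves_nodeE forest_leaves_cat !cat_uniq => /and3P[_ _ /and3P[]].
Qed.

(** Subtrees at the same depth have disjoint sets of leaves. *)
Lemma occurs_inj t d s s' u : uniq (leaves t) -> occurs t d s -> occurs t d s' ->
  u \in leaves s -> u \in leaves s' -> s = s'.
Proof.
move=> + H; elim: H s' => {t d s} [t|b ts1 t ts2 d s H IH] s' ut H' us us'.
  by inversion H'.
have [[]//|[d' [c [[<-] cts H'']]]] := occurs_node H'.
have tts : t \in ts1 ++ t :: ts2 by rewrite mem_cat mem_head orbT.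
have ct : c = t.
  exact: (uniq_child (u := u) ut cts tts (occurs_leaves H'' us') (occurs_leaves H us)).
by rewrite ct in H''; apply: IH => //; exact: uniq_leaves_child ut tts.
Qed.

Lemma lca_uniq t u v s s' : uniq (leaves t) ->
  is_lca t u v s -> is_lca t u v s' -> s = s'.
Proof.
move=> ut [d [Ho us vs Hm]] [d' [Ho' us' vs' Hm']].
have dd' : d = d' by apply/eqP; rewrite eqn_leq (Hm' _ _ Ho us vs) (Hm _ _ Ho' us' vs').
by subst d'; exact: occurs_inj ut Ho Ho' us us'.
Qed.

Lemma lca_sym t u v s : is_lca t u v s -> is_lca t v u s.
Proof. by case=> d [H1 H2 H3 H4]; exists d; split=> // *; apply: H4; eauto. Qed.

(** A deeper subtree lies below one child, and the leaves of that child are not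
    leaves of another one. *)
Lemma lca_root b ts c c' u v : uniq (leaves (Node b ts)) ->
  c \in ts -> c' \in ts -> c != c' -> u \in leaves c -> v \in leaves c' ->
  is_lca (Node b ts) u v (Node b ts).
Proof.
move=> ut cts cts' cc' uc vc'; exists 0; split; first by constructor.
- by apply/mem_forest; exists c.
- by apply/mem_forest; exists c'.
move=> d' s' /occurs_node[[-> //]|[d [a [-> ats H]]]] us vs.
have ua := uniq_child ut ats cts (occurs_leaves H us) uc.
have va := uniq_child ut ats cts' (occurs_leaves H vs) vc'.
by rewrite -ua -va eqxx in cc'.
Qed.

Lemma lca_child b ts c u v s : uniq (leaves (Node b ts)) -> c \in ts ->
  is_lca c u v s -> is_lca (Node b ts) u v s.
Proof.
move=> ut cts [d [Ho us vs Hm]]; exists d.+1; split=> //.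
  exact: occurs_child cts Ho.
move=> d' s' /occurs_node[[-> //]|[d'' [a [-> ats H]]]] us' vs'.
have ua := uniq_child ut ats cts (occurs_leaves H us') (occurs_leaves Ho us).
by rewrite ltnS; apply: Hm us' vs'; rewrite -ua.
Qed.

Lemma lca_exists t u v : uniq (leaves t) -> u \in leaves t -> v \in leaves t ->
  u != v -> exists b ts, is_lca t u v (Node b ts).
Proof.
elim/cotree_nested_ind: t => [w|b ts IH] ut.
  by rewrite !inE => /eqP-> /eqP->; rewrite eqxx.
move=> /mem_forest[c cts uc] /mem_forest[c' cts' vc'] uv.
have [cc'|cc'] := eqVneq c c'; last by exists b, ts; exact: lca_root cts cts' cc' uc vc'.
subst c'; have [b' [ts' H]] := IH c cts (uniq_leaves_child ut cts) uc vc' uv.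
by exists b', ts'; exact: lca_child cts H.
Qed.

(** * Trees that represent a graph *)

Section Represents.
Variable e : rel V.

(** Both orders of [u] and [v], since symmetry of the relation is not assumed;
    the inequality makes [represents] imply that leaves are distinct. *)
Definition adjacent_as b u v : bool := [&& u != v, e u v == b & e v u == b].

Definition cross b c c' : bool := allrel (adjacent_as b) (leaves c) (leaves c').

Lemma crossE b c c' u v : cross b c c' -> u \in leaves c -> v \in leaves c' ->
  adjacent_as b u v.
Proof. by move=> H uc vc'; exact: (allrelP H). Qed.

Fixpoint represents t : bool :=
  match t with
  | Leaf _ => true
  | Node b ts => pairwise (cross b) ts && all represents ts
  end.

Lemma adjacent_as_sym b u v : adjacent_as b u v = adjacent_as b v u.
Proof. by rewrite /adjacent_as eq_sym [(e v u == b) && _]andbC. Qed.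

Lemma cross_forest b ts cs :
  allrel (cross b) ts cs =
  allrel (adjacent_as b) (forest_leaves ts) (forest_leaves cs).
Proof.
apply/allrelP/allrelP => [H u v /mem_forest[c cts uc] /mem_forest[c' cts' vc']|H c c' cts cts'].
  exact: crossE (H c c' cts cts') uc vc'.
by apply/allrelP => u v uc vc'; apply: H; apply/mem_forest; [exists c|exists c'].
Qed.

(** All operations on lists of children below reduce to this split. *)
Lemma represents_cat b ts cs : represents (Node b (ts ++ cs)) =
  [&& allrel (adjacent_as b) (forest_leaves ts) (forest_leaves cs),
      represents (Node b ts) & represents (Node b cs)].
Proof.
rewrite /= pairwise_cat all_cat cross_forest.
by case: allrel => //=; case: pairwise => //=; case: pairwise => //=; rewrite andbF.
Qed.

Lemma represents_cons b c cs : represents (Node b (c :: cs)) =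
  [&& allrel (adjacent_as b) (leaves c) (forest_leaves cs),
      represents c & represents (Node b cs)].
Proof.
rewrite -cat1s represents_cat /forest_leaves /= cats0 !andbT.
by [].
Qed.

Lemma represents_child b ts c : represents (Node b ts) -> c \in ts -> represents c.
Proof. by move=> /= /andP[_ /allP H] /H. Qed.

Lemma represents_cross b ts c c' u v : represents (Node b ts) ->
  c \in ts -> c' \in ts -> c != c' -> u \in leaves c -> v \in leaves c' ->
  adjacent_as b u v.
Proof.
move=> /= /andP[+ _]; elim: ts => //= a ts IH /andP[/allP acr pw].
rewrite !in_cons => /predU1P[->|cts] /predU1P[->|cts'].
- by rewrite eqxx.
- by move=> _ ua vc'; exact: crossE (acr _ cts') ua vc'.
- by move=> _ uc va; rewrite adjacent_as_sym; exact: crossE (acr _ cts) va uc.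
- exact: IH.
Qed.

Lemma represents_uniq t : represents t -> uniq (leaves t).
Proof.
elim/cotree_nested_ind: t => [//|b ts IH].
have {IH} : all (fun c => uniq (leaves c)) ts || ~~ represents (Node b ts).
  case R: (represents _) => /=; last by rewrite orbT.
  by rewrite orbF; apply/allP => c cts; apply: IH => //; exact: represents_child R cts.
move=> + R; rewrite R orbF; elim: ts R => //= c ts IH.
rewrite -/(represents (Node b (c :: ts))) represents_cons => /and3P[/allrelP cr _ R].
move=> /andP[uc us]; rewrite cat_uniq uc (IH R us) andbT.
apply/hasPn => u ut; apply/negP => uc'.
by have /and3P[] := cr u u uc' ut; rewrite eqxx.
Qed.

Lemma represents_occurs t d s : occurs t d s -> represents t -> represents s.
Proof.
elim=> {t d s} [t|b ts1 t ts2 d s _ IH] // R; apply: IH.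
by apply: represents_child R _; rewrite mem_cat mem_head orbT.
Qed.

(** The least common ancestor separates [u] from [v], for otherwise a child of
    it would contain both and be deeper. *)
Lemma represents_lca t u v b ts : u != v -> represents t ->
  is_lca t u v (Node b ts) -> adjacent_as b u v.
Proof.
move=> uv R [d [Ho us vs Hm]]; have R' := represents_occurs Ho R.
have [c cts uc] := mem_forest _ _ us; have [c' cts' vc'] := mem_forest _ _ vs.
have [cc'|cc'] := eqVneq c c'; last exact: represents_cross R' cts cts' cc' uc vc'.
subst c'.
by have := Hm _ _ (occurs_below Ho cts) uc vc'; rewrite ltnn.
Qed.

(** Leaves below different children of a node have that node as their least
    common ancestor, so the condition on ancestors gives all the local ones. *)
Lemma lca_represents t : uniq (leaves t) ->
  (forall u v b ts, u \in leaves t -> v \in leaves t -> u != v ->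
     is_lca t u v (Node b ts) -> e u v = b) ->
  represents t.
Proof.
elim/cotree_nested_ind: t => [//|b ts IH] ut H.
apply/andP; split; last first.
  apply/allP => c cts; apply: IH => // [|u v b' ts' uc vc uv lc].
    exact: uniq_leaves_child ut cts.
  apply: (H u v b' ts') => //; [| |exact: lca_child cts lc];
    by apply/mem_forest; exists c.
have {H IH} : forall c c' u v, c \in ts -> c' \in ts -> c != c' ->
    u \in leaves c -> v \in leaves c' -> adjacent_as b u v.
  move=> c c' u v cts cts' cc' uc vc'; have lc := lca_root ut cts cts' cc' uc vc'.
  have uv : u != v.
    apply: contraNneq cc' => uv; subst v; apply/eqP.
    exact: uniq_child ut cts cts' uc vc'.
  have uts : u \in leaves (Node b ts) by apply/mem_forest; exists c.
  have vts : v \in leaves (Node b ts) by apply/mem_forest; exists c'.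
  rewrite /adjacent_as uv (H u v b ts) // (H v u b ts) ?eqxx // 1?eq_sym //.
  exact: lca_sym.
elim: ts ut => //= c ts IH; rewrite cat_uniq.
case/and3P=> _ /hasPn dis uts H; rewrite IH // => [|c1 c2 u v h1 h2]; last first.
  by apply: H; rewrite in_cons ?h1 ?h2 orbT.
rewrite andbT; apply/allP => c' cts'; apply/allrelP => u v uc vc'.
have vts : v \in forest_leaves ts by apply/mem_forest; exists c'.
apply: (H c c') => //; rewrite ?mem_head ?in_cons ?cts' ?orbT //.
by apply: contraNneq (dis _ vts) => /= ->.
Qed.

End Represents.
End CotreeOccurrences.

(** The recursive condition is what the proofs manipulate: it is stable under
    passing to subtrees, deleting leaves and merging nodes. *)
Lemma cotree_onP (V : finType) (e : rel V) (S : {set V}) (t : cotree V) :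
  cotree_on e S t <-> [/\ well_formed t, leaves t =i S & represents e t].
Proof.
split=> [[wt ut tS H]|[wt tS R]].
  split=> //; apply: lca_represents => // u v b ts; rewrite !tS => uS vS uv lc.
  case: b lc => lc; first by apply/H => //; exists ts.
  apply/negP => /H[]// ts' lc'.
  by have := lca_uniq ut lc lc'.
have ut := represents_uniq R; split=> // u v; rewrite -!tS => uS vS uv; split.
  have [b [ts lc]] := lca_exists ut uS vS uv.
  by have /and3P[_ /eqP-> _] := represents_lca uv R lc; case: b lc => // lc _; exists ts.
by case=> ts lc; have /and3P[_ /eqP-> _] := represents_lca uv R lc.
Qed.

(** * Heights and siblings *)

Section CotreeTheory.
Variable V : eqType.
Implicit Types (t c s : cotree V) (ts cs : seq (cotree V)) (u v : V).

Fixpoint height t : nat :=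
  if t is Node _ ts then (foldr maxn 0 (map height ts)).+1 else 0.

Lemma height_child b ts c : c \in ts -> height c < height (Node b ts).
Proof.
rewrite /= ltnS; elim: ts => //= a ts IH; rewrite in_cons leq_max.
by case/predU1P => [->|/IH->]; rewrite ?leqnn ?orbT.
Qed.

Lemma height_node b ts h :
  {in ts, forall c, height c <= h} -> height (Node b ts) <= h.+1.
Proof.
rewrite /= ltnS; elim: ts => //= a ts IH H; rewrite geq_max H ?mem_head //=.
by apply: IH => c cts; rewrite H // in_cons cts orbT.
Qed.

Lemma occurs_height t d b ts : occurs t d (Node b ts) -> d < height t.
Proof.
move es: (Node b ts) => s H; elim: H es => {t d s} [t <- //|b' ts1 t ts2 d s _ IH es].
apply: leq_ltn_trans (IH es) _; apply: height_child.
by rewrite mem_cat mem_head orbT.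
Qed.

Lemma is_leafP v t : is_leaf v t -> t = Leaf v.
Proof. by case: t => //= u /eqP->. Qed.

Lemma has_is_leaf v ts : has (is_leaf v) ts = (Leaf v \in ts).
Proof.
apply/hasP/idP => [[c cts /is_leafP <-]//|vts].
by exists (Leaf v); rewrite //= eqxx.
Qed.

Lemma sibling_pair_height t d b k l : sibling_pair t d b k l -> d < height t.
Proof. by case=> ts [/occurs_height]. Qed.

Lemma sibling_pair_leaves t d b k l :
  sibling_pair t d b k l -> k \in leaves t /\ l \in leaves t.
Proof.
case=> ts [/occurs_leaves Ho]; rewrite !has_is_leaf => kts lts _.
by split; apply: Ho; [apply: mem_forest_of kts _|apply: mem_forest_of lts _];
  rewrite mem_seq1.
Qed.

Lemma max_child ts : ts != [::] ->
  exists2 c, c \in ts & height c = foldr maxn 0 (map height ts).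
Proof.
elim: ts => // a ts IH _; case: (eqVneq ts [::]) => [->|/IH[c cts hc]] /=.
  by exists a; rewrite ?mem_head // maxn0.
rewrite -hc maxnC /maxn; case: ltnP => _; first by exists a; rewrite ?mem_head.
by exists c; rewrite // in_cons cts orbT.
Qed.

(** Follow a child of greatest height at each node. *)
Lemma occurs_deepest t : 0 < height t ->
  exists b ts, occurs t (height t).-1 (Node b ts).
Proof.
elim/cotree_nested_ind: t => // b ts IH _.
have [z|nz] := posnP (foldr maxn 0 (map height ts)).
  by exists b, ts; rewrite /= z; constructor.
have [|c cts hc] := @max_child ts; first by apply: contraTneq nz => ->.
rewrite -hc in nz; have [b' [ts' H]] := IH c cts nz.
exists b', ts'; rewrite /= -hc -(prednK nz); exact: occurs_child cts H.
Qed.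

Lemma well_formed_leaf t : well_formed t -> exists u, u \in leaves t.
Proof.
elim/cotree_nested_ind: t => [v _|b [|c ts] // IH /and3P[_ _ /andP[wc _]]].
  by exists v; rewrite mem_seq1.
have [u uc] := IH c (mem_head _ _) wc; exists u.
exact: (mem_forest_of (mem_head _ _) uc).
Qed.

Lemma well_formed_child b ts c : well_formed (Node b ts) -> c \in ts ->
  well_formed c /\ ~~ labelled b c.
Proof. by case/and3P=> _ /hasPn nl /allP wf cts; split; [exact: wf|exact: nl]. Qed.

(** * Uniqueness of cotrees *)

Section Uniqueness.
Variable e : rel V.

Lemma other_child b ts c : well_formed (Node b ts) -> represents e (Node b ts) ->
  c \in ts -> exists2 c', c' \in ts & c' != c.
Proof.
case: ts => [|x [|y ts]] // wf R cts.
have [xc|xc] := eqVneq x c; last by exists x; rewrite ?mem_head.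
exists y; first by rewrite in_cons mem_head orbT.
have [|wy _] := @well_formed_child _ _ y wf; first by rewrite in_cons mem_head orbT.
have [u uy] := well_formed_leaf wy.
rewrite -xc; apply: contraTneq R => yx.
rewrite represents_cons; apply/negP => /and3P[/allrelP H _ _].
have := H u u; rewrite -yx uy /adjacent_as eqxx /=.
by move=> H'; have := H' isT; rewrite (mem_forest_of (mem_head _ _) uy) => /(_ isT).
Qed.

(** Describes the partition of the leaves into children by the graph and the set of
    leaves alone: [u] and [v] are at distance at most two in the graph or,
    below a join, in its complement. *)
Definition linked_by b ts u v :=
  [\/ u = v, e u v = ~~ b
    | exists w, [/\ w \in forest_leaves ts, e u w = ~~ b & e v w = ~~ b]].

(** A child that is not a leaf has the opposite label, and two of its leaves
    below the same grandchild have a common neighbour for that label below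
    another grandchild. Conversely, such a path cannot leave a child. *)
Lemma same_childP b ts c u v : well_formed (Node b ts) ->
  represents e (Node b ts) -> c \in ts -> u \in leaves c ->
  v \in forest_leaves ts -> (v \in leaves c <-> linked_by b ts u v).
Proof.
move=> wf R cts uc vts; split=> [vc|lk].
  have [uv|uv] := eqVneq u v; first exact: Or31.
  have [wc lc] := well_formed_child wf cts; have Rc := represents_child R cts.
  case: c => [w|b' us] in cts uc vc wc lc Rc *.
    by move: uc vc uv; rewrite !inE => /eqP-> /eqP->; rewrite eqxx.
  have b'b : b' = ~~ b by case: (b') (b) lc => [] [].
  have /mem_forest[a aus ua] := uc; have /mem_forest[a' aus' va'] := vc.
  have [aa'|aa'] := eqVneq a a'; last first.
    by apply: Or32; have /and3P[_ /eqP-> _] := represents_cross Rc aus aus' aa' ua va'.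
  subst a'; have [x xus xa] := other_child wc Rc aus.
  have [wx _] := well_formed_child wc xus; have [w wwx] := well_formed_leaf wx.
  apply: Or33; exists w; split; first exact: mem_forest_of cts (mem_forest_of xus wwx).
    by have /and3P[_ _ /eqP->] := represents_cross Rc xus aus xa wwx ua.
  by have /and3P[_ _ /eqP->] := represents_cross Rc xus aus xa wwx va'.
apply: contraT => vc; have /mem_forest[c' cts' vc'] := vts.
have cc' : c != c' by apply: contraNneq vc => ->.
have /and3P[uv /eqP euv /eqP evu] := represents_cross R cts cts' cc' uc vc'.
case: lk => [/eqP|euv'|[w [/mem_forest[a ats wa] euw evw]]].
- by rewrite (negPf uv).
- by move: euv'; rewrite euv; case: (b).
have [ac|ac] := eqVneq a c; last first.
  by have /and3P[_ _ /eqP] := represents_cross R ats cts ac wa uc; rewrite euw; case: (b).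
subst a; have /and3P[_ _ /eqP] := represents_cross R cts cts' cc' wa vc'.
by rewrite evw; case: (b).
Qed.

(** If the labels differed, two leaves [u] and [v] below different children of
    the first tree would share a child of the second one, and a leaf [w] of
    another child of the second tree would link them in the first. *)
Lemma root_label b ts b' ts' :
  well_formed (Node b ts) -> represents e (Node b ts) ->
  well_formed (Node b' ts') -> represents e (Node b' ts') ->
  forest_leaves ts =i forest_leaves ts' -> b = b'.
Proof.
move=> wf R wf' R' tt'; apply: contrapT => /eqP bb'.
have {bb'} bb' : b' = ~~ b by case: (b') (b) bb' => [] [].
case: ts => [//|x ts] in wf R tt' *; have xts := mem_head x ts.
have [y yts yx] := other_child wf R xts.
have [wx _] := well_formed_child wf xts; have [u ux] := well_formed_leaf wx.
have [wy _] := well_formed_child wf yts; have [v vy] := well_formed_leaf wy.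
have /and3P[uv /eqP euv _] : adjacent_as e b u v.
  by apply: represents_cross R xts yts _ ux vy; rewrite eq_sym.
have uts := mem_forest_of xts ux; have vts := mem_forest_of yts vy.
have /mem_forest[c cts' uc] : u \in forest_leaves ts' by rewrite -tt'.
have vc : v \in leaves c.
  apply/(same_childP wf' R' cts' uc); first by rewrite -tt'.
  by apply: Or32; rewrite euv bb' negbK.
have [c' cts'' cc'] := other_child wf' R' cts'.
have [wc' _] := well_formed_child wf' cts''; have [w wc''] := well_formed_leaf wc'.
suff : v \in leaves x.
  move=> vx; have := uniq_child (represents_uniq R) xts yts vx vy.
  by move/eqP; rewrite eq_sym (negPf yx).
apply/(same_childP wf R xts ux vts); apply: Or33; exists w; split.
- by rewrite tt'; exact: mem_forest_of cts'' wc''.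
- by have /and3P[_ _ /eqP->] := represents_cross R' cts'' cts' cc' wc'' uc.
- by have /and3P[_ _ /eqP->] := represents_cross R' cts'' cts' cc' wc'' vc.
Qed.

Lemma child_matching b ts ts' c :
  well_formed (Node b ts) -> represents e (Node b ts) ->
  well_formed (Node b ts') -> represents e (Node b ts') ->
  forest_leaves ts =i forest_leaves ts' -> c \in ts ->
  exists2 c', c' \in ts' & leaves c =i leaves c'.
Proof.
move=> wf R wf' R' tt' cts; have [wc _] := well_formed_child wf cts.
have [u uc] := well_formed_leaf wc; have uts := mem_forest_of cts uc.
have /mem_forest[c' cts' uc'] : u \in forest_leaves ts' by rewrite -tt'.
exists c' => // v; apply/idP/idP => vc.
  have vts := mem_forest_of cts vc.
  apply/(same_childP wf' R' cts' uc'); first by rewrite -tt'.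
  have /(same_childP wf R cts uc vts) := vc.
  by case=> [|| [w [wt h1 h2]]]; [exact: Or31|exact: Or32|apply: Or33; exists w; rewrite -tt'].
have vts := mem_forest_of cts' vc.
apply/(same_childP wf R cts uc); first by rewrite tt'.
have /(same_childP wf' R' cts' uc' vts) := vc.
by case=> [|| [w [wt h1 h2]]]; [exact: Or31|exact: Or32|apply: Or33; exists w; rewrite tt'].
Qed.

Lemma one_leaf t k : well_formed t -> represents e t -> leaves t =i [:: k] ->
  t = Leaf k.
Proof.
case: t => [v|b ts] wf R H; first by have := H v; rewrite !inE eqxx => /esym/eqP->.
case: ts => [//|x ts] in wf R H *; have xts := mem_head x ts.
have [y yts yx] := other_child wf R xts.
have [wx _] := well_formed_child wf xts; have [u ux] := well_formed_leaf wx.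
have [wy _] := well_formed_child wf yts; have [v vy] := well_formed_leaf wy.
have := H u; rewrite (mem_forest_of xts ux) inE => /esym/eqP uk.
have := H v; rewrite (mem_forest_of yts vy) inE => /esym/eqP vk.
by have := represents_cross R yts xts yx vy ux; rewrite uk vk /adjacent_as eqxx.
Qed.

(** Label and children of the root are determined by the graph
    ([root_label], [child_matching]), hence by induction all depths are. This is
    the part of the uniqueness of cotrees that the algorithm relies on. *)
Lemma sibling_pair_unique t t' d b k l :
  well_formed t -> represents e t -> well_formed t' -> represents e t' ->
  leaves t =i leaves t' -> sibling_pair t d b k l -> sibling_pair t' d b k l.
Proof.
elim: d t t' => [|d IH] t t' wf R wf' R' tt' sib;
  have [kt lt] := sibling_pair_leaves sib; case: sib => us [Ho hk hl kl];
  case: t' => [w|b' ts'] in wf' R' tt' *;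
  try (by move: kt lt kl; rewrite !tt' !inE => /eqP-> /eqP->; rewrite eqxx).
  inversion Ho; subst; have bb' := root_label wf R wf' R' tt'; subst b'.
  exists ts'; split=> //; first by constructor.
    move: hk; rewrite !has_is_leaf => kus.
    have [c cts cl] := child_matching wf R wf' R' tt' kus.
    have [wc _] := well_formed_child wf' cts.
    suff <- : c = Leaf k by [].
    by apply: one_leaf wc (represents_child R' cts) _ => u; rewrite -cl.
  move: hl; rewrite !has_is_leaf => lus.
  have [c cts cl] := child_matching wf R wf' R' tt' lus.
  have [wc _] := well_formed_child wf' cts.
  suff <- : c = Leaf l by [].
  by apply: one_leaf wc (represents_child R' cts) _ => u; rewrite -cl.
case: t => [v|b0 ts] in wf R tt' kt lt Ho *; first by inversion Ho.
have bb' := root_label wf R wf' R' tt'; subst b0.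
have [[]//|[d' [c [[<-] cts Hc]]]] := occurs_node Ho.
have [c' cts' cl] := child_matching wf R wf' R' tt' cts.
have [wc _] := well_formed_child wf cts; have [wc' _] := well_formed_child wf' cts'.
have [|vs [Ho' hk' hl' _]] := IH c c' wc (represents_child R cts) wc' (represents_child R' cts') cl.
  by exists us.
by exists vs; split=> //; exact: occurs_child cts' Ho'.
Qed.

Lemma deepest_unique t t' b k l :
  well_formed t -> represents e t -> well_formed t' -> represents e t' ->
  leaves t =i leaves t' ->
  deepest_sibling_pair t b k l -> deepest_sibling_pair t' b k l.
Proof.
move=> wf R wf' R' tt' [d sib Hm]; exists d; first exact: sibling_pair_unique sib.
move=> d' b' k' l' sib'; apply: (Hm d' b' k' l').
by apply: sibling_pair_unique sib' => // u; rewrite tt'.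
Qed.

(** An interior node of greatest depth has at least two children, all of them
    leaves. *)
Lemma deepest_exists t : well_formed t -> represents e t -> 1 < size (leaves t) ->
  exists b k l, deepest_sibling_pair t b k l.
Proof.
move=> wf R sz; have h0 : 0 < height t by case: t sz {wf R}.
have [b [ts Ho]] := occurs_deepest h0.
have wt := occurs_wf Ho wf; have Rt := represents_occurs Ho R.
have isl c : c \in ts -> exists v, c = Leaf v.
  case: c => [v|b' us] cts; first by exists v.
  by have := occurs_height (occurs_below Ho cts); rewrite (prednK h0) ltnn.
case: ts => [//|x ts] in Ho wt Rt isl *; have xts := mem_head x ts.
have [y yts yx] := other_child wt Rt xts.
have [k xk] := isl x xts; have [l yl] := isl y yts.
exists b, k, l, (height t).-1 => [|d' b' k' l' /sibling_pair_height]; last by lia.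
exists (x :: ts); rewrite !has_is_leaf -xk -yl; split=> //.
by apply: contraNneq yx => kl; rewrite xk yl kl.
Qed.

Lemma siblings_adjacent t d b k l : represents e t -> sibling_pair t d b k l ->
  adjacent_as e b k l.
Proof.
move=> R [ts [Ho]]; rewrite !has_is_leaf => kts lts kl.
apply: represents_cross (represents_occurs Ho R) kts lts _ _ _; rewrite ?mem_seq1 //.
by apply: contraNneq kl => -[->].
Qed.

Lemma occurs_module t d s u x y : represents e t -> occurs t d s ->
  u \in leaves t -> u \notin leaves s -> x \in leaves s -> y \in leaves s ->
  e u x = e u y.
Proof.
move=> R Ho; elim: Ho R => {t d s} [t|b ts1 t ts2 d s Ho IH] R ut us xs ys.
  by rewrite ut in us.
have tts : t \in ts1 ++ t :: ts2 by rewrite mem_cat mem_head orbT.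
have /mem_forest[c cts uc] := ut.
have [ct|ct] := eqVneq c t.
  by apply: IH => //; [exact: represents_child R tts|rewrite -ct].
have /and3P[_ /eqP-> _] := represents_cross R cts tts ct uc (occurs_leaves Ho xs).
by have /and3P[_ /eqP-> _] := represents_cross R cts tts ct uc (occurs_leaves Ho ys).
Qed.

(** Below the common parent the label decides; elsewhere the leaves of a
    subtree form a module. *)
Lemma siblings_twins t d b k l u : represents e t -> sibling_pair t d b k l ->
  u \in leaves t -> u != k -> u != l -> e u k = e u l.
Proof.
move=> R [ts [Ho]]; rewrite !has_is_leaf => kts lts kl ut uk ul.
have [/mem_forest[c cts uc]|us] := boolP (u \in leaves (Node b ts)); last first.
  apply: occurs_module R Ho ut us _ _;
    [exact: mem_forest_of kts (mem_head _ _)|exact: mem_forest_of lts (mem_head _ _)].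
have Rs := represents_occurs Ho R.
have ck : c != Leaf k by apply: contraNneq uk => ck; rewrite ck mem_seq1 in uc.
have cl : c != Leaf l by apply: contraNneq ul => cl; rewrite cl mem_seq1 in uc.
have /and3P[_ /eqP-> _] := represents_cross Rs cts kts ck uc (mem_head _ _).
by have /and3P[_ /eqP-> _] := represents_cross Rs cts lts cl uc (mem_head _ _).
Qed.

Lemma represents_sym t u v : represents e t -> u \in leaves t -> v \in leaves t ->
  e u v = e v u.
Proof.
move=> R ut vt; have [->//|uv] := eqVneq u v.
have [b [ts lc]] := lca_exists (represents_uniq R) ut vt uv.
by have /and3P[_ /eqP-> /eqP->] := represents_lca uv R lc.
Qed.

End Uniqueness.

(** * Normal form of a labelled tree *)

(** What a normalized child contributes to the children of a node labelled
    [b]. *)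
Definition opened b (o : option (cotree V)) : seq (cotree V) :=
  match o with
  | None => [::]
  | Some (Leaf v) => [:: Leaf v]
  | Some (Node c us) => if c == b then us else [:: Node c us]
  end.

Definition collapsed b cs : option (cotree V) :=
  match cs with
  | [::] => None
  | [:: c] => Some c
  | _ => Some (Node b cs)
  end.

(** Deleting leaves and flipping labels lead to empty nodes, nodes with one child
    and nodes with the label of their parent; [norm] removes these defects and
    changes neither the leaves nor the adjacencies. *)
Fixpoint norm t : option (cotree V) :=
  match t with
  | Leaf v => Some (Leaf v)
  | Node b ts => collapsed b (flatten [seq opened b (norm c) | c <- ts])
  end.

Definition norm_children b ts := flatten [seq opened b (norm c) | c <- ts].

Definition option_leaves (o : option (cotree V)) : seq V :=
  if o is Some t then leaves t else [::].

Lemma leaves_opened b o : forest_leaves (opened b o) = option_leaves o.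
Proof.
case: o => [[v|c us]|] //=; case: ifP => // _.
by rewrite /forest_leaves /= cats0.
Qed.

Lemma leaves_collapsed b cs : option_leaves (collapsed b cs) = forest_leaves cs.
Proof. by case: cs => [|c [|c' cs]] //=; rewrite /forest_leaves /= cats0. Qed.

Lemma leaves_norm t : option_leaves (norm t) = leaves t.
Proof.
elim/cotree_nested_ind: t => //= b ts IH; rewrite leaves_collapsed.
elim: ts IH => //= c ts IHts IH; rewrite forest_leaves_cat leaves_opened IH ?mem_head //.
by congr cat; apply: IHts => a ats; rewrite IH // in_cons ats orbT.
Qed.

Lemma leaves_norm_children b ts : forest_leaves (norm_children b ts) = forest_leaves ts.
Proof. by rewrite -(leaves_collapsed b) -[collapsed _ _]/(norm (Node b ts)) leaves_norm. Qed.

Lemma norm_children_cons b c ts :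
  norm_children b (c :: ts) = opened b (norm c) ++ norm_children b ts.
Proof. by []. Qed.

Lemma norm_wf t s : norm t = Some s -> well_formed s.
Proof.
elim/cotree_nested_ind: t s => [v s [<-]//|b ts IH s].
have : all (fun c => well_formed c && ~~ labelled b c) (norm_children b ts).
  apply/allP => x /flatten_mapP[c cts]; case E: (norm c) => [a|] //=.
  have := IH c cts _ E; case: a {E} => [v _|c' us /= /and3P[sz nl wf]].
    by rewrite inE => /eqP->.
  case: ifP => [/eqP<- xus|c'b].
    by rewrite (allP wf x xus) (hasPn nl x xus).
  by rewrite inE => /eqP->; rewrite /= c'b sz nl wf.
rewrite /= -/(norm_children b ts); case: (norm_children b ts) => [|x [|y cs]] //.
  by rewrite /= andbT => /andP[wx _] [<-].
rewrite -/(all _ (x :: y :: cs)) => /allP H [<-]; apply/and3P; split=> //.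
  by apply/hasPn => c /H/andP[].
by apply/allP => c /H/andP[].
Qed.

Lemma represents_norm e t s : represents e t -> norm t = Some s -> represents e s.
Proof.
elim/cotree_nested_ind: t s => [v s _ [<-]//|b ts IH s R].
have : represents e (Node b (norm_children b ts)).
  elim: ts IH R => // c ts IHts IH; rewrite represents_cons => /and3P[cr Rc R].
  rewrite norm_children_cons represents_cat leaves_opened leaves_norm.
  rewrite leaves_norm_children cr IHts ?andbT //=; last first.
    by move=> a ats; apply: IH; rewrite in_cons ats orbT.
  case E: (norm c) => [[v|c' us]|] //=.
  have Rc' := IH c (mem_head _ _) _ Rc E.
  by case: ifP => [/eqP<-//|_]; apply/andP; rewrite /= andbT.
rewrite /= -/(norm_children b ts); case: (norm_children b ts) => [|x [|y cs]] //=.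
  by rewrite !andbT => Rx [<-].
by move=> H [<-].
Qed.

(** Together with [norm_occurs] below this locates the deepest siblings of a
    normal form: nodes only move upwards. *)
Lemma height_norm t s : norm t = Some s -> height s <= height t.
Proof.
elim/cotree_nested_ind: t s => [v s [<-]//|b ts IH s].
have H : {in norm_children b ts, forall x, height x <= foldr maxn 0 (map height ts)}.
  move=> x /flatten_mapP[c cts]; rewrite -ltnS => xc.
  apply: leq_ltn_trans (height_child b cts).
  case E: (norm c) xc => [[v|c' us]|] //=; first by rewrite inE => /eqP->.
  have := IH c cts _ E; case: ifP => [_ h xus|_ h]; last by rewrite inE => /eqP->.
  by apply: leq_trans (ltnW (height_child c' xus)) h.
rewrite /= -/(norm_children b ts); case: (norm_children b ts) H => [|x [|y cs]] //= H.
  by move=> [<-]; apply: leqW; apply: H; rewrite mem_head.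
by move=> [<-]; exact: (@height_node b (x :: y :: cs)).
Qed.

(** * Deletion of a leaf *)

(** The hole left by [k] is an empty node, which [norm] removes. *)
Fixpoint prune k t : cotree V :=
  match t with
  | Leaf v => if v == k then Node true [::] else Leaf v
  | Node b ts => Node b (map (prune k) ts)
  end.

Lemma leaves_prune k t : leaves (prune k t) = [seq v <- leaves t | v != k].
Proof.
elim/cotree_nested_ind: t => [v|b ts IH] /=; first by case: eqP.
rewrite filter_flatten -!map_comp; congr flatten; apply/eq_in_map => c cts /=.
exact: IH.
Qed.

Lemma represents_prune e k t : represents e t -> represents e (prune k t).
Proof.
elim/cotree_nested_ind: t => [v _|b ts IH /= /andP[pw Rs]]; first by rewrite /=; case: ifP.
apply/andP; split; last first.
  by rewrite all_map; apply/allP => c cts; apply: IH => //; exact: (allP Rs).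
rewrite pairwise_map; apply: sub_pairwise pw => c c' cr.
apply/allrelP => u v; rewrite !leaves_prune !mem_filter => /andP[_ uc] /andP[_ vc].
exact: crossE cr uc vc.
Qed.

End CotreeTheory.

Local Open Scope ring_scope.

(** * Congruence of the matrices along a run *)

Section Congruence.
Variables (R : realType) (n : nat).
Implicit Types (M N : 'M[R]_n) (S : {set 'I_n}).

Lemma congruent_refl M : congruent M M.
Proof. by exists 1%:M; rewrite ?unitmx1 // trmx1 mul1mx mulmx1. Qed.

Lemma congruent_trans M N K : congruent M N -> congruent N K -> congruent M K.
Proof.
move=> [P uP ->] [Q uQ ->]; exists (Q *m P); first by rewrite unitmx_mul uQ.
by rewrite trmx_mul !mulmxA.
Qed.

(** Add to each row [i] the multiple [v i] of row [k], and likewise for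
    columns. As [v k = 0], the change of basis has the form [1 + N] with
    [N ^ 2 = 0], so [1 - N] is its inverse. *)
Lemma congruent_shear M (k : 'I_n) (v : 'I_n -> R) : v k = 0 ->
  congruent (\matrix_(i, j) (M i j + v i * M k j + v j * M i k + v i * v j * M k k)) M.
Proof.
move=> vk; pose N : 'M[R]_n := delta_mx k 0 *m \row_j v j.
have NE i j : N i j = (i == k)%:R * v j.
  by rewrite mxE big_ord1 !mxE eqxx andbT.
have sumN (f : 'I_n -> R) : \sum_a (a == k)%:R * f a = f k.
  by rewrite (bigD1 k) //= eqxx mul1r big1 ?addr0 // => a /negPf->; rewrite mul0r.
have NN : N *m N = 0.
  apply/matrixP => i j; rewrite !mxE big1 // => a _; rewrite !NE.
  by case: (a =P k) => [->|_]; rewrite ?vk /= ?mulr0 ?mul0r ?mulr0.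
exists (1%:M + N).
  have : (1%:M + N) *m (1%:M - N) = 1%:M.
    by rewrite mulmxDl mulmxBr mulmxBr !mul1mx mulmx1 NN subr0 addrNK.
  by case/mulmx1_unit.
have MN i j : (M *m N) i j = M i k * v j.
  rewrite mxE -(sumN (fun a => M i a * v j)); apply: eq_bigr => a _.
  by rewrite NE; ring.
have NM (K : 'M[R]_n) i j : (N^T *m K) i j = v i * K k j.
  rewrite mxE -(sumN (fun a => v i * K a j)); apply: eq_bigr => a _.
  by rewrite mxE NE; ring.
have -> : (1%:M + N)^T = 1%:M + N^T by rewrite linearD /= trmx1.
have addE (A B : 'M[R]_n) i j : (A + B) i j = A i j + B i j by rewrite mxE.
rewrite mulmxDl mul1mx mulmxDr mulmx1.
apply/matrixP => i j; rewrite [LHS]mxE !addE mulmxDl addE MN -mulmxA !NM MN; ring.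
Qed.

(** The matrix that the algorithm has implicitly reached when [S] is the set of
    vertices of its cotree. *)
Definition deflated (e : rel 'I_n) S (d : 'I_n -> R) : 'M[R]_n :=
  \matrix_(i, j) if i == j then d i else ((i \in S) && (j \in S) && e i j)%:R.

(** [G kk kl ll s] is the matrix in which [k] is cleared outside the block of
    [k] and [l], this block has the entries [kk], [kl] and [ll], and the rest of row [l]
    is multiplied by [s]. First [l] is subtracted from [k] ([step1]). If the new entry
    [kk] is not zero it clears [kl] ([step2]); if both vanish nothing is left to do;
    otherwise [kl] clears the rest of row [l] ([step3]), and a last shear
    makes the block diagonal ([step4]). *)
Lemma new_values_congruent (e : rel 'I_n) S (d d' : 'I_n -> R) (k l : 'I_n) b dk dl rem_l :
  k \in S -> l \in S -> k != l -> e k l = b -> e l k = b ->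
  {in S &, forall u v, e u v = e v u} ->
  {in S, forall u, u != k -> u != l -> e u k = e u l} ->
  new_values b (d k) (d l) = (dk, dl, rem_l) ->
  d' =1 (fun i => if i == k then dk else if i == l then dl else d i) ->
  congruent (deflated e (if rem_l then S :\ k :\ l else S :\ k) d') (deflated e S d).
Proof.
move=> kS lS kl ekl elk esym twins nv dE.
have lk : (l == k) = false by rewrite eq_sym (negPf kl).
pose r u : R := [&& u \in S, u != k, u != l & e u l]%:R.
pose bR : R := b%:R.
pose G (kk kl ll s : R) : 'M[R]_n := \matrix_(i, j)
  if i == k then (if j == k then kk else if j == l then kl else 0)
  else if i == l then (if j == k then kl else if j == l then ll else s * r j)
  else if j == k then 0 else if j == l then s * r i else deflated e S d i j.
have rk : r k = 0 by rewrite /r eqxx /= andbF.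
have rl : r l = 0 by rewrite /r eqxx /= !andbF.
have DM i j : deflated e S d i j =
  if i == k then (if j == k then d k else if j == l then bR else r j)
  else if i == l then (if j == k then bR else if j == l then d l else r j)
  else if j == k then r i else if j == l then r i else deflated e S d i j.
  rewrite !mxE; have [->|ik] := eqVneq i k.
    have [_|jk] := eqVneq j k; first by [].
    have [->|jl] := eqVneq j l; first by rewrite kS lS ekl.
    rewrite kS /r jk jl /=; case jS : (j \in S) => //=.
    by rewrite esym // twins.
  have [->|il] := eqVneq i l.
    have [->|jk] := eqVneq j k; first by rewrite kS lS elk lk.
    have [_|jl] := eqVneq j l; first by [].
    rewrite lS /r jk jl /=; case jS : (j \in S) => //=.
    by rewrite esym.
  have [->|jk] := eqVneq j k.
    rewrite (negPf ik) kS andbT /r ik il /=; case iS : (i \in S) => //=.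
    by rewrite twins.
  have [->|jl //] := eqVneq j l.
  by rewrite (negPf il) lS andbT /r ik il.
have GE kk kl' ll s i j : G kk kl' ll s i j =
  if i == k then (if j == k then kk else if j == l then kl' else 0)
  else if i == l then (if j == k then kl' else if j == l then ll else s * r j)
  else if j == k then 0 else if j == l then s * r i else deflated e S d i j.
  by rewrite mxE.
have final s rm : s = (~~ rm)%:R ->
    deflated e (if rm then S :\ k :\ l else S :\ k) d' = G dk 0 dl s.
  move=> ->; apply/matrixP => i j; rewrite GE !mxE dE.
  have [->|ik] := eqVneq i k.
    rewrite [k == j]eq_sym; have [//|jk] := eqVneq j k.
    by case: (rm); rewrite !inE eqxx /= ?andbF /=; case: eqP.
  have [->|il] := eqVneq i l.
    rewrite [l == j]eq_sym; have [->|jk] := eqVneq j k.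
      by rewrite eq_sym lk; case: (rm); rewrite !inE eqxx /= ?andbF.
    have [//|jl] := eqVneq j l.
    case: (rm) => /=; first by rewrite !inE eqxx mul0r.
    rewrite mul1r /r !inE lk jk jl lS /=; case jS: (j \in S) => //=.
    by rewrite esym.
  have [->|jk] := eqVneq j k.
    by rewrite (negPf ik); case: (rm); rewrite !inE eqxx /= !andbF.
  have [->|jl] := eqVneq j l.
    rewrite (negPf il); case: (rm) => /=; first by rewrite !inE eqxx /= andbF mul0r.
    by rewrite mul1r /r !inE ik il lk lS /= andbT.
  by case: eqP => // _; case: (rm); rewrite !inE ik jk ?il ?jl.
move: final DM GE; set M := deflated e S d => final DM GE.
clearbody r M G; clear esym twins dE ekl elk.
have nine (P : 'I_n -> 'I_n -> Prop) : P k k -> P k l ->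
    (forall u, u != k -> u != l -> P k u) -> P l k -> P l l ->
    (forall u, u != k -> u != l -> P l u) -> (forall u, u != k -> u != l -> P u k) ->
    (forall u, u != k -> u != l -> P u l) ->
    (forall u w, u != k -> u != l -> w != k -> w != l -> P u w) -> forall i j, P i j.
  move=> ????????? i j; have [->|ik] := eqVneq i k.
    by have [->|jk] := eqVneq j k; [|have [->|jl] := eqVneq j l; auto].
  have [->|il] := eqVneq i l.
    by have [->|jk] := eqVneq j k; [|have [->|jl] := eqVneq j l; auto].
  by have [->|jk] := eqVneq j k; [auto|have [->|jl] := eqVneq j l; auto].
have Mkk : M k k = d k by rewrite DM eqxx.
have Mkl : M k l = bR by rewrite DM !eqxx lk.
have Mlk : M l k = bR by rewrite DM !eqxx lk.
have Mll : M l l = d l by rewrite DM !eqxx lk.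
have Mku u : u != k -> u != l -> M k u = r u.
  by move=> uk ul; rewrite DM eqxx (negPf uk) (negPf ul).
have Mlu u : u != k -> u != l -> M l u = r u.
  by move=> uk ul; rewrite DM lk eqxx (negPf uk) (negPf ul).
have Muk u : u != k -> u != l -> M u k = r u.
  by move=> uk ul; rewrite DM eqxx (negPf uk) (negPf ul).
have Mul u : u != k -> u != l -> M u l = r u.
  by move=> uk ul; rewrite DM lk eqxx (negPf uk) (negPf ul).
have step1 : congruent (G (d k + d l - 2 * bR) (bR - d l) (d l) 1) (M).
  have -> : G (d k + d l - 2 * bR) (bR - d l) (d l) 1 =
     \matrix_(i, j) (M i j + (- (i == k)%:R) * M l j
       + (- (j == k)%:R) * M i l
       + (- (i == k)%:R) * (- (j == k)%:R) * M l l).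
    apply/matrixP => i j; rewrite GE [RHS]mxE.
    move: i j; apply: nine => [|| u uk ul||| u uk ul| u uk ul| u uk ul| u w uk ul wk wl];
      rewrite ?eqxx ?lk ?(negPf kl) ?(negPf uk) ?(negPf ul) ?(negPf wk) ?(negPf wl) ?Mkk ?Mkl ?Mlk ?Mll ?Mku ?Mlu ?Muk ?Mul //=;
      ring.
  by apply: congruent_shear; rewrite lk oppr0.
have step2 kk kl' ll s c : congruent (G kk (kl' + c * kk) (ll + 2 * c * kl' + c ^+ 2 * kk) s)
    (G kk kl' ll s).
  have -> : G kk (kl' + c * kk) (ll + 2 * c * kl' + c ^+ 2 * kk) s =
     \matrix_(i, j) (G kk kl' ll s i j + (c * (i == l)%:R) * G kk kl' ll s k j
       + (c * (j == l)%:R) * G kk kl' ll s i k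
       + (c * (i == l)%:R) * (c * (j == l)%:R) * G kk kl' ll s k k).
    apply/matrixP => i j; rewrite [RHS]mxE !GE.
    move: i j; apply: nine => [|| u uk ul||| u uk ul| u uk ul| u uk ul| u w uk ul wk wl];
      rewrite ?eqxx ?lk ?(negPf kl) ?(negPf uk) ?(negPf ul) ?(negPf wk) ?(negPf wl) ?rk ?rl /=;
      ring.
  by apply: congruent_shear; rewrite (negPf kl) mulr0.
have step3 kl' ll c : kl' != 0 -> congruent (G 0 kl' (ll + 2 * c * kl') 0) (G 0 kl' ll 1).
  move=> nz; pose v i := c * (i == l)%:R - r i / kl'.
  have -> : G 0 kl' (ll + 2 * c * kl') 0 =
     \matrix_(i, j) (G 0 kl' ll 1 i j + v i * G 0 kl' ll 1 k j
       + v j * G 0 kl' ll 1 i k + v i * v j * G 0 kl' ll 1 k k).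
    apply/matrixP => i j; rewrite [RHS]mxE !GE /v.
    move: i j; apply: nine => [|| u uk ul||| u uk ul| u uk ul| u uk ul| u w uk ul wk wl];
      rewrite ?eqxx ?lk ?(negPf kl) ?(negPf uk) ?(negPf ul) ?(negPf wk) ?(negPf wl) ?rk ?rl /=;
      by field.
  by apply: congruent_shear; rewrite /v rk (negPf kl) mulr0 mul0r subr0.
have step4 kk kl' ll c : congruent (G (kk + 2 * c * kl' + c ^+ 2 * ll) (kl' + c * ll) ll 0)
    (G kk kl' ll 0).
  have -> : G (kk + 2 * c * kl' + c ^+ 2 * ll) (kl' + c * ll) ll 0 =
     \matrix_(i, j) (G kk kl' ll 0 i j + (c * (i == k)%:R) * G kk kl' ll 0 l j
       + (c * (j == k)%:R) * G kk kl' ll 0 i l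
       + (c * (i == k)%:R) * (c * (j == k)%:R) * G kk kl' ll 0 l l).
    apply/matrixP => i j; rewrite [RHS]mxE !GE.
    move: i j; apply: nine => [|| u uk ul||| u uk ul| u uk ul| u uk ul| u w uk ul wk wl];
      rewrite ?eqxx ?lk ?(negPf kl) ?(negPf uk) ?(negPf ul) ?(negPf wk) ?(negPf wl) ?rk ?rl /=;
      ring.
  by apply: congruent_shear; rewrite lk mulr0.
(* In the third cases, adding half of [k] to [l] turns the entry [ll] into 1
   for a join; for a union it is left alone. *)
apply: (congruent_trans _ step1); clear step1; rewrite /bR {bR DM Mkl Mlk}.
have finala : deflated e (S :\ k) d' = G dk 0 dl 1 := final 1 false erefl.
have finalc : deflated e (S :\ k :\ l) d' = G dk 0 dl 0 := final 0 true erefl.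
have two : (2 : R) != 0 by rewrite pnatr_eq0.
move: nv; rewrite /new_values; case: (b).
  have [s2|s2] /= := eqVneq (d k + d l) 2.
    have [l1|l1] := eqVneq (d l) 1.
      case=> h1 h2 h3; subst rem_l; rewrite finala.
      rewrite -h1 -h2 s2 l1 mulr1 !subrr; exact: congruent_refl.
    have nz : 1 - d l != 0 by rewrite subr_eq0 eq_sym.
    case=> h1 h2 h3; subst rem_l; rewrite finalc.
    rewrite s2 mulr1 subrr; apply: congruent_trans (step3 _ _ (2%:R^-1) nz).
    have -> : d l + 2 * 2^-1 * (1 - d l) = 1 :> R by field.
    have := step4 0 (1 - d l) 1 (- (1 - d l)).
    rewrite -h1 -h2; congr (congruent (G _ _ _ _) _); ring.
  case=> h1 h2 h3; subst rem_l; rewrite finala.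
  have nz : d k + d l - 2 != 0 by rewrite subr_eq0.
  have := step2 (d k + d l - 2) (1 - d l) (d l) 1 (- (1 - d l) / (d k + d l - 2)).
  rewrite mulr1 -h1 -h2; congr (congruent (G _ _ _ _) _); by field.
have [s2|s2] /= := eqVneq (d k + d l) 0.
  have [l1|l1] := eqVneq (d l) 0.
    case=> h1 h2 h3; subst rem_l; rewrite finala.
    rewrite -h1 -h2 s2 l1 mulr0 !subrr; exact: congruent_refl.
  have nz : 0 - d l != 0 by rewrite sub0r oppr_eq0.
  case=> h1 h2 h3; subst rem_l; rewrite finalc.
  rewrite s2 mulr0 subrr; apply: congruent_trans (step3 _ _ 0 nz).
  have := step4 0 (0 - d l) (d l) 1.
  rewrite -h1 -h2; congr (congruent (G _ _ _ _) (G _ _ _ _)); ring.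
case=> h1 h2 h3; subst rem_l; rewrite finala.
have := step2 (d k + d l) (0 - d l) (d l) 1 (d l / (d k + d l)).
rewrite mulr0 subr0 -h1 -h2; congr (congruent (G _ _ _ _) _); by field.
Qed.

End Congruence.

Local Close Scope ring_scope.

Local Open Scope ring_scope.

(** * All runs *)

Lemma cograph_irreflexive (V : finType) (e : rel V) : cograph e -> irreflexive e.
Proof.
elim=> {V e} [//|V W e f _ IHe _ IHf [u|u] //=|V W e f _ IHe _ IHf [u|u] //=|].
move=> V W e f h [g _ gK] hf _ IH u; rewrite -(gK u) hf; exact: IH.
Qed.

Section Runs.
Variables (R : realType) (n : nat) (e : rel 'I_n).
Implicit Types (S : {set 'I_n}) (t : cotree 'I_n) (T : option (cotree 'I_n)).

Definition option_cotree_on S T : Prop :=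
  if T is Some t then cotree_on e S t else S = set0.

Lemma option_cotree_on_num S T : option_cotree_on S T -> num_leaves T = #|S|.
Proof.
case: T => [t [_ ut tS _]|->] /=; last by rewrite cards0.
by rewrite -(card_uniqP ut); apply: eq_card.
Qed.

Lemma norm_cotree_on S t : represents e t -> leaves t =i S ->
  option_cotree_on S (norm t).
Proof.
move=> Rt tS; have := leaves_norm t; case E: (norm t) => [s|] /= ls.
  apply/cotree_onP; split; [exact: norm_wf E|by move=> u; rewrite ls tS|].
  exact: represents_norm Rt E.
by apply/setP => u; rewrite -tS -ls in_set0 in_nil.
Qed.

Lemma cotree_minusE S t k T : cotree_on e S t ->
  cotree_minus e t k T <-> option_cotree_on (S :\ k) T.
Proof.
case=> _ _ tS _; rewrite /cotree_minus.
by have -> : [set u in leaves t] = S by apply/setP => u; rewrite inE tS.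
Qed.

Lemma cotree_minus_exists S t k : cotree_on e S t ->
  exists T, cotree_minus e t k T.
Proof.
move=> tS; exists (norm (prune k t)); apply/(cotree_minusE _ _ tS).
have [_ lS Rt] := (cotree_onP _ _ _).1 tS.
apply: norm_cotree_on; first exact: represents_prune.
by move=> u; rewrite leaves_prune mem_filter lS !inE.
Qed.

Lemma diag_step_cotree_on S t d tr (s : diag_state R n) : cotree_on e S t ->
  @diag_step R n e (Some t, d) tr s ->
  exists S', [/\ option_cotree_on S' s.1, S' \proper S, size tr = 2%N
    & congruent (deflated e S' s.2) (deflated e S d)].
Proof.
move=> tS H; inversion H as [t0 t1 T d0 b k l dk dl rem_l sz [dp sib _] nv mk ml]; subst.
move/(cotree_minusE k (Some t1) tS): mk => /= mk.
have [_ lS Rt] := (cotree_onP _ _ _).1 tS.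
have [kt lt] := sibling_pair_leaves sib; rewrite !lS in kt lt.
have /and3P[kl /eqP ekl /eqP elk] := siblings_adjacent Rt sib.
exists (if rem_l then S :\ k :\ l else S :\ k); split=> //=.
- by case: rem_l ml {nv H} => [/(cotree_minusE _ _ mk)|->].
- case: (rem_l); last by rewrite properD1.
  by apply: sub_proper_trans (properD1 kt); exact: subD1set.
apply: new_values_congruent kt lt kl ekl elk _ _ nv _ => [u v uS vS|u uS uk ul|i].
- by apply: represents_sym Rt _ _; rewrite lS.
- by apply: siblings_twins Rt sib _ uk ul; rewrite lS.
- by rewrite ffunE.
Qed.

Lemma diag_step_exists S t d : cotree_on e S t -> (1 < size (leaves t))%N ->
  exists tr s, @diag_step R n e (Some t, d) tr s.
Proof.
move=> tS sz; have [wt lS Rt] := (cotree_onP _ _ _).1 tS.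
have [b [k [l deep]]] := deepest_exists wt Rt sz.
case nv: (new_values b (d k) (d l)) => [[dk dl] rem_l].
have [T mk] := cotree_minus_exists k tS.
have [dp sib _] := deep; have [kt lt] := sibling_pair_leaves sib.
have /and3P[kl _ _] := siblings_adjacent Rt sib.
have mk' := (cotree_minusE k T tS).1 mk.
case: T mk mk' => [t1|] mk mk'; last first.
  by have := in_set0 l; rewrite -mk' !inE eq_sym kl -lS lt.
have [T ml] := cotree_minus_exists l mk'.
case: rem_l nv => nv; do 2 eexists; first exact: DiagStep deep nv mk ml.
exact: DiagStep deep nv mk (erefl _).
Qed.

(** Two assignments and at least one deletion per iteration give the bound on
    the length of the trace. *)
Lemma diag_run_sound (s0 s : diag_state R n) tr S0 : diag_run e s0 tr s -> option_cotree_on S0 s0.1 ->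
  exists S, [/\ option_cotree_on S s.1, (size tr + 2 * #|S| <= 2 * #|S0|)%N
    & congruent (deflated e S s.2) (deflated e S0 s0.2)].
Proof.
move=> H; elim: H S0 => {s0 tr s} [s|s1 tr s2 tr' s3 st _ IH] S0 s0S.
  by exists S0; split=> //; exact: congruent_refl.
have [S1 [cS1 pS1 sz c1]] : exists S', [/\ option_cotree_on S' s2.1, S' \proper S0,
    size tr = 2%N & congruent (deflated e S' s2.2) (deflated e S0 s1.2)].
  by case: s1 st s0S => [[t|] d] st s0S; [exact: diag_step_cotree_on st|inversion st].
have [S [cS le c2]] := IH S1 cS1; exists S; split=> //.
  by rewrite size_cat sz; have := proper_card pS1; lia.
exact: congruent_trans c2 c1.
Qed.

Lemma diag_run_cat (s1 s2 s3 : diag_state R n) tr tr' :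
  diag_run e s1 tr s2 -> diag_run e s2 tr' s3 -> diag_run e s1 (tr ++ tr') s3.
Proof.
elim=> {s1 tr s2} [//|s1 tr s2 tr2 s4 st _ IH] /IH H.
by rewrite -catA; exact: DiagRunStep st H.
Qed.

(** With at most one vertex left, the current matrix is the diagonal matrix of
    the [d_i]. *)
Lemma diag_run_correct t (x : R) tr (s : diag_state R n) :
  irreflexive e -> cotree_on e [set: 'I_n] t -> diag_run e (diag_start t x) tr s ->
  [/\ (size tr <= 2 * n)%N,
      (1 < num_leaves s.1)%N -> exists tr' s', diag_step e s tr' s'
    & (num_leaves s.1 <= 1)%N ->
      congruent (diag_mx (\row_i s.2 i)) (adjacency R e + x%:M)].
Proof.
move=> irr tT /diag_run_sound H; have {H} [S [cS sz c]] := H setT tT; split.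
- by rewrite cardsT card_ord in sz; apply: leq_trans sz; exact: leq_addr.
- case: s cS {c} => [[t'|] d] //= cS; exact: diag_step_exists cS.
rewrite (option_cotree_on_num cS) => S1.
have <- : deflated e [set: 'I_n] (diag_start t x).2 = adjacency R e + x%:M.
  apply/matrixP => i j; rewrite !mxE !ffunE !inE /=; case: eqP => [->|_].
    by rewrite irr mulr1n add0r.
  by rewrite mulr0n addr0.
suff -> : diag_mx (\row_i s.2 i) = deflated e S s.2 by [].
apply/matrixP => i j; rewrite !mxE; have [->|ij] := eqVneq i j; first by rewrite mulr1n.
rewrite mulr0n; case: (boolP (_ && _)) => [/andP[/andP[iS jS] _]|//].
by move: ij; rewrite (card_le1_eqP S1 i j iS jS) eqxx.
Qed.

End Runs.

Local Close Scope ring_scope.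

(** * Trees assembled from arrays *)

Lemma upd_same (T : Type) (f : nat -> T) a v : upd f a v a = v.
Proof. by rewrite /upd eqxx. Qed.

Lemma upd_other (T : Type) (f : nat -> T) a v i : i != a -> upd f a v i = f i.
Proof. by rewrite /upd => /negPf->. Qed.

Lemma upd_upd (T : Type) (f : nat -> T) a v v' : upd (upd f a v) a v' = upd f a v'.
Proof. by apply/funext => i; rewrite /upd; case: eqP. Qed.

Lemma upd_id (T : Type) (f : nat -> T) a : upd f a (f a) = f.
Proof. by apply/funext => i; rewrite /upd; case: eqP => // ->. Qed.

Section Assembly.
Variable V : eqType.
Implicit Types (t s : cotree V) (ts cs : seq (cotree V)) (u v : V).
Implicit Types (par lab dep : nat -> nat) (ord : seq nat) (F : nat -> seq (cotree V)).

(** The node [w] with its children [F w] becomes a child of its parent. Labels are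
    natural numbers, as in the code of a cotree: 1 for a join, 0 for a union, and
    2 for the sentinel. *)
Definition attach par lab F w : nat -> seq (cotree V) :=
  upd F (par w) (Node (lab w == 1) (F w) :: F (par w)).

(** The list [ord] has the nodes in an order in which children come before their
    parents, and node 0 is the sentinel. The recursion follows the order in which
    the algorithm handles the nodes, so that handling one is a change of [F]. *)
Fixpoint assemble par lab ord F : seq (cotree V) :=
  if ord is w :: ord' then assemble par lab ord' (attach par lab F w) else F 0.

Fixpoint bottom_up par ord : bool :=
  if ord is w :: ord' then
    [&& w \notin 0 :: ord', par w \in 0 :: ord' & bottom_up par ord']
  else true.

(** The nodes in [ord] that are children of [j] are yet to be attached. *)
Definition arity par ord (T : Type) (F : nat -> seq T) j : nat :=
  size (F j) + count (fun c => par c == j) ord.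

Lemma bottom_up_par par ord c :
  bottom_up par ord -> c \in ord -> par c \in 0 :: ord.
Proof.
elim: ord => //= w ord IH /and3P[_ pw bu]; rewrite in_cons => /predU1P[->|/(IH bu)].
  by move: pw; rewrite !in_cons => /orP[->|->]; rewrite ?orbT.
by rewrite !in_cons => /orP[->|->]; rewrite ?orbT.
Qed.

Lemma bottom_up_uniq par ord : bottom_up par ord -> uniq (0 :: ord).
Proof.
elim: ord => //= w ord IH /and3P[+ _ /IH/andP[h0 hu]].
by rewrite !in_cons !negb_or eq_sym => /andP[-> ->]; rewrite h0 hu.
Qed.

Lemma bottom_up_head par w ord c :
  bottom_up par (w :: ord) -> c \in w :: ord -> par c != w.
Proof.
move=> /= /and3P[w0 pw bu]; rewrite in_cons => /predU1P[->|/(bottom_up_par bu) pc].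
  by apply: contraNneq w0 => {1}<-.
by apply: contraNneq w0 => <-.
Qed.

Lemma bottom_up_insert par ds ord x : bottom_up par (ds ++ ord) ->
  x \notin 0 :: ds ++ ord -> par x \in 0 :: ord -> bottom_up par (ds ++ x :: ord).
Proof.
elim: ds => [|d ds IH] /=; first by move=> -> -> ->.
case/and3P=> d0 pd bu; rewrite !(in_cons, mem_cat) !negb_or => /and4P[x0 xd xds xo] px.
rewrite IH // ?andbT; last by rewrite !(in_cons, mem_cat) !negb_or x0 xds xo.
move: d0 pd; rewrite !(in_cons, mem_cat) !negb_or => /and3P[-> -> ->] /=.
rewrite [d == x]eq_sym xd /= => /or3P[->|->|->]; rewrite ?orbT //.
Qed.

Lemma flatten_upd (T : eqType) (G : nat -> seq T) (s : seq nat) p x :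
  uniq s -> p \in s ->
  perm_eq (flatten [seq upd G p (x ++ G p) j | j <- s]) (x ++ flatten [seq G j | j <- s]).
Proof.
elim: s => //= a s IH /andP[na us]; rewrite in_cons => /predU1P[->|ps].
  rewrite upd_same -catA perm_cat2l perm_cat2l.
  rewrite (_ : [seq _ | j <- s] = [seq G j | j <- s]) //.
  by apply/eq_in_map => j js; rewrite upd_other //; apply: contraNneq na => <-.
rewrite upd_other; last by apply: contraNneq na => ->.
by rewrite perm_sym perm_catCA perm_cat2l perm_sym; exact: IH.
Qed.

Lemma leaves_assemble par lab ord F : bottom_up par ord ->
  perm_eq (forest_leaves (assemble par lab ord F))
          (flatten [seq forest_leaves (F j) | j <- 0 :: ord]).
Proof.
elim: ord F => [|w ord IH] F; first by rewrite /= cats0.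
move=> bu; have /bottom_up_uniq := bu; move: bu => /= /and3P[w0 pw bu] u0.
apply: perm_trans (IH _ bu) _.
have := @flatten_upd _ (fun j => forest_leaves (F j)) (0 :: ord) (par w)
   (forest_leaves (F w)) (bottom_up_uniq bu) pw.
have -> : [seq forest_leaves (attach par lab F w j) | j <- 0 :: ord] =
  [seq upd (fun j => forest_leaves (F j)) (par w)
     (forest_leaves (F w) ++ forest_leaves (F (par w))) j | j <- 0 :: ord].
  by apply/eq_map => j; rewrite /attach /upd; case: eqP.
by move=> h; apply: perm_trans h _; rewrite /= perm_catCA.
Qed.

Lemma size_assemble par lab ord F : bottom_up par ord ->
  size (assemble par lab ord F) = arity par ord F 0.
Proof.
elim: ord F => [|w ord IH] F; first by rewrite /arity addn0.
move=> /= /and3P[w0 pw bu]; rewrite IH // /arity /attach /= /upd eq_sym.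
by case: eqP => /= [->|_]; lia.
Qed.

(** [D - dep j] bounds the heights of the subtrees that hang from [j], before and
    after attaching a node. *)
Lemma height_assemble par lab dep ord F D :
  {in ord, forall c, dep c = (dep (par c)).+1 /\ dep c <= D} ->
  (forall j, j \in 0 :: ord -> {in F j, forall t, height t + dep j <= D}) -> dep 0 = 0 ->
  bottom_up par ord ->
  {in assemble par lab ord F, forall t, height t <= D}.
Proof.
elim: ord F => [|w ord IH] F hd hF d0; first by move=> _ t /hF -/(_ (mem_head _ _)); rewrite d0 addn0.
move=> /= /and3P[w0 pw bu]; apply: IH => // [c cord|j jo t].
  by apply: hd; rewrite in_cons cord orbT.
have jo' : j \in 0 :: w :: ord by move: jo; rewrite !in_cons => /orP[->|->]; rewrite ?orbT.
rewrite /attach /upd; case: eqP => [jp|_]; last exact: hF.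
rewrite in_cons => /predU1P[->|]; last by rewrite -jp; exact: hF.
have [hw hD] := hd w (mem_head _ _).
suff : height (Node (lab w == 1) (F w)) <= (D - dep w).+1 by rewrite jp; lia.
apply: height_node => a aw; have := hF w _ a aw.
by rewrite !in_cons eqxx orbT => /(_ isT); lia.
Qed.

Section Refinement.
Variable e : rel V.

Lemma represents_perm b ts cs : perm_eq ts cs ->
  represents e (Node b ts) -> represents e (Node b cs).
Proof.
elim: ts cs => [|a ts IH] cs; first by rewrite perm_sym => /perm_nilP->.
move=> pac; have acs : a \in cs by rewrite -(perm_mem pac) mem_head.
case/path.splitPr: acs pac => x y pac.
rewrite represents_cons => /and3P[cr Ra Rts].
have pxy : perm_eq ts (x ++ y).
  by rewrite -(perm_cons a) (permPl pac) -cat1s perm_catCA.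
have := IH _ pxy Rts; rewrite !represents_cat represents_cons => /and3P[cxy -> ->].
rewrite Ra !andbT /=; have {cr} /allrelP cr : allrel (adjacent_as e b) (leaves a) (forest_leaves (x ++ y)).
  apply/allrelP => u v ua /mem_forest[c cxy' vc]; apply: (allrelP cr) => //.
  by apply: mem_forest_of vc; rewrite (perm_mem pxy).
rewrite /forest_leaves /= -/(forest_leaves y) allrel_catr cxy andbT.
apply/andP; split; apply/allrelP => u v ux va.
  by rewrite adjacent_as_sym; apply: cr => //; rewrite forest_leaves_cat mem_cat ux.
by apply: cr => //; rewrite forest_leaves_cat mem_cat va orbT.
Qed.

(** A replacement for the children of a node labelled [b]. One direction of
    [represents] is enough, since steps of the algorithm lose leaves. *)
Definition refines b ts cs : Prop :=
  {subset forest_leaves cs <= forest_leaves ts} /\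
  (represents e (Node b ts) -> represents e (Node b cs)).

Definition refines_tree t s : Prop :=
  {subset leaves s <= leaves t} /\ (represents e t -> represents e s).

Lemma refines_refl b ts : refines b ts ts.
Proof. by split. Qed.

Lemma refines_trans b ts cs us : refines b ts cs -> refines b cs us -> refines b ts us.
Proof. by move=> [h1 h2] [h3 h4]; split=> [u /h3/h1//|/h2/h4]. Qed.

Lemma refines_perm b ts cs : perm_eq ts cs -> refines b ts cs.
Proof.
move=> p; split; last exact: represents_perm.
by move=> u /mem_forest[c]; rewrite -(perm_mem p); exact: mem_forest_of.
Qed.

Lemma refines_cons b t s ts cs : refines_tree t s -> refines b ts cs ->
  refines b (t :: ts) (s :: cs).
Proof.
move=> [st Rst] [sts Rts]; split.
  move=> u; rewrite /forest_leaves /= !mem_cat => /orP[/st->//|/sts].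
  by rewrite /forest_leaves => ->; rewrite orbT.
rewrite !represents_cons => /and3P[/allrelP cr /Rst-> /Rts->]; rewrite !andbT.
by apply/allrelP => u v /st ut /sts; exact: cr.
Qed.

(** Refinement is a congruence for [assemble]. The second alternative is the
    change of label: it replaces the node as a whole, hence requires that
    no further node be attached to it. *)
Lemma assemble_refines par par' lab lab' ord F F' :
  {in ord, par' =1 par} ->
  (forall j, j \in 0 :: ord ->
     (lab' j = lab j /\ refines (lab j == 1) (F j) (F' j)) \/
     [/\ j != 0, j \notin map par ord
       & refines_tree (Node (lab j == 1) (F j)) (Node (lab' j == 1) (F' j))]) ->
  refines (lab 0 == 1) (assemble par lab ord F) (assemble par' lab' ord F').
Proof.
elim: ord F F' => [|w ord IH] F F' hp H /=.
  by have [[_ //]|[]] := H 0 (mem_head _ _).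
apply: IH => [c co|j jo]; first by apply: hp; rewrite in_cons co orbT.
have jo' : j \in 0 :: w :: ord by move: jo; rewrite !in_cons => /orP[->|->]; rewrite ?orbT.
rewrite /attach hp ?mem_head // /upd; case: (j =P par w) => [jp|jp]; last first.
  have [[h1 h2]|[h1 hn h3]] := H j jo'; [by left|right].
  by move: hn; rewrite /= in_cons negb_or => /andP[_ h2].
have [[h1 h2]|[h1 hn h3]] := H j jo'; last by rewrite jp /= mem_head in hn.
left; split; rewrite // -jp; apply: refines_cons h2.
have wo : w \in 0 :: w :: ord by rewrite !in_cons eqxx orbT.
by have [[-> h3]|[_ _]] := H w wo.
Qed.

(** Attaching [x] commutes with attaching nodes that are neither its parent nor
    its children. *)
Lemma assemble_swap par lab x ds ord F :
  x \notin ds -> {in ds, forall y, par y != x /\ par x != y} ->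
  refines (lab 0 == 1) (assemble par lab (x :: ds ++ ord) F)
    (assemble par lab (ds ++ x :: ord) F).
Proof.
elim: ds F => [|y ds IH] F; first by move=> _ _; exact: refines_refl.
rewrite in_cons negb_or => /andP[xy xds] H.
apply: (@refines_trans _ _ (assemble par lab (x :: ds ++ ord) (attach par lab F y))); last first.
  by apply: IH => // z zds; apply: H; rewrite in_cons zds orbT.
have [pyx pxy] := H y (mem_head _ _).
apply: (@assemble_refines _ _ _ _ (ds ++ ord) (attach par lab (attach par lab F x) y)
  (attach par lab (attach par lab F y) x)) => // j _.
left; split=> //; apply: refines_perm.
have yx : y != x by rewrite eq_sym.
have Ey : attach par lab F x y = F y by rewrite /attach upd_other // eq_sym.
have Ex : attach par lab F y x = F x by rewrite /attach upd_other // eq_sym.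
rewrite {1}/attach Ey [X in perm_eq _ (X j)]/attach Ex /attach /upd.
rewrite [par x == par y]eq_sym; case: (par y =P par x) => [->|/eqP pp]; last first.
  by case: (j =P par y) => [->|_] //; rewrite (negPf pp).
case: (j == par x) => //.
by rewrite (perm_catCA [:: _] [:: _]).
Qed.

End Refinement.
End Assembly.

(** * Lazy trees and their deepest siblings *)

Section LazyTrees.
Variable V : eqType.
Implicit Types (t s : cotree V) (ts cs : seq (cotree V)) (u v : V).
Implicit Types (par lab dep : nat -> nat) (ord : seq nat) (F : nat -> seq (cotree V)).
Implicit Types (L : nat -> seq V).

Lemma size_opened b t s : norm t = Some s -> 0 < size (opened b (norm t)).
Proof.
move=> ts; rewrite ts; case: s ts => [//|c us /norm_wf /= /and3P[sz _ _]].
by case: ifP => // _; exact: ltnW.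
Qed.

Lemma size_norm_children b ts : all (fun t => norm t) ts ->
  size ts <= size (norm_children b ts).
Proof.
elim: ts => //= t ts IH /andP[nt /IH]; rewrite norm_children_cons size_cat.
case E: (norm t) nt => [s|//] _; have := size_opened b E; rewrite E; lia.
Qed.

Lemma norm_node b ts : 1 < size ts -> all (fun t => norm t) ts ->
  norm (Node b ts) = Some (Node b (norm_children b ts)).
Proof.
move=> sz /(size_norm_children b); rewrite /= -/(norm_children b ts).
by case: (norm_children b ts) => [|x [|y cs]] //= h; have := leq_trans sz h.
Qed.

Lemma norm_node_some b ts : 0 < size ts -> all (fun t => norm t) ts ->
  norm (Node b ts).
Proof.
move=> sz /(size_norm_children b); rewrite /= -/(norm_children b ts).
by case: (norm_children b ts) => [|x [|y cs]] //= h; have := leq_trans sz h.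
Qed.

(** The hypotheses exclude both ways to lose the child: being merged into its
    parent, as the labels differ, and replacing its parent, as two children are
    left. *)
Lemma norm_occurs b ts t c vs r x : t \in ts -> norm t = Some (Node c vs) ->
  c != b -> occurs (Node c vs) r x -> 1 < size ts -> all (fun t => norm t) ts ->
  exists us, norm (Node b ts) = Some (Node b us) /\ occurs (Node b us) r.+1 x.
Proof.
move=> tts nt cb H sz alive; exists (norm_children b ts); rewrite norm_node //; split=> //.
apply: occurs_child H; apply/flatten_mapP; exists t => //.
by rewrite nt /= (negPf cb) mem_seq1.
Qed.

Lemma arity_attach par lab w ord F j :
  arity par ord (attach par lab F w) j = arity par (w :: ord) F j.
Proof.
rewrite /arity /attach /upd /= [par w == j]eq_sym.
by case: eqP => [->|_] /=; lia.
Qed.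

Lemma arity_head par w ord (T : Type) (F : nat -> seq T) : bottom_up par (w :: ord) ->
  arity par (w :: ord) F w = size (F w).
Proof.
move=> bu; rewrite /arity (@eq_in_count _ _ pred0) ?count_pred0 ?addn0 //.
by move=> c /(bottom_up_head bu)/negPf.
Qed.

(** [Q] singles out the ancestors of [s]. These have at least two children and
    labels that alternate, so that [norm_occurs] carries the node [x] upwards
    through each of them, one level at a time. *)
Lemma assemble_occurs par lab dep ord F (Q : nat -> Prop) r (s : nat) t b vs x :
  bottom_up par ord -> dep 0 = 0 -> {in ord, forall c, dep c = (dep (par c)).+1} ->
  (forall j, j \in 0 :: ord -> all (fun t => norm t) (F j)) ->
  {in ord, forall j, 0 < arity par ord F j} ->
  {in ord, forall c, Q c -> [/\ 1 < arity par ord F c, Q (par c)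
     & par c \in ord -> (lab c == 1) != (lab (par c) == 1)]} ->
  s \in 0 :: ord -> Q s -> t \in F s -> norm t = Some (Node b vs) ->
  (s \in ord -> b != (lab s == 1)) -> occurs (Node b vs) r x ->
  exists t' b' vs', [/\ t' \in assemble par lab ord F, norm t' = Some (Node b' vs')
    & occurs (Node b' vs') (r + dep s) x].
Proof.
move=> + d0; elim: ord F r s t b vs => [|w ord IH] F r s t b vs.
  move=> _ _ _ _ _; rewrite inE => /eqP-> _ ts nt _ H.
  by exists t, b, vs; rewrite d0 addn0.
move=> bu hd al ar hQ so Qs ts nt bs H; have := bu; rewrite [bottom_up _ _]/= => /and3P[w0 pw bu'].
have sub j : j \in 0 :: ord -> j \in 0 :: w :: ord.
  by rewrite !in_cons => /orP[->|->]; rewrite ?orbT.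
have hd' : {in ord, forall c, dep c = (dep (par c)).+1}.
  by move=> c co; apply: hd; rewrite in_cons co orbT.
have ar' : {in ord, forall j, 0 < arity par ord (attach par lab F w) j}.
  by move=> j jo; rewrite arity_attach; apply: ar; rewrite in_cons jo orbT.
have alw : all (fun t => norm t) (F w) by apply: al; rewrite !in_cons eqxx orbT.
have wlt : 0 < size (F w) by have := ar w (mem_head _ _); rewrite arity_head.
have al' j : j \in 0 :: ord -> all (fun t => norm t) (attach par lab F w j).
  move=> jo; rewrite /attach /upd; case: (j =P par w) => [jp|_]; last exact: al (sub j jo).
  by rewrite /= -/(norm (Node _ _)) norm_node_some // -jp; exact: al (sub j jo).
have hQ' : {in ord, forall c, Q c -> [/\ 1 < arity par ord (attach par lab F w) c, Q (par c)
     & par c \in ord -> (lab c == 1) != (lab (par c) == 1)]}.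
  move=> c co Qc; rewrite arity_attach.
  have [|h1 h2 h3] := hQ c _ Qc; first by rewrite in_cons co orbT.
  by split=> // pc; apply: h3; rewrite in_cons pc orbT.
have [sw|sw] := eqVneq s w.
  subst s; have ww := mem_head w ord.
  have [aw Qp lp] := hQ w ww Qs; rewrite arity_head // in aw.
  have [us [nw Hw]] := norm_occurs ts nt (bs ww) H aw alw.
  rewrite (hd w ww) addnS -addSn.
  apply: (IH (attach par lab F w) r.+1 (par w) (Node (lab w == 1) (F w)) (lab w == 1) us) => //.
    by rewrite /attach upd_same mem_head.
  by move=> po; apply: lp; rewrite in_cons po orbT.
apply: (IH (attach par lab F w) r s t b vs) => //.
- by move: so; rewrite !in_cons (negPf sw).
- by rewrite /attach /upd; case: (s =P par w) ts => [->|_ //]; rewrite in_cons => ->; rewrite orbT.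
- by move=> so'; apply: bs; rewrite in_cons so' orbT.
Qed.

Definition leaf_forest L (j : nat) : seq (cotree V) := map (@Leaf V) (L j).

Lemma norm_leaf_forest L j : all (fun t => norm t) (leaf_forest L j).
Proof. by rewrite all_map; apply/allP. Qed.

Definition all_leaves ord L : seq V := flatten [seq L j | j <- 0 :: ord].

Lemma forest_leaves_leaf (s : seq V) : forest_leaves (map (@Leaf V) s) = s.
Proof. by rewrite /forest_leaves -map_comp; elim: s => //= a s ->. Qed.

Section LazyTreeTheory.
Variables (e : rel V) (par dep : nat -> nat).

(** What holds between two turns. A node with an unhandled child still has the
    label of the input ([lazy_alternating]), because only the turn of an only
    child changes a label. A node with an unhandled grandchild still has all its
    children ([lazy_wide]), because nodes are handled by decreasing depth. That all
    other nodes have a child is required separately, for it fails at the node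
    being handled once its last leaves are gone. *)
Record lazy_tree lab ord L : Prop := LazyTree {
  lazy_order : bottom_up par ord;
  lazy_dep0 : dep 0 = 0;
  lazy_dep : {in ord, forall c, dep c = (dep (par c)).+1};
  lazy_represents : represents e (Node (lab 0 == 1) (assemble par lab ord (leaf_forest L)));
  lazy_lab0 : lab 0 = 2;
  lazy_lab : {in ord, forall c, lab c < 2};
  lazy_root : arity par ord L 0 <= 1;
  lazy_alternating : {in ord, forall c, par c \in ord -> lab (par c) != lab (par (par c))};
  lazy_wide : {in ord, forall c, par c \in ord -> par (par c) \in ord ->
    1 < arity par ord L (par (par c))} }.

Lemma arity_leaf_forest ord L j : arity par ord (leaf_forest L) j = arity par ord L j.
Proof. by rewrite /arity size_map. Qed.

Lemma all_leaves_assemble lab ord L : bottom_up par ord ->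
  perm_eq (forest_leaves (assemble par lab ord (leaf_forest L))) (all_leaves ord L).
Proof.
move=> bu; apply: perm_trans (leaves_assemble _ _ bu) _; rewrite /all_leaves.
by rewrite (eq_map (g := L)) // => j; exact: forest_leaves_leaf.
Qed.

Lemma all_leaves_uniq lab ord L : lazy_tree lab ord L -> uniq (all_leaves ord L).
Proof.
move=> sn; rewrite -(perm_uniq (all_leaves_assemble lab L (lazy_order sn))).
exact: (represents_uniq (lazy_represents sn)).
Qed.

Lemma all_leaves_cons w ord L :
  perm_eq (all_leaves (w :: ord) L) (L w ++ all_leaves ord L).
Proof. by rewrite /all_leaves /= perm_catCA. Qed.

Lemma all_leaves_upd w ord L (s : seq V) : w \notin 0 :: ord ->
  all_leaves ord (upd L w s) = all_leaves ord L.
Proof.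
move=> wo; congr flatten; apply/eq_in_map => j jo; rewrite upd_other //.
by apply: contraNneq wo => <-.
Qed.

(** By [assemble_occurs] the node [w] keeps its depth under normalization, and by
    [height_assemble] and [height_norm] nothing is deeper. *)
Lemma deepest_assembled lab w ord L k l : lazy_tree lab (w :: ord) L ->
  {in ord, forall j, 0 < arity par (w :: ord) L j} ->
  {in ord, forall c, dep c <= dep w} ->
  lab w != lab (par w) -> (par w \in ord -> 1 < arity par (w :: ord) L (par w)) ->
  k \in L w -> l \in L w -> k != l ->
  exists t T, [/\ assemble par lab (w :: ord) (leaf_forest L) = [:: t], norm t = Some T
    & deepest_sibling_pair T (lab w == 1) k l].
Proof.
move=> [bu d0 hd Rp l0 hl rt alt wide] al dw lw pw kw lw' kl.
have := bu; rewrite [bottom_up _ _]/= => /and3P[w0 pwo bu'].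
have wo := mem_head w ord.
pose Q c := c = par w \/ exists c', [/\ c' \in w :: ord, par c' \in w :: ord & par (par c') = c].
have sub j : j \in ord -> j \in w :: ord by rewrite in_cons => ->; rewrite orbT.
have lab_bool c c' : c \in w :: ord -> c' \in w :: ord -> lab c != lab c' ->
    (lab c == 1) != (lab c' == 1).
  by move=> /hl + /hl; case: (lab c) (lab c') => [|[|?]] [|[|?]].
have sw : 1 < size (L w).
  by case: (L w) kw lw' kl => [|x [|y s]] //; rewrite !inE => /eqP-> /eqP->; rewrite eqxx.
have nw : norm (Node (lab w == 1) (leaf_forest L w)) = Some (Node (lab w == 1) (leaf_forest L w)).
  rewrite norm_node ?size_map ?norm_leaf_forest //.
  congr (Some (Node _ _)); rewrite /norm_children /leaf_forest -map_comp.
  by elim: (L w) => //= a s ->.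
pose F := attach par lab (leaf_forest L) w.
have arF j : arity par ord F j = arity par (w :: ord) L j.
  by rewrite arity_attach arity_leaf_forest.
have [t [b [vs [tin nt Ho]]]] : exists t' b' vs', [/\ t' \in assemble par lab ord F,
    norm t' = Some (Node b' vs')
    & occurs (Node b' vs') (0 + dep (par w)) (Node (lab w == 1) (leaf_forest L w))].
  apply: (@assemble_occurs par lab dep ord F Q 0 (par w)
    (Node (lab w == 1) (leaf_forest L w)) (lab w == 1) (leaf_forest L w)) => //.
  - by move=> c /sub/hd.
  - move=> j jo; rewrite /F /attach /upd; case: (j =P par w) => _; last exact: norm_leaf_forest.
    by apply/andP; split; [rewrite nw|exact: norm_leaf_forest].
  - by move=> j jo; rewrite arF al.
  - move=> c co [cp|[c' [c'o pc'o ppc']]].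
      subst c; rewrite arF pw //; split=> //; first by right; exists w; rewrite wo sub.
      by move=> ppo; apply: lab_bool (sub _ co) (sub _ ppo) _; exact: alt (sub _ co).
    subst c; rewrite arF; split; first exact: wide (sub _ co).
      by right; exists (par c'); rewrite pc'o sub.
    by move=> po; apply: lab_bool (sub _ co) (sub _ po) _; exact: alt (sub _ co).
  - by left.
  - by rewrite /F /attach upd_same mem_head.
  - by move=> po; apply: lab_bool wo (sub _ po) lw.
  - by constructor.
have sz : size (assemble par lab (w :: ord) (leaf_forest L)) <= 1.
  by rewrite size_assemble // arity_leaf_forest.
have tin' : t \in assemble par lab (w :: ord) (leaf_forest L) by [].
exists t, (Node b vs); split=> //.
  by case: (assemble _ _ _ _) sz tin' => [|x [|y s]] //; rewrite inE => _ /eqP->.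
exists (dep (par w)).
  exists (leaf_forest L w); split=> //.
    by rewrite has_is_leaf; exact: map_f.
  by rewrite has_is_leaf; exact: map_f.
move=> d' b' k' l' /sibling_pair_height h.
suff ht : height t <= dep w.
  by rewrite -ltnS -(hd w wo); exact: leq_trans h (leq_trans (height_norm nt) ht).
apply: (@height_assemble _ par lab dep (w :: ord) (leaf_forest L)) tin' => //.
  move=> c co; split; first exact: hd.
  by move: co; rewrite in_cons => /predU1P[->|/dw].
move=> j; rewrite !in_cons => jo a /mapP[v _ ->]; rewrite /= add0n.
by case/or3P: jo => [/eqP->|/eqP->|/dw]; rewrite ?d0.
Qed.

Lemma lazy_tree_shrink lab w ord L (s : seq V) : lazy_tree lab (w :: ord) L -> subseq s (L w) ->
  lazy_tree lab (w :: ord) (upd L w s).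
Proof.
move=> [bu d0 hd Rp l0 hl rt alt wide] sub.
have := bu; rewrite [bottom_up _ _]/= => /and3P[w0 pwo bu'].
have ar j : j != w -> arity par (w :: ord) (upd L w s) j = arity par (w :: ord) L j.
  by move=> jw; rewrite /arity upd_other.
split=> //.
- apply: (assemble_refines (e := e) (par' := par) _ _).2 Rp => // j _; left; split=> //.
  rewrite /leaf_forest /upd; case: (j =P w) => [->|_]; last exact: refines_refl.
  split; first by rewrite !forest_leaves_leaf; exact: mem_subseq.
  rewrite /= => /andP[pwl _]; apply/andP; split; last by rewrite all_map; apply/allP.
  by apply: subseq_pairwise pwl; exact: map_subseq.
- by rewrite ar //; apply: contraNneq w0 => <-; rewrite mem_head.
- by move=> c co pc ppc; rewrite ar ?wide // (bottom_up_head bu).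
Qed.

(** The three ways to end the turn of [w]: at most one leaf is left of it, or
    it has the label of its parent, or it is an only child and passes its
    label on. In the first case the parent keeps a child because it had another
    one; a node without children would break the alternation argument. *)
Lemma lazy_tree_merge lab lab' w ord L (L' := upd L (par w) (L w ++ L (par w))) :
  lazy_tree lab (w :: ord) L -> {in ord, forall j, 0 < arity par (w :: ord) L j} ->
  {in ord, forall c, dep c <= dep w} ->
  [\/ [/\ lab' = lab, size (L w) <= 1
        & par w \in ord -> size (L w) + arity par (w :: ord) L (par w) > 1],
      [/\ lab' = lab, lab w = lab (par w) & 0 < size (L w)]
    | [/\ lab' = upd lab (par w) (lab w), par w \in ord, 0 < size (L w)
        & arity par (w :: ord) L (par w) = 1]] ->
  [/\ lazy_tree lab' ord L', {in ord, forall j, 0 < arity par ord L' j}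
    & perm_eq (all_leaves ord L') (all_leaves (w :: ord) L)].
Proof.
move=> [bu d0 hd Rp l0 hl rt alt wide] al dw cases.
have := bu; rewrite [bottom_up _ _]/= => /and3P[w0 pwo bu'].
have uo := bottom_up_uniq bu'.
have wo := mem_head w ord.
have wpn : w != par w by rewrite eq_sym; exact: bottom_up_head bu wo.
have sub j : j \in ord -> j \in w :: ord by rewrite in_cons => ->; rewrite orbT.
have ar j : j != par w -> arity par ord L' j = arity par (w :: ord) L j.
  by move=> jp; rewrite /arity /L' upd_other //= [par w == j]eq_sym (negPf jp).
have arp : arity par ord L' (par w) + 1 = size (L w) + arity par (w :: ord) L (par w).
  by rewrite /arity /L' upd_same size_cat /= eqxx; lia.
have p0 : par w != 0 -> par w \in ord by move: pwo; rewrite in_cons => /orP[->|].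
have flip0 : arity par (w :: ord) L (par w) = 1 -> L (par w) = [::] /\ par w \notin map par ord.
  rewrite /arity /= eqxx => h; split; first by apply/nilP; rewrite /nilp; lia.
  apply/negP => /mapP[c co pc]; have : has (fun c => par c == par w) ord.
    by apply/hasP; exists c; rewrite // pc.
  by rewrite has_count; move: h; move: (size _) (count _ _) => a k; clear; lia.
have lab'E j : (j == par w) = false \/ lab' = lab -> lab' j = lab j.
  by case=> [h|-> //]; case: cases => [[-> //]|[-> //]|[-> _ _ _]]; rewrite /upd h.
have gp c : c \in ord -> par c \in ord -> par (par c) != par w.
  move=> co pc; apply/eqP => E; have := dw c co.
  by rewrite (hd c (sub _ co)) (hd _ (sub _ pc)) E -(hd w wo) ltnn.
have pflip c : c \in ord -> (par c == par w) = false \/ lab' = lab.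
  move=> co; case: cases => [[-> _ _]|[-> _ _]|[_ _ _ /flip0[_ h]]]; try by right.
  by left; apply: contraNF h => /eqP<-; exact: map_f.
have l00 : lab' 0 = lab 0.
  apply: lab'E; case: cases => [[-> _ _]|[-> _ _]|[_ po _ _]]; try by right.
  by left; apply/eqP => E; move/bottom_up_uniq: bu' => /=; rewrite E po.
split; last 2 first.
- move=> j jo; have [jp|jp] := eqVneq j (par w); last by rewrite ar ?al.
  have := al j jo; rewrite jp => h; subst j; move: cases h arp.
  move: (arity par ord L' (par w)) (arity par (w :: ord) L (par w)) (size (L w)) => a c z.
  by case=> [[_ _ /(_ jo)]|[_ _]|[_ _]]; clear; lia.
- rewrite perm_sym; apply: perm_trans (all_leaves_cons _ _ _) _; rewrite perm_sym.
  exact: flatten_upd uo pwo.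
split=> //.
- by move=> c /sub/hd.
- rewrite l00; have : represents e (Node (lab 0 == 1)
    (assemble par lab ord (attach par lab (leaf_forest L) w))) by [].
  apply: (assemble_refines (e := e) _ _).2 => // j jo.
  rewrite /attach /upd; have [jp|jp] := eqVneq j (par w); last first.
    left; split; first by apply: lab'E; left; exact: negPf.
    by rewrite /leaf_forest /L' upd_other //; exact: refines_refl.
  have LE : leaf_forest L' j = leaf_forest L w ++ leaf_forest L (par w).
    by rewrite /leaf_forest /L' jp upd_same map_cat.
  have lE b ts cs : forest_leaves (ts ++ cs) = forest_leaves (Node b ts :: cs) :> seq V.
    by rewrite forest_leaves_cat.
  rewrite LE -/(leaf_forest L (par w)); case: cases => [[-> sz _]|[-> lw _]|[-> po sz a1]].
  + left; split=> //; split=> [u|]; first by rewrite (lE (lab w == 1)).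
    rewrite represents_cons represents_cat => /and3P[-> _ ->]; rewrite andbT /=.
    by rewrite /leaf_forest; case: (L w) sz => [|x [|]].
  + left; split=> //; split=> [u|]; first by rewrite (lE (lab w == 1)).
    rewrite represents_cons represents_cat jp -lw => /and3P[-> -> ->] //.
  + right; have [Lp hp] := flip0 a1.
    split; [|by rewrite jp|].
      by rewrite jp; apply: contraTneq po => ->; have /= /andP[] := uo.
    rewrite jp upd_same /leaf_forest Lp cats0; split=> [u|].
      by rewrite /= cats0.
    by rewrite represents_cons => /and3P[].
- by rewrite l00.
- move=> c co; have [cp|cp] := eqVneq c (par w); last by rewrite lab'E ?hl ?sub //; left; exact: negPf.
  case: cases => [[-> _ _]|[-> _ _]|[-> _ _ _]]; try by apply: hl; exact: sub.
  by rewrite cp upd_same; exact: hl.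
- have [p00|p00] := eqVneq (par w) 0; last by rewrite ar // eq_sym.
  have := rt; rewrite -p00 => h; have := arp; case: cases => [[_ ? _]|[_ lw _]|[_ po _ _]]; first by lia.
    by have := hl w wo; rewrite lw p00 l0.
  by have := uo; rewrite /= -p00 po.
- move=> c co pc; rewrite (lab'E _ (pflip _ co)) (lab'E _ (pflip _ pc)).
  by apply: alt; exact: sub.
- by move=> c co pc ppc; rewrite ar ?gp //; apply: wide; exact: sub.
Qed.

End LazyTreeTheory.
End LazyTrees.

Section Reduce.
Variables (R : realType) (n : nat) (e : rel 'I_n).
Implicit Types (S : {set 'I_n}) (t : cotree 'I_n) (T : option (cotree 'I_n)).

Definition updated (d : {ffun 'I_n -> R}) (k l : 'I_n) (dk dl : R) : {ffun 'I_n -> R} :=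
  [ffun i => if i == k then dk else if i == l then dl else d i].

(** The cotree of the run is only known up to the order of children, while
    the deepest siblings do not depend on it by [deepest_unique]. *)
Lemma reduce_step par dep lab w ord (L : nat -> seq 'I_n) k l rest T S
    (d : {ffun 'I_n -> R}) dk dl rem_l :
  lazy_tree e par dep lab (w :: ord) L ->
  {in ord, forall j, 0 < arity par (w :: ord) L j} ->
  {in ord, forall c, dep c <= dep w} ->
  lab w != lab (par w) -> (par w \in ord -> 1 < arity par (w :: ord) L (par w)) ->
  L w = [:: k, l & rest] ->
  option_cotree_on e S T -> S =i all_leaves (w :: ord) L ->
  new_values (lab w == 1) (d k) (d l) = (dk, dl, rem_l) ->
  exists T' S', [/\ diag_step e (T, d) [:: (k, dk); (l, dl)] (T', updated d k l dk dl),
     option_cotree_on e S' T' &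
     S' =i all_leaves (w :: ord) (upd L w (if rem_l then rest else l :: rest))].
Proof.
move=> sn al dw lw pw Lw cT SL nv.
have uL := all_leaves_uniq sn; have bu := lazy_order sn.
have := bu; rewrite [bottom_up _ _]/= => /and3P[w0 pwo bu'].
have uLw : uniq (L w ++ all_leaves ord L) by rewrite -(perm_uniq (all_leaves_cons _ _ _)).
have SLw u : (u \in S) = (u \in L w ++ all_leaves ord L).
  by rewrite SL; exact: perm_mem (all_leaves_cons _ _ _) u.
have kl : k != l.
  by move: uLw; rewrite cat_uniq Lw /= inE negb_or => /andP[/andP[/andP[]]].
have [kL lL] : k \in L w /\ l \in L w by rewrite Lw !inE !eqxx orbT.
have [t0 [T0 [at0 nt0 deep0]]] := deepest_assembled sn al dw lw pw kL lL kl.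
have Rt0 : represents e t0.
  by have := lazy_represents sn; rewrite at0 => /represents_child -> //; rewrite mem_head.
have kS : k \in S by rewrite SLw mem_cat kL.
have lS : l \in S by rewrite SLw mem_cat lL.
case: T cT => [t|] cT; last by rewrite cT in_set0 in kS.
have [wt tS Rt] := (cotree_onP _ _ _).1 cT.
have deep : deepest_sibling_pair t (lab w == 1) k l.
  apply: deepest_unique (norm_wf nt0) (represents_norm Rt0 nt0) wt Rt _ deep0 => u.
  have := leaves_norm t0; rewrite nt0 /= => ->; rewrite tS SL.
  rewrite -(perm_mem (all_leaves_assemble lab L bu)) at0.
  by rewrite /forest_leaves /= cats0.
have [T1 mk] := cotree_minus_exists k cT.
have mk' := (cotree_minusE k T1 cT).1 mk.
have lSk : l \in S :\ k by rewrite !inE eq_sym kl.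
case: T1 mk mk' => [t1|] mk mk'; last by rewrite mk' in_set0 in lSk.
have sz : 1 < num_leaves (Some t).
  rewrite (option_cotree_on_num (e := e) (S := S)) //.
  by rewrite (cardsD1 k) kS (cardsD1 l) lSk.
pose S' := if rem_l then S :\ k :\ l else S :\ k.
have [T' ml cT'] : exists2 T', (if rem_l then cotree_minus e t1 l T' else T' = Some t1)
    & option_cotree_on e S' T'.
  rewrite /S'; case: (rem_l); last by exists (Some t1).
  have [T' ml] := cotree_minus_exists l mk'.
  by exists T' => //; apply/(cotree_minusE _ _ mk').
exists T', S'; split=> //; first exact: DiagStep sz deep nv mk ml.
move=> u; rewrite (perm_mem (all_leaves_cons _ _ _)) upd_same all_leaves_upd //.
move: uLw SLw; rewrite Lw; move: (all_leaves ord L) => X /= /and3P[+ + _] /(_ u).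
rewrite !in_cons !mem_cat !negb_or => /and3P[_ kr ka] /andP[lr la].
rewrite /S'; case: (rem_l); rewrite !inE => -> /=.
  have [->|uk] /= := eqVneq u k; first by rewrite andbF (negPf kr) (negPf ka).
  by have [->|ul] /= := eqVneq u l; rewrite ?(negPf lr) ?(negPf la).
have [->|uk] /= := eqVneq u k; last by rewrite orbA.
by rewrite (negPf kl) (negPf kr) (negPf ka).
Qed.

End Reduce.

(** * Total correctness with running time *)

Section Logic.
Variables (R : realType) (S : nat).
Implicit Types (m : memory R) (p q : prog).

(** Every program preserves this, so that loads and subtractions need no check of
    the size of their result. *)
Definition bounded m : Prop :=
  (forall r, ireg m r < S) /\ (forall a, imem m a < S).

Lemma bounded_upd (f : nat -> nat) a v :
  (forall i, f i < S) -> v < S -> forall i, upd f a v i < S.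
Proof. by move=> fS vS i; rewrite /upd; case: eqP. Qed.

(** Weakest preconditions in bounded memories. *)
Definition safe (i : instr) m (Q : memory R -> Prop) : Prop :=
  let ir r v := Memory (upd (ireg m) r v) (imem m) (rreg m) (rmem m) (log m) in
  let rr r v := Memory (ireg m) (imem m) (upd (rreg m) r v) (rmem m) (log m) in
  match i with
  | IConst r c => c < S /\ Q (ir r c)
  | IAdd r a b => ireg m a + ireg m b < S /\ Q (ir r (ireg m a + ireg m b))
  | ISub r a b => Q (ir r (ireg m a - ireg m b))
  | ILoad r a => ireg m a < S /\ Q (ir r (imem m (ireg m a)))
  | IStore a r => ireg m a < S /\
      Q (Memory (ireg m) (upd (imem m) (ireg m a) (ireg m r)) (rreg m) (rmem m) (log m))
  | RConst r c => Q (rr r (c%:R)%R)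
  | RAdd r a b => Q (rr r (rreg m a + rreg m b)%R)
  | RSub r a b => Q (rr r (rreg m a - rreg m b)%R)
  | RMul r a b => Q (rr r (rreg m a * rreg m b)%R)
  | RDiv r a b => (rreg m b != 0)%R /\ Q (rr r (rreg m a / rreg m b)%R)
  | RLoad r a => ireg m a < S /\ Q (rr r (rmem m (ireg m a)))
  | RStore a r => ireg m a < S /\
      Q (Memory (ireg m) (imem m) (rreg m) (upd (rmem m) (ireg m a) (rreg m r))
           (rcons (log m) (ireg m a, rreg m r)))
  end.

(** Weakest preconditions of programs without loops; loops are the business of
    [halts_while]. *)
Fixpoint wp p m (Q : memory R -> Prop) : Prop :=
  match p with
  | Skip => Q m
  | Do i => safe i m Q
  | Seq p q => wp p m (fun m' => wp q m' Q)
  | If c p q => (holds c m -> wp p m Q) /\ (~~ holds c m -> wp q m Q)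
  | While _ _ => False
  end.

(** A bound on the time of a program without loops. *)
Fixpoint cost p : nat :=
  match p with
  | Skip => 1
  | Do _ => 1
  | Seq p q => cost p + cost q
  | If _ p q => (maxn (cost p) (cost q)).+1
  | While _ _ => 0
  end.

(** The postcondition sees the time, which is what amortization needs. *)
Definition halts p m (Q : nat -> memory R -> Prop) : Prop :=
  bounded m -> exists c m', [/\ runs S p m c m', bounded m' & Q c m'].

Lemma safe_halts i m Q : safe i m Q -> halts (Do i) m (fun c m' => c <= 1 /\ Q m').
Proof.
move=> H [bi bm]; exists 1.
have ir r v : v < S -> exec S i m = set_ireg S m r v ->
    Q (Memory (upd (ireg m) r v) (imem m) (rreg m) (rmem m) (log m)) ->
    exists m', [/\ runs S (Do i) m 1 m', bounded m' & 1 <= 1 /\ Q m'].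
  move=> vS E q; eexists; split; [apply: RunDo; rewrite E /set_ireg vS //| |by split; [|exact: q]].
  by split=> //=; exact: bounded_upd.
have rr r v : exec S i m = set_rreg m r v ->
    Q (Memory (ireg m) (imem m) (upd (rreg m) r v) (rmem m) (log m)) ->
    exists m', [/\ runs S (Do i) m 1 m', bounded m' & 1 <= 1 /\ Q m'].
  by move=> E q; eexists; split; [apply: RunDo; rewrite E /set_rreg //| |by split; [|exact: q]].
case: i H ir rr => [r c|r a b|r a b|r a|a r|r c|r a b|r a b|r a b|r a b|r a|a r] /= H ir rr.
- by case: H => h q; exact: ir h erefl q.
- by case: H => h q; exact: ir h erefl q.
- by apply: ir _ erefl H; exact: leq_ltn_trans (leq_subr _ _) (bi a).
- by case: H => h q; apply: ir (bm _) _ q; rewrite h.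
- case: H => h q; eexists; split; [apply: RunDo; rewrite /= h //| |by split; [|exact: q]].
  by split=> //=; exact: bounded_upd.
- exact: rr erefl H.
- exact: rr erefl H.
- exact: rr erefl H.
- exact: rr erefl H.
- by case: H => h q; apply: rr _ q; rewrite (negPf h).
- by case: H => h q; apply: rr _ q; rewrite h.
- case: H => h q; eexists; split; [apply: RunDo; rewrite /= h //| |by split; [|exact: q]].
  by split.
Qed.

Lemma halts_conseq p m (Q Q' : nat -> memory R -> Prop) :
  halts p m Q -> (forall c m', Q c m' -> Q' c m') -> halts p m Q'.
Proof. by move=> H QQ /H[c [m' [r b q]]]; exists c, m'; split=> //; exact: QQ. Qed.

Lemma halts_seq p q m (Q : nat -> memory R -> Prop) :
  halts p m (fun c m' => halts q m' (fun c' => Q (c + c'))) -> halts (Seq p q) m Q.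
Proof.
move=> H /H[c [m' [r b /(_ b)[c' [m'' [r' b' Q']]]]]].
by exists (c + c'), m''; split=> //; exact: RunSeq r r'.
Qed.

Lemma halts_if t p q m (Q : nat -> memory R -> Prop) :
  (holds t m -> halts p m (fun c => Q c.+1)) -> (~~ holds t m -> halts q m (fun c => Q c.+1)) ->
  halts (If t p q) m Q.
Proof.
move=> Hp Hq b; have [h|h] := boolP (holds t m).
  by have [c [m' [r b' q']]] := Hp h b; exists c.+1, m'; split=> //; apply: RunIf; rewrite h.
by have [c [m' [r b' q']]] := Hq h b; exists c.+1, m'; split=> //; apply: RunIf; rewrite (negPf h).
Qed.

Lemma wp_halts p m Q : wp p m Q -> halts p m (fun c m' => c <= cost p /\ Q m').
Proof.
elim: p m Q => [|i|p IHp q IHq|t p IHp q IHq|//] m Q.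
- by move=> q b; exists 1, m; split=> //; exact: RunSkip.
- exact: safe_halts.
- move=> /IHp H; apply: halts_seq; apply: halts_conseq H _ => c m' [cp /IHq H].
  by apply: halts_conseq H _ => c' m'' [cq q']; split=> //=; lia.
- move=> /= [Hp Hq]; apply: halts_if => h.
    by apply: halts_conseq (IHp _ _ (Hp h)) _ => c m' [cp q']; split=> //; lia.
  by apply: halts_conseq (IHq _ _ (Hq h)) _ => c m' [cp q']; split=> //; lia.
Qed.

(** Amortization: an iteration pays at most [K] for each unit by which it lowers
    the potential [k], and one more unit per iteration pays for the test. *)
Lemma halts_while K (I : nat -> memory R -> Prop) t p :
  (forall k m, I k m -> holds t m ->
    halts p m (fun c m' => exists k', [/\ k' < k, c + K * k' <= K * k & I k' m'])) ->
  forall k m, I k m ->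
  halts (While t p) m (fun c m' => exists k', [/\ ~~ holds t m', I k' m'
     & c + K.+1 * k' <= K.+1 * k + 1]).
Proof.
move=> H k; have [j] := ubnP k; elim: j k => // j IH k; rewrite ltnS => kj m Im b.
have [h|h] := boolP (holds t m); last first.
  by exists 1, m; split=> //; [exact: RunWhileFalse|exists k; split=> //; lia].
have [c [m' [r b' [k' [kk ck Im']]]]] := H k m Im h b.
have [c' [m'' [r' b'' [k'' [h'' Im'' ck']]]]] := IH k' (leq_trans kk kj) m' Im' b'.
exists (c + c').+1, m''; split=> //; first exact: RunWhileTrue h r r'.
by exists k''; split=> //; nia.
Qed.

End Logic.
Arguments wp : simpl never.
Arguments safe : simpl never.
Arguments cost : simpl never.

Arguments upd T f a v i /.

(** * Arrays and symbolic execution *)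

Notation "p ;; q" := (Seq p q) (at level 61, right associativity).

(** Array [f] of a family of nine arrays of length [N] starts at the address
    [f * N]. Integer registers 2 to 5 hold 0, 1, 2, 3; register 7 holds addresses;
    register [10 + f] holds the start of array [f]; the variables of the program
    are registers 20 and above. The arrays are:
    - 0, the code of the input;
    - 1 to 5, indexed by nodes: parent, label, number of children (plus two for
      the sentinel), first and last leaf of the list of leaves;
    - 6, indexed by nodes: the next node of the same depth;
    - 7, indexed by depths: the first node of that depth;
    - 8, indexed by leaves: the next leaf of the same list.

    The sentinel is node 0, a node is the position of its opening bracket plus
    one, and a leaf is its symbol in the code, so that 0 can end all lists. *)
Definition ld r f i : prog := Do (IAdd 7 (10 + f) i) ;; Do (ILoad r 7).
Definition st f i r : prog := Do (IAdd 7 (10 + f) i) ;; Do (IStore 7 r).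

Definition view N (M : nat -> nat) (A : nat -> nat -> nat) : Prop :=
  forall f i, f < 9 -> i < N -> M (f * N + i) = A f i.

Definition put (A : nat -> nat -> nat) f i v : nat -> nat -> nat :=
  fun f' => if f' == f then upd (A f') i v else A f'.

Lemma view_put N M A f i v : view N M A -> i < N ->
  view N (upd M (f * N + i) v) (put A f i v).
Proof.
move=> vw iN f' i' f9 iN'; rewrite /upd /put.
have N0 : 0 < N by exact: leq_ltn_trans iN.
have [E|ne] := eqVneq (f' * N + i') (f * N + i).
  have ff : f' = f.
    have := congr1 (fun x => x %/ N) E.
    by rewrite /= !divnMDl // !divn_small // !addn0.
  by subst f'; rewrite eqxx; move/addnI: E => ->; rewrite /= eqxx.
have [ff|ff] := eqVneq f' f; last exact (vw _ _ f9 iN').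
subst f'; rewrite /=; case: (i' =P i) => [ii|_]; last exact (vw _ _ f9 iN').
by rewrite ii eqxx in ne.
Qed.

Definition consts N (g : nat -> nat) : Prop :=
  [/\ g 2 = 0, g 3 = 1, g 4 = 2, g 5 = 3
    & forall f, f < 9 -> g (10 + f) = f * N].

Lemma consts_upd N g r v : (r == 7) || (20 <= r) -> consts N g -> consts N (upd g r v).
Proof.
move=> hr [h2 h3 h4 h5 hb].
have ne k : k < 20 -> k != 7 -> upd g r v k = g k.
  by move=> k20 k7; rewrite /upd; case: eqP => // kr; move: hr; lia.
split; rewrite ?ne // => f f9; rewrite ne ?hb //; lia.
Qed.

Section Steps.
Variables (R : realType) (S N : nat).
Hypothesis SN : 9 * N <= S.
Implicit Types (Q : memory R -> Prop).

Lemma wp_seq p q (m : memory R) Q :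
  wp S p m (fun m' => wp S q m' Q) -> wp S (Seq p q) m Q.
Proof. by []. Qed.

Lemma wp_do i (m : memory R) Q : safe S i m Q -> wp S (Do i) m Q.
Proof. by []. Qed.

Lemma wp_if t p q (m : memory R) Q :
  (holds t m -> wp S p m Q) -> (~~ holds t m -> wp S q m Q) -> wp S (If t p q) m Q.
Proof. by []. Qed.

Lemma wp_skip (m : memory R) Q : Q m -> wp S Skip m Q.
Proof. by []. Qed.

Lemma addr_lt f i : f < 9 -> i < N -> f * N + i < S.
Proof. by move=> f9 iN; nia. Qed.

Lemma wp_ld g M A rr rm lg r f i Q : consts N g -> view N M A -> f < 9 -> i != 7 ->
  g i < N ->
  Q (Memory (upd (upd g 7 (f * N + g i)) r (A f (g i))) M rr rm lg) ->
  wp S (ld r f i) (Memory g M rr rm lg) Q.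
Proof.
move=> [_ _ _ _ hb] vw f9 i7 giN q; apply: wp_seq; apply: wp_do; rewrite /safe /= hb //.
split; first exact: addr_lt.
apply: wp_do; rewrite /safe /=; split; first exact: addr_lt.
by rewrite vw.
Qed.

Lemma wp_st g M A rr rm lg f i r Q : consts N g -> view N M A -> f < 9 -> i != 7 ->
  r != 7 -> g i < N ->
  (forall M', view N M' (put A f (g i) (g r)) ->
     Q (Memory (upd g 7 (f * N + g i)) M' rr rm lg)) ->
  wp S (st f i r) (Memory g M rr rm lg) Q.
Proof.
move=> [_ _ _ _ hb] vw f9 i7 r7 giN q; apply: wp_seq; apply: wp_do; rewrite /safe /= hb //.
split; first exact: addr_lt.
apply: wp_do; rewrite /safe /=; split; first exact: addr_lt.
apply: q; rewrite (negPf r7); exact: view_put.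
Qed.

End Steps.

(** One step of symbolic execution each; the bound on the index of a load or a
    store is left to the user. *)
Ltac consts_tac := repeat (apply: consts_upd; [by []|]); assumption.
Ltac step_load := apply: wp_seq; (eapply wp_ld; [eassumption|consts_tac|eassumption|by []|by []| |]); rewrite /=.
Ltac step_store := apply: wp_seq; (eapply wp_st; [eassumption|consts_tac|eassumption|by []|by []|by []| |]); rewrite /=.
Ltac step_do := apply: wp_seq; apply: wp_do; rewrite /safe /=.

(** Real registers 1 and 2 hold the old values of [d_k] and [d_l], registers 4 and 1
    receive the new ones; integer register 23 is the label, and register 31
    tells whether both leaves are deleted. *)
Definition values_prog : prog :=
  Do (IConst 31 0) ;; Do (RAdd 3 1 2) ;; Do (RConst 5 2) ;; Do (RConst 6 1) ;;
  Do (RConst 7 0) ;;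
  If (IEq 23 3)
    (If (REq 3 5)
       (If (REq 2 6)
          (Do (RConst 4 0) ;; Do (RConst 1 1))
          (Do (RSub 4 6 2) ;; Do (RMul 4 4 4) ;; Do (RSub 4 7 4) ;; Do (RConst 1 1) ;;
           Do (IConst 31 1)))
       (Do (RSub 4 3 5) ;; Do (RMul 1 1 2) ;; Do (RSub 1 1 6) ;; Do (RDiv 1 1 4)))
    (If (REq 3 7)
       (If (REq 2 7)
          (Do (RConst 4 0) ;; Do (RConst 1 0))
          (Do (RSub 4 7 2) ;; Do (RAdd 1 2 7) ;; Do (IConst 31 1)))
       (Do (RAdd 4 3 7) ;; Do (RMul 1 1 2) ;; Do (RDiv 1 1 3))).

Lemma wp_values (R : realType) S N g M (rr rm : nat -> R) lg dk dl rem_l Q :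
  consts N g -> 1 < S ->
  new_values (g 23 == 1) (rr 1) (rr 2) = (dk, dl, rem_l) ->
  (forall g' rr', g' = upd (upd g 31 0) 31 (nat_of_bool rem_l) \/ g' = upd g 31 (nat_of_bool rem_l) ->
     rr' 4 = dk -> rr' 1 = dl -> Q (Memory g' M rr' rm lg)) ->
  wp S values_prog (Memory g M rr rm lg) Q.
Proof.
move=> [_ g3 _ _ _] S1 nv q.
step_do; split; first exact: ltnW.
do 4 step_do.
have done g' rr' : g' = upd g 31 (nat_of_bool rem_l) \/
    g' = upd (upd g 31 0) 31 (nat_of_bool rem_l) ->
    (rr' 4, rr' 1) = (dk, dl) -> Q (Memory g' M rr' rm lg).
  by move=> hg [h4 h1]; apply: q; tauto.
apply: wp_if; rewrite /= g3 => lw; move: nv; rewrite /new_values ?lw ?(negPf lw).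
  case: ifP => s2; [|case: ifP => b1] => -[h4 h1 hr]; subst dk dl rem_l.
  - apply: wp_if; rewrite /= (negPf s2) // => _.
    step_do; step_do; step_do; apply: wp_do; rewrite /safe /=; split; first by rewrite subr_eq0.
    by apply: done; [left|].
  - have {}s2 := negbFE s2; apply: wp_if; rewrite /= s2 // => _.
    apply: wp_if; rewrite /= b1 // => _.
    by step_do; apply: wp_do; rewrite /safe /=; apply: done; [left|].
  - have {}s2 := negbFE s2; apply: wp_if; rewrite /= s2 // => _.
    apply: wp_if; rewrite /= b1 // => _.
    step_do; step_do; step_do; step_do; apply: wp_do; rewrite /safe /=; split; first exact: S1.
    by apply: done; [right|rewrite /= sub0r expr2].
case: ifP => s2; [|case: ifP => b1] => -[h4 h1 hr]; subst dk dl rem_l.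
- apply: wp_if; rewrite /= (negPf s2) // => _.
  step_do; step_do; apply: wp_do; rewrite /safe /=; rewrite addr0; split=> //.
  by apply: done; [left|rewrite /= ?addr0].
- have {}s2 := negbFE s2; apply: wp_if; rewrite /= s2 // => _.
  apply: wp_if; rewrite /= b1 // => _.
  by step_do; apply: wp_do; rewrite /safe /=; apply: done; [left|].
- have {}s2 := negbFE s2; apply: wp_if; rewrite /= s2 // => _.
  apply: wp_if; rewrite /= b1 // => _.
  step_do; step_do; apply: wp_do; rewrite /safe /=; split=> //.
  by apply: done; [right|rewrite /= sub0r addr0].
Qed.

(** * Linked lists *)

Fixpoint linked (nx : nat -> nat) (h : nat) (s : seq nat) : Prop :=
  if s is x :: s' then [/\ h = x, x != 0 & linked nx (nx x) s'] else h = 0.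

Lemma linked_upd nx h s a v : a \notin s -> linked nx h s -> linked (upd nx a v) h s.
Proof.
elim: s h => //= x s IH h; rewrite in_cons negb_or eq_sym => /andP[xa as'] [-> x0 H].
by split=> //; rewrite (negPf xa); exact: IH.
Qed.

(** Redirecting the last pointer of the first list is enough. *)
Lemma linked_cat nx h s h' s' : uniq s -> s != [::] -> ~~ has (mem s) s' ->
  linked nx h s -> linked nx h' s' ->
  linked (upd nx (last 0 s) h') h (s ++ s').
Proof.
elim: s h => // x s IH h /= /andP[xs us] _ dis [-> x0 H] H'; split=> //.
case: s xs us IH H dis => [|y s] xs us IH H dis /=.
  rewrite eqxx; apply: linked_upd => //; apply/negP => xs'.
  by move/hasPn: dis => /(_ _ xs') /=; rewrite inE eqxx.
have -> : (x == last y s) = false.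
  by apply: contraNF xs => /eqP->; exact: mem_last.
apply: (IH (nx x)) => //; apply: contra dis => /hasP[z zs' zs].
by apply/hasP; exists z => //=; rewrite inE (zs : z \in y :: s) orbT.
Qed.

(** * Handling one node *)

Lemma halts_wp_seq (R : realType) S p q (m : memory R) Q :
  wp S p m (fun m' => halts S q m' (fun c' m'' => forall c, c <= cost p -> Q (c + c') m'')) ->
  halts S (Seq p q) m Q.
Proof.
move=> /wp_halts H; apply: halts_seq; apply: halts_conseq H _ => c m' [cp H].
by apply: halts_conseq H _ => c' m''; apply.
Qed.

Definition leaf_id n (v : 'I_n) : nat := v + 3.

Lemma leaf_id_inj n : injective (@leaf_id n).
Proof. by move=> u v /addIn/val_inj. Qed.

(** The order in which the nodes are handled: deepest first. *)
Fixpoint buckets (bs : nat -> seq nat) D : seq nat :=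
  if D is d.+1 then bs D ++ buckets bs d else [::].

Lemma mem_buckets bs D c :
  reflect (exists2 d, 0 < d <= D & c \in bs d) (c \in buckets bs D).
Proof.
elim: D => [|D IH] /=; first by constructor => -[[|d]].
rewrite mem_cat; apply: (iffP orP) => [[cD|/IH[d /andP[d0 dD] cd]]|[d /andP[d0]]].
- by exists D.+1 => //; rewrite ltnSn.
- by exists d => //; rewrite d0 leqW.
rewrite leq_eqVlt => /predU1P[->|dD] cd; [by left|right].
by apply/IH; exists d => //; rewrite d0.
Qed.

Lemma eq_buckets bs bs' D : (forall d, d <= D -> bs d = bs' d) -> buckets bs D = buckets bs' D.
Proof.
elim: D => //= D IH H; rewrite H // IH // => d dD; apply: H; exact: leqW.
Qed.

Lemma buckets_pop (bs : nat -> seq nat) D w rest : 0 < D -> bs D = w :: rest ->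
  buckets bs D = w :: buckets (upd bs D rest) D.
Proof.
case: D => // D _ E; rewrite /= E eqxx /=; congr (_ :: _ ++ _).
by apply: eq_buckets => d dD /=; case: eqP => // h; lia.
Qed.

(** Variables: 20 is the current depth, 21 the node [w], 22 its parent [p], 23 and 24
    their labels, 25 and 26 their numbers of children, 27 the first leaf of [w] and
    28 the one after it. The leaf [v_k] is the first of the list and [v_l] the
    second, so that deletions shorten the list at its head. *)
Definition keep_prog : prog := Do (IAdd 27 28 2) ;; Do (ISub 25 25 3).
Definition drop_prog : prog := ld 27 8 28 ;; Do (ISub 25 25 4).

Definition reduce_prog : prog :=
  ld 28 8 27 ;; Do (ISub 29 27 5) ;; Do (ISub 30 28 5) ;;
  Do (RLoad 1 29) ;; Do (RLoad 2 30) ;; values_prog ;;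
  Do (RStore 29 4) ;; Do (RStore 30 1) ;;
  If (IEq 31 2) keep_prog drop_prog.

Definition fetch_prog : prog :=
  ld 22 6 21 ;; st 7 20 22 ;; ld 22 1 21 ;; ld 23 2 21 ;; ld 24 2 22 ;;
  ld 25 3 21 ;; ld 26 3 22 ;; ld 27 4 21.

Definition reduce_loop : prog := While (ILt 3 25) reduce_prog.

(** If [w] is an only child, its label is all that has to be stored: the label
    of [p] then agrees with it when the lists are spliced. *)
Definition solve_prog : prog :=
  If (IEq 23 24) Skip (If (ILt 26 4) (st 2 22 23) reduce_loop).

Definition splice_prog : prog :=
  ld 28 5 21 ;; ld 29 4 22 ;; st 8 28 29 ;; If (IEq 29 2) (st 5 22 28) Skip ;; st 4 22 27.

Definition merge_prog : prog :=
  If (ILt 2 25) splice_prog Skip ;;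
  Do (IAdd 26 26 25) ;; Do (ISub 26 26 3) ;; st 3 22 26.

Definition process_prog : prog :=
  ld 21 7 20 ;;
  If (IEq 21 2) (Do (ISub 20 20 3)) (fetch_prog ;; solve_prog ;; merge_prog).

Section Heap.
Variables (n : nat) (e : rel 'I_n) (N : nat) (dep : nat -> nat).
Implicit Types (A : nat -> nat -> nat) (L : nat -> seq 'I_n) (bs : nat -> seq nat).

(** The arrays describe the lists [L] of leaves and the lists [bs] of nodes of each
    depth. The sentinel has two phantom children, so that it never looks as
    if it had an only child. *)
Record heap A L bs D : Prop := Heap {
  heap_id : forall d c, 0 < d <= D -> c \in bs d -> [/\ dep c = d, c < N & A 1 c < N];
  heap_bucket : forall d, 0 < d <= D -> linked (A 6) (A 7 d) (bs d);
  heap_count : forall j, j \in 0 :: buckets bs D ->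
    A 3 j = arity (A 1) (buckets bs D) L j + 2 * (j == 0);
  heap_list : forall j, j \in 0 :: buckets bs D ->
    linked (A 8) (A 4 j) (map (@leaf_id n) (L j)) /\
    (L j != [::] -> A 5 j = last 0 (map (@leaf_id n) (L j))) }.

Lemma heap_lt A L bs D c : heap A L bs D -> c \in buckets bs D ->
  [/\ dep c <= D, c < N & A 1 c < N].
Proof.
move=> hp /mem_buckets[d dD cd]; have [-> cN pN] := heap_id hp dD cd.
by split=> //; case/andP: dD.
Qed.

Lemma all_leaves_mem ord L j u : j \in 0 :: ord -> u \in L j -> u \in all_leaves ord L.
Proof. by move=> jo uj; apply/flatten_mapP; exists j. Qed.

Lemma all_leaves_uniq_at ord L j :
  j \in 0 :: ord -> uniq (all_leaves ord L) -> uniq (L j).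
Proof.
rewrite /all_leaves; move: (0 :: ord) => s js; case/path.splitPr: js => s1 s2.
by rewrite map_cat flatten_cat /= !cat_uniq => /and3P[_ _ /and3P[]].
Qed.

(** The last pointer of [w] stays valid while leaves are taken from the head of
    its list. Pointers of other lists are not affected, as the lists
    are disjoint. *)
Lemma heap_pop A A' L bs D w rest pre s h lab (p := A 1 w) (ord := buckets (upd bs D rest) D) :
  lazy_tree e (A 1) dep lab (w :: ord) (upd L w s) -> heap A L bs D -> 0 < D ->
  bs D = w :: rest -> L w = pre ++ s -> linked (A 8) h (map (@leaf_id n) s) ->
  A' 1 = A 1 -> A' 6 = A 6 -> A' 7 = upd (A 7) D (A 6 w) ->
  A' 3 = upd (A 3) p (A 3 p + size s - 1) ->
  (if 0 < size s then [/\ A' 8 = upd (A 8) (A 5 w) (A 4 p),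
        A' 5 = (if A 4 p == 0 then upd (A 5) p (A 5 w) else A 5)
        & A' 4 = upd (A 4) p h]
      else [/\ A' 8 = A 8, A' 5 = A 5 & A' 4 = A 4]) ->
  heap A' (upd (upd L w s) p (s ++ L p)) (upd bs D rest) D.
Proof.
move=> sn hp D0 bsD Lw lks A1 A6 A7 A3 A458.
have bE := buckets_pop D0 bsD; rewrite -/ord in bE.
have bu := lazy_order sn; have := bu => /= /and3P[w0 po bu'].
have uL := all_leaves_uniq sn; rewrite (perm_uniq (all_leaves_cons _ _ _)) upd_same all_leaves_upd // in uL.
have sub j : j \in 0 :: ord -> j \in 0 :: buckets bs D.
  by rewrite bE !in_cons => /orP[->|->]; rewrite ?orbT.
have wo : w \in 0 :: buckets bs D by rewrite bE !in_cons eqxx orbT.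
have jw j : j \in 0 :: ord -> j != w by apply: contraTneq => ->.
split.
- move=> d c dD cd; have : c \in bs d.
    move: cd => /=; case: eqP => // ->; rewrite bsD in_cons => ->; exact: orbT.
  by rewrite A1; exact: (heap_id hp).
- move=> d dD; have := heap_bucket hp dD; rewrite A6 A7 /=.
  by have [->|_ //] := eqVneq d D; rewrite bsD => -[_ _].
- rewrite -/ord => j jo; rewrite A1 A3 /arity /=.
  have := heap_count hp (sub j jo); rewrite bE /arity /= -/p [p == j]eq_sym.
  have [->|jp] := eqVneq j p; last by rewrite (negPf (jw j jo)) add0n.
  by move=> /= ->; rewrite size_cat; lia.
rewrite -/ord => j jo; have [lj tj] := heap_list hp (sub j jo).
have [lw tw] := heap_list hp wo; have [lp tp] := heap_list hp (sub p po).
rewrite /= (negPf (jw j jo)); case: (posnP (size s)) A458 => [s0|s0].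
  have {s0} -> : s = [::] by apply: size0nil.
  by move=> [-> -> ->]; case: (j =P p) => [->|_].
have sn0 : s != [::] by case: (s) s0.
have A5w : A 5 w = last 0 (map (@leaf_id n) s).
  rewrite tw; last by rewrite Lw; case: (pre) (s) sn0 => [|? ?] [].
  by rewrite Lw map_cat last_cat; case: (s) sn0.
have us : uniq (map (@leaf_id n) s).
  by rewrite map_inj_uniq; [move: uL; rewrite cat_uniq => /andP[]|exact: leaf_id_inj].
have dis i : i \in 0 :: ord -> ~~ has (mem (map (@leaf_id n) s)) (map (@leaf_id n) (L i)).
  move=> io; apply/hasPn => _ /mapP[v vi ->] /=; rewrite mem_map; last exact: leaf_id_inj.
  apply/negP => vs; move: uL; rewrite cat_uniq => /and3P[_ /hasPn/(_ v)].
  by rewrite (all_leaves_mem io vi) /= vs => /(_ isT).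
move=> [-> -> ->]; have [->|jp] := eqVneq j p.
  rewrite /= eqxx map_cat A5w; split.
    by apply: linked_cat lks lp => //; [case: (s) sn0|exact: dis].
  move=> _; rewrite last_cat; have [h0|h0] := eqVneq (A 4 p) 0.
    have -> : L p = [::] by case: (L p) lp => //= a s' [<- /eqP]; rewrite h0.
    by rewrite /= eqxx.
  have Lp0 : L p != [::] by apply: contraNneq h0 => E; move: lp; rewrite E => /eqP.
  by rewrite tp //; case: (L p) Lp0.
split; last by case: (A 4 p == 0); rewrite /= ?(negPf jp).
rewrite /= (negPf jp); apply: linked_upd lj.
rewrite A5w; have := dis j jo; move/hasPn => dis'.
apply/negP => h1; have /negP := dis' _ h1; apply => /=.
by case: (s) sn0 => // a s' _; rewrite /= mem_last.
Qed.

End Heap.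

Section Iteration.
Variables (R : realType) (n : nat) (e : rel 'I_n) (t0 : cotree 'I_n) (x : R).
Variables (S N : nat) (dep : nat -> nat).
Hypotheses (SN : 9 * N <= S) (S3 : 3 < S) (nN : n + 3 <= N) (NS : n + N + 3 <= S).
Implicit Types (A : nat -> nat -> nat) (L : nat -> seq 'I_n) (bs : nat -> seq nat).
Implicit Types (g : nat -> nat) (M : nat -> nat) (rr rm : nat -> R) (lg : seq (nat * R)).

Definition to_log (tr : seq ('I_n * R)) : seq (nat * R) :=
  [seq (nat_of_ord a.1, a.2) | a <- tr].

(** The tie between the machine and [diag_run]. The cotree itself stays existential:
    it is not stored, and only its leaves [X] are known to the program. *)
Definition tracks rm lg (X : seq 'I_n) : Prop :=
  exists tr T (U : {set 'I_n}) (d : {ffun 'I_n -> R}),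
  [/\ diag_run e (diag_start t0 x) tr (T, d), option_cotree_on e U T, U =i X,
      lg = to_log (diag_init_trace n x ++ tr) & forall i : 'I_n, rm i = d i].

Lemma wp_reduce g M A rr rm lg (k l : 'I_n) dk dl rem_l Q :
  consts N g -> view N M A -> g 27 = leaf_id k -> A 8 (leaf_id k) = leaf_id l ->
  new_values (g 23 == 1) (rm k) (rm l) = (dk, dl, rem_l) ->
  (forall g' rr', consts N g' ->
     [/\ g' 20 = g 20, g' 21 = g 21, g' 22 = g 22, g' 23 = g 23 & g' 26 = g 26] ->
     g' 27 = (if rem_l then A 8 (leaf_id l) else leaf_id l) ->
     g' 25 = g 25 - (if rem_l then 2 else 1) ->
     Q (Memory g' M rr' (upd (upd rm k dk) l dl) (lg ++ [:: (k : nat, dk); (l : nat, dl)]))) ->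
  wp S reduce_prog (Memory g M rr rm lg) Q.
Proof.
move=> cg vw gk Ak nv q.
have lN (v : 'I_n) : leaf_id v < N by rewrite /leaf_id; have := ltn_ord v; lia.
have lS (v : 'I_n) : v < S by have := lN v; rewrite /leaf_id; lia.
have [g2 g3 g4 g5 gb] := cg.
step_load; first by rewrite gk.
step_do; step_do; step_do; split; first by rewrite gk g5 /leaf_id addnK.
step_do; split; first by rewrite gk g5 Ak /leaf_id addnK.
rewrite gk g5 Ak /leaf_id !addnK -!/(leaf_id _).
apply: wp_seq; apply: (wp_values (N := N) (dk := dk) (dl := dl) (rem_l := rem_l)) => [|||g1 rr1 hg1 h4 h1].
- by consts_tac.
- exact: leq_trans S3.
- exact: nv.
have c1 : consts N g1 by case: hg1 => ->; consts_tac.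
have [g1' g1k g1l g1r] : [/\ forall r, (20 <= r <= 27) -> g1 r = g r, g1 29 = k, g1 30 = l
    & g1 31 = rem_l /\ g1 28 = leaf_id l].
  split; last by case: hg1 => ->.
  - by move=> r hr; case: hg1 => -> /=; repeat (case: eqP => [?|_]; first lia).
  - by case: hg1 => ->.
  - by case: hg1 => ->.
have [g131 g128] := g1r.
step_do; split; first by rewrite g1k.
step_do; split; first by rewrite g1l.
rewrite g1k g1l h4 h1.
have lgE : rcons (rcons lg (k : nat, dk)) (l : nat, dl) = lg ++ [:: (k : nat, dk); (l : nat, dl)].
  by rewrite -!cats1 -catA.
rewrite lgE; have [c12 c13 c14 _ _] := c1.
apply: wp_if; rewrite /= g131 c12 => hr.
  have {}hr : rem_l = false by case: (rem_l) hr.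
  subst rem_l; step_do; split; first by rewrite g128 c12 addn0; apply: leq_trans (lN l) _; lia.
  apply: wp_do; rewrite /safe /=; apply: q; [by consts_tac|by split; rewrite /= g1'|by rewrite /= g128 c12 addn0|].
  by rewrite /= g1' // c13.
have {}hr : rem_l = true by case: (rem_l) hr.
subst rem_l; apply: wp_seq; (eapply wp_ld; [eassumption|consts_tac|eassumption|by []|by []| |]); rewrite /= g128 //.
apply: wp_do; rewrite /safe /=; apply: q; [by consts_tac|by split; rewrite /= g1'|by rewrite /= ?g128|].
by rewrite /= g1' // c14.
Qed.

Lemma tracks_reduce par lab w ord L (k l : 'I_n) rest rm lg dk dl rem_l :
  lazy_tree e par dep lab (w :: ord) L ->
  {in ord, forall j, 0 < arity par (w :: ord) L j} ->
  {in ord, forall c, dep c <= dep w} ->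
  lab w != lab (par w) -> (par w \in ord -> 1 < arity par (w :: ord) L (par w)) ->
  L w = [:: k, l & rest] ->
  tracks rm lg (all_leaves (w :: ord) L) ->
  new_values (lab w == 1) (rm k) (rm l) = (dk, dl, rem_l) ->
  tracks (upd (upd rm k dk) l dl) (lg ++ [:: (k : nat, dk); (l : nat, dl)])
    (all_leaves (w :: ord) (upd L w (if rem_l then rest else l :: rest))).
Proof.
move=> sn al dw lw pw Lw [tr [T [U [d [run cT UX lgE rmE]]]]]; rewrite !rmE => nv.
have [T' [U' [st cT' UX']]] := reduce_step sn al dw lw pw Lw cT UX nv.
exists (tr ++ [:: (k, dk); (l, dl)]), T', U', (updated d k l dk dl); split=> //.
- apply: diag_run_cat run _; rewrite -[X in diag_run _ _ X _]cats0.
  by apply: DiagRunStep st _; exact: DiagRunNil.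
- by rewrite lgE /to_log !map_cat -!catA.
move=> i; rewrite /= ffunE !(inj_eq val_inj).
have uL := all_leaves_uniq sn; rewrite (perm_uniq (all_leaves_cons _ _ _)) Lw in uL.
have lk : (l == k) = false.
  by apply/negbTE; move: uL => /= /andP[]; rewrite inE negb_or eq_sym => /andP[].
by have [->|il] := eqVneq i l; rewrite ?lk ?rmE.
Qed.

(** The potential is the number of leaves in the list. *)
Lemma reduce_loop_ok par lab w ord L A g M rr rm lg :
  lazy_tree e par dep lab (w :: ord) L ->
  {in ord, forall j, 0 < arity par (w :: ord) L j} ->
  {in ord, forall c, dep c <= dep w} ->
  lab w != lab (par w) -> (par w \in ord -> 1 < arity par (w :: ord) L (par w)) ->
  consts N g -> view N M A -> g 23 = lab w -> g 25 = size (L w) ->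
  linked (A 8) (g 27) (map (@leaf_id n) (L w)) ->
  tracks rm lg (all_leaves (w :: ord) L) ->
  halts S reduce_loop (Memory g M rr rm lg) (fun c m' => exists g' rr' rm' lg' pre s,
    [/\ m' = Memory g' M rr' rm' lg',
        [/\ consts N g', g' 20 = g 20, g' 21 = g 21, g' 22 = g 22 & g' 26 = g 26],
        [/\ g' 25 = size s, size s <= 1, L w = pre ++ s
          & linked (A 8) (g' 27) (map (@leaf_id n) s)],
        lazy_tree e par dep lab (w :: ord) (upd L w s) /\
        tracks rm' lg' (all_leaves (w :: ord) (upd L w s))
      & c + (cost reduce_prog).+1 * size s <= (cost reduce_prog).+1 * size (L w) + 1]).
Proof.
move=> sn al dw lw pw cg vw g23 g25 lk tk.
have bu := lazy_order sn.
pose I k m' := exists g' rr' rm' lg' pre s,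
    [/\ m' = Memory g' M rr' rm' lg',
        [/\ consts N g', g' 20 = g 20, g' 21 = g 21, g' 22 = g 22 & g' 26 = g 26],
        [/\ g' 25 = size s, g' 23 = lab w, L w = pre ++ s
          & linked (A 8) (g' 27) (map (@leaf_id n) s)],
        lazy_tree e par dep lab (w :: ord) (upd L w s) /\
        tracks rm' lg' (all_leaves (w :: ord) (upd L w s))
      & k = size s].
have I0 : I (size (L w)) (Memory g M rr rm lg).
  by exists g, rr, rm, lg, [::], (L w); split=> //; split=> //; rewrite upd_id.
apply: halts_conseq (halts_while (K := cost reduce_prog) (I := I) _ I0) _; last first.
  move=> c m' [k [nh [g' [rr' [rm' [lg' [pre [s [mE h1 [h2 h3 h4 h5] h6 ks]]]]]]] ck]].
  subst m'.
  exists g', rr', rm', lg', pre, s; split=> //; last by rewrite -ks.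
  have [_ g'3 _ _ _] : consts N g' by case: h1.
  by split=> //; move: nh; rewrite /= g'3 h2 -leqNgt.
move=> {I0} k m [g' [rr' [rm' [lg' [pre [s [-> [cg' h20 h21 h22 h26] [h25 h23 Ls lk'] [sn' tk'] ks]]]]]]].
have [_ g'3 _ _ _] := cg'; rewrite /= g'3 h25.
case: s h25 Ls lk' sn' tk' ks => [|a [|b rest]] // h25 Ls lk' sn' tk' ks _.
set L1 := upd L w [:: a, b & rest] in sn' tk'.
case nv: (new_values (lab w == 1) (rm' a) (rm' b)) => [[dk dl] rem_l].
have L1w : L1 w = [:: a, b & rest] by rewrite /L1 /= eqxx.
have ar j : j != w -> arity par (w :: ord) L1 j = arity par (w :: ord) L j.
  by move=> jw; rewrite /arity /L1 upd_other.
have jw j : j \in ord -> j != w.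
  move: bu => /= /andP[w0 _] jo; apply: contraNneq w0 => <-.
  by rewrite in_cons jo orbT.
have sn2 := sn'; have tk2 := tracks_reduce sn2 (lab := lab) _ dw lw _ L1w tk' nv.
have {}tk2 := tk2 (fun j jo => etrans (congr1 (leq 1) (ar j (jw j jo))) (al j jo))
  (fun po => etrans (congr1 (leq 2) (ar _ (jw _ po))) (pw po)).
have sub : subseq (if rem_l then rest else b :: rest) (L1 w).
  rewrite L1w; case: (rem_l); last exact: subseq_cons.
  by apply: subseq_trans (subseq_cons _ _) (subseq_cons _ _).
have sn3 := lazy_tree_shrink sn2 sub.
rewrite /L1 upd_upd in sn3 tk2.
move: lk' => /= [h27 _ [Ak b0 lk']].
apply: halts_conseq (wp_halts (wp_reduce rr' (lg := lg') (A := A) (k := a) (l := b) (rm := rm') cg' vw h27 Ak _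
  (Q := fun m' => exists k', k' < k /\ I k' m') _)) _.
- by rewrite h23; exact: nv.
- move=> g2 rr2 cg2 [e20 e21 e22 e23 e26] e27 e25.
  exists (size (if rem_l then rest else b :: rest)); split.
    by rewrite ks; case: (rem_l) => //=; lia.
  exists g2, rr2, (upd (upd rm' a dk) b dl), (lg' ++ [:: (a : nat, dk); (b : nat, dl)]).
  exists (if rem_l then pre ++ [:: a; b] else pre ++ [:: a]).
  exists (if rem_l then rest else b :: rest); split=> //.
  + by split=> //; congruence.
  + split; [by rewrite e25 h25; case: (rem_l) => /=; lia|by rewrite e23| |].
      by rewrite Ls; case: (rem_l); rewrite -catA.
    by rewrite e27; case: (rem_l).
- move=> c m2 [cc [k' [kk Ik]]]; exists k'; split=> //.
  by move: (cost _) cc => K cc; nia.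
Qed.

Lemma wp_fetch g M A rr rm lg Q : consts N g -> view N M A ->
  g 20 < N -> g 21 < N -> A 1 (g 21) < N ->
  (forall g' M', consts N g' -> view N M' (put A 7 (g 20) (A 6 (g 21))) ->
     g' 20 = g 20 -> g' 21 = g 21 -> g' 22 = A 1 (g 21) ->
     g' 23 = A 2 (g 21) -> g' 24 = A 2 (A 1 (g 21)) -> g' 25 = A 3 (g 21) ->
     g' 26 = A 3 (A 1 (g 21)) -> g' 27 = A 4 (g 21) -> Q (Memory g' M' rr rm lg)) ->
  wp S fetch_prog (Memory g M rr rm lg) Q.
Proof.
move=> cg vw h20 h21 h1 q; rewrite /fetch_prog.
step_load; first by [].
step_store; first by [].
move=> M' vw'.
step_load; first by []. step_load; first by []. step_load; first by []. step_load; first by []. step_load; first by [].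
eapply wp_ld; [eassumption|consts_tac|eassumption|by []|by []|by []|].
by apply: q => //; consts_tac.
Qed.

Lemma wp_merge g M A rr rm lg Q : consts N g -> view N M A ->
  g 21 < N -> g 22 < N -> (0 < g 25 -> A 5 (g 21) < N) -> g 26 + g 25 < S ->
  (forall g' M' A', consts N g' -> view N M' A' -> g' 20 = g 20 ->
     [/\ A' 1 = A 1, A' 2 = A 2, A' 6 = A 6 & A' 7 = A 7] ->
     A' 3 = upd (A 3) (g 22) (g 26 + g 25 - 1) ->
     (if 0 < g 25 then [/\ A' 8 = upd (A 8) (A 5 (g 21)) (A 4 (g 22)),
        A' 5 = (if A 4 (g 22) == 0 then upd (A 5) (g 22) (A 5 (g 21)) else A 5)
        & A' 4 = upd (A 4) (g 22) (g 27)]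
      else [/\ A' 8 = A 8, A' 5 = A 5 & A' 4 = A 4]) ->
     Q (Memory g' M' rr rm lg)) ->
  wp S merge_prog (Memory g M rr rm lg) Q.
Proof.
clear S3 nN NS.
move=> cg vw h21 h22 h5 hS q; have [g2 g3 _ _ _] := cg.
have fin g1 M1 A1 : consts N g1 -> view N M1 A1 -> (forall r, 20 <= r <= 27 -> g1 r = g r) ->
    [/\ A1 1 = A 1, A1 2 = A 2, A1 6 = A 6, A1 7 = A 7 & A1 3 = A 3] ->
    (if 0 < g 25 then [/\ A1 8 = upd (A 8) (A 5 (g 21)) (A 4 (g 22)),
        A1 5 = (if A 4 (g 22) == 0 then upd (A 5) (g 22) (A 5 (g 21)) else A 5)
        & A1 4 = upd (A 4) (g 22) (g 27)]
      else [/\ A1 8 = A 8, A1 5 = A 5 & A1 4 = A 4]) ->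
    wp S (Do (IAdd 26 26 25) ;; Do (ISub 26 26 3) ;; st 3 22 26) (Memory g1 M1 rr rm lg) Q.
  move=> c1 v1 gE [A11 A12 A16 A17 A13] Ac; have [_ g13 _ _ _] := c1.
  step_do; rewrite !gE //; split=> //.
  step_do; rewrite g13 -/(put A1 3 _ _).
  eapply wp_st; [eassumption|consts_tac|eassumption|by []|by []|by []|by rewrite /= gE|].
  move=> M2 v2; apply: (q _ _ _ _ v2) => //=; rewrite ?gE //; first by consts_tac.
  by rewrite /put /= ?gE // A13.
apply: wp_seq; apply: wp_if; rewrite /= g2 => h25; last first.
  by apply: wp_skip; apply: (fin g M A) => //; rewrite (negPf h25).
apply: wp_seq; (eapply wp_ld; [eassumption|consts_tac|eassumption|by []|by []|by []|]).
step_load; first by [].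
step_store; first exact: h5.
move=> M1 v1; apply: wp_seq; apply: wp_if; rewrite /= g2 => hp0.
  eapply wp_st; [eassumption|consts_tac|eassumption|by []|by []|by []|by []|].
  move=> M2 v2; eapply wp_st; [eassumption|consts_tac|eassumption|by []|by []|by []|by []|].
  move=> M3 v3; apply: (fin _ _ _ _ v3) => //; first by consts_tac.
    by move=> r hr /=; repeat (case: eqP => [?|_]; first lia).
  by rewrite h25 hp0.
apply: wp_skip; eapply wp_st; [eassumption|consts_tac|eassumption|by []|by []|by []|by []|].
move=> M3 v3; apply: (fin _ _ _ _ v3) => //; first by consts_tac.
  by move=> r hr /=; repeat (case: eqP => [?|_]; first lia).
by rewrite h25 (negPf hp0).
Qed.

End Iteration.

(** * The main loop *)

Section MainLoop.
Variables (R : realType) (n : nat) (e : rel 'I_n) (t0 : cotree 'I_n) (x : R).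
Variables (S N : nat) (dep : nat -> nat).
Hypotheses (SN : 9 * N <= S) (S3 : 3 < S) (nN : n + 3 <= N) (NS : n + N + 3 <= S).
Implicit Types (A : nat -> nat -> nat) (L : nat -> seq 'I_n) (bs : nat -> seq nat).
Implicit Types (g : nat -> nat) (M : nat -> nat) (rr rm : nat -> R) (lg : seq (nat * R)).

Local Notation K1 := (cost reduce_prog).+1.

Lemma solve_ok A w ord L g M rr rm lg (p := A 1 w) (lab := A 2) :
  lazy_tree e (A 1) dep lab (w :: ord) L ->
  {in ord, forall j, 0 < arity (A 1) (w :: ord) L j} -> 0 < size (L w) ->
  {in ord, forall c, dep c <= dep w} ->
  consts N g -> view N M A -> p < N ->
  g 22 = p -> g 23 = lab w -> g 24 = lab p -> g 25 = size (L w) ->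
  g 26 = arity (A 1) (w :: ord) L p + 2 * (p == 0) ->
  linked (A 8) (g 27) (map (@leaf_id n) (L w)) ->
  tracks e t0 x rm lg (all_leaves (w :: ord) L) ->
  halts S solve_prog (Memory g M rr rm lg) (fun c m' =>
    exists g' M' rr' rm' lg' A' pre s,
    [/\ m' = Memory g' M' rr' rm' lg',
        [/\ consts N g', view N M' A' & A' = A \/ A' = put A 2 p (lab w)],
        [/\ g' 20 = g 20, g' 21 = g 21, g' 22 = p, g' 25 = size s & g' 26 = g 26],
        L w = pre ++ s /\ linked (A 8) (g' 27) (map (@leaf_id n) s)
      & [/\ lazy_tree e (A 1) dep lab (w :: ord) (upd L w s),
            tracks e t0 x rm' lg' (all_leaves (w :: ord) (upd L w s)),
            [\/ [/\ A' 2 = lab, size s <= 1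
               & p \in ord -> 1 < size s + arity (A 1) (w :: ord) L p],
               [/\ A' 2 = lab, lab w = lab p & 0 < size s]
             | [/\ A' 2 = upd lab p (lab w), p \in ord, 0 < size s
               & arity (A 1) (w :: ord) L p = 1]]
          & c + K1 * size s <= K1 * size (L w) + 10]]).
Proof.
move=> sn al Lw dw cg vw pN g22 g23 g24 g25 g26 lk tk.
have bu := lazy_order sn; have := bu => /= /and3P[w0 po bu'].
apply: halts_if; rewrite /= g23 g24 => lwp.
  have := wp_halts (wp_skip S (m := Memory g M rr rm lg)
    (Q := fun m' => m' = Memory g M rr rm lg) erefl).
  move=> H; apply: halts_conseq H _.
  move=> c m' [cc ->]; exists g, M, rr, rm, lg, A, [::], (L w); split=> //.
    by split=> //; left.
  split=> //; rewrite ?upd_id //; last by rewrite /cost in cc; lia.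
  by apply: Or32; split=> //; exact/eqP.
have [g2 g3 g4 g5 gb] := cg.
apply: halts_if; rewrite /= g26 g4 => ap.
  have p0 : p == 0 = false by apply/negP => p0; rewrite p0 in ap; lia.
  have po' : p \in ord by move: po; rewrite in_cons p0.
  rewrite p0 /= addn0 in ap.
  have E : wp S (st 2 22 23) (Memory g M rr rm lg) (fun m' => exists g' M',
      [/\ m' = Memory g' M' rr rm lg, consts N g',
          view N M' (put A 2 p (lab w)) & forall r, 20 <= r <= 27 -> g' r = g r]).
    apply: (wp_st SN cg vw) => //; first by rewrite g22.
    move=> M' v'; exists (upd g 7 (2 * N + g 22)), M'; split=> //.
      by rewrite -g22 -g23.
    by move=> r hr /=; case: eqP => // ?; lia.
  apply: halts_conseq (wp_halts E) _ => {E}.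
  move=> c m' [cc [g' [M' [-> cg' vw' gE]]]].
  exists g', M', rr, rm, lg, (put A 2 p (lab w)), [::], (L w); rewrite !gE //; split=> //.
    by split=> //; right.
  split=> //; rewrite ?upd_id //; last by rewrite /cost /= in cc; lia.
  apply: Or33; split=> //.
  by have := al p po'; lia.
have ar2 : p \in ord -> 1 < arity (A 1) (w :: ord) L p.
  move=> po'; have p0 : p == 0 = false.
    by apply: contraTF (bottom_up_uniq bu') => /= /eqP <-; rewrite po'.
  by rewrite p0 in ap; lia.
have := @reduce_loop_ok R n e t0 x S N dep SN S3 nN NS (A 1) lab w ord L A g M rr rm lg
  sn al dw lwp ar2 cg vw g23 g25 lk tk.
move=> H; apply: halts_conseq H _.
move=> c m' [g' [rr' [rm' [lg' [pre [s [-> [cg' h20 h21 h22 h26] [h25 s1 Ls lk'] [sn' tk'] cc]]]]]]].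
exists g', M, rr', rm', lg', A, pre, s; rewrite h22 h26; split=> //.
  by split=> //; left.
split=> //; last by lia.
by apply: Or31; split=> // po'; have := ar2 po'; lia.
Qed.

(** Covers the fixed part of an iteration and, through the cost of one
    reduction, each leaf that it deletes. *)
Definition iteration_cost : nat :=
  cost (ld 21 7 20) + cost fetch_prog + K1 + cost merge_prog + 20.

(** The potential counts the remaining depths, nodes and leaves: an iteration
    either descends to the next depth or handles a node, and in the latter case
    its cost is proportional to one plus the number of deleted leaves. *)
Definition main_inv (k : nat) (m : memory R) : Prop :=
  exists g M rr rm lg A L bs D,
  [/\ m = Memory g M rr rm lg, [/\ consts N g, view N M A, g 20 = D & D < N],
      heap N dep A L bs D,
      lazy_tree e (A 1) dep (A 2) (buckets bs D) L /\
      {in buckets bs D, forall j, 0 < arity (A 1) (buckets bs D) L j}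
    & tracks e t0 x rm lg (all_leaves (buckets bs D) L) /\
      k = D + size (buckets bs D) + size (all_leaves (buckets bs D) L)].

Lemma process_ok k m : main_inv k m -> holds (ILt 2 20) m ->
  halts S process_prog m (fun c m' =>
    exists k', [/\ k' < k, c + iteration_cost * k' <= iteration_cost * k & main_inv k' m']).
Proof.
move=> [g [M [rr [rm [lg [A [L [bs [D [-> [cg vw g20 DN] hp [sn al] [tk ->]]]]]]]]]]].
have [g2 g3 g4 g5 gb] := cg; rewrite /= g2 g20 => D0.
apply: halts_wp_seq; (eapply wp_ld; [eassumption|consts_tac|eassumption|by []|by []|by rewrite g20|]).
rewrite g20; set w := A 7 D.
have DD : 0 < D <= D by rewrite D0 leqnn.
have lkD := heap_bucket hp DD; rewrite -/w in lkD.
set g1 := upd (upd g _ _) _ _; have cg1 : consts N g1 by consts_tac.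
have g1w : g1 21 = w by []. have g1D : g1 20 = D by rewrite /g1 /= g20.
clearbody g1; have [g12 g13 _ _ _] := cg1.
apply: halts_if; rewrite /= g12 g1w => w0.
  have bD : bs D = [::].
    by move: lkD; case: (bs D) => //= a s [wa]; rewrite -wa w0.
  have bE : buckets bs D = buckets bs D.-1 by case: (D) D0 bD => // D' _ /= ->.
  have := wp_halts (S := S) (wp_do (i := ISub 20 20 3) (m := Memory g1 M rr rm lg)
    (Q := fun m' => m' = Memory (upd g1 20 (g1 20 - g1 3)) M rr rm lg) (erefl _)).
  move=> H; apply: halts_conseq H _ => c m' [cc ->] c1 hc1.
  have eD : g1 20 - g1 3 = D.-1 by rewrite g13 g1D subn1.
  exists (D.-1 + size (buckets bs D) + size (all_leaves (buckets bs D) L)); split.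
    by rewrite !ltn_add2r prednK.
    have hc : c1 + c.+1 <= iteration_cost.
      have c_1 : c <= 1 := cc; rewrite /iteration_cost.
      by move: (cost _) (cost _) (cost _) (cost _) hc1 => *; lia.
    by rewrite -[X in _ <= _ * (X + _ + _)](prednK D0) !addSn mulnS leq_add2r.
  exists (upd g1 20 D.-1), M, rr, rm, lg, A, L, bs, D.-1; rewrite eD; split=> //.
  - by split=> //; [consts_tac|lia].
  - split=> [d c' dD|d dD||]; rewrite -?bE.
    + by apply: (heap_id hp); lia.
    + by apply: (heap_bucket hp); lia.
    + exact: heap_count hp.
    + exact: heap_list hp.
  - by rewrite -bE.
  - by rewrite -bE.
have [rest bD lkr] : exists2 rest, bs D = w :: rest & linked (A 6) (A 6 w) rest.
  move: lkD w0; case: (bs D) => [/= ->//|a s /= [-> _ lks] _].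
  by exists s.
have bE := buckets_pop D0 bD; set ord := buckets (upd bs D rest) D in bE.
have [depw wN pN] : [/\ dep w = D, w < N & A 1 w < N].
  by apply: (heap_id hp DD); rewrite bD mem_head.
have wB : w \in buckets bs D by rewrite bE mem_head.
have sub j : j \in 0 :: ord -> j \in 0 :: buckets bs D.
  by rewrite bE !in_cons => /orP[->|->]; rewrite ?orbT.
have bu := lazy_order sn; rewrite bE in bu; have := bu => /= /and3P[w0' po bu'].
have p0 := sub _ po.
have [lkw tlw] := heap_list hp (j := w) (mem_behead (s := 0 :: _) wB).
have cw : A 3 w = size (L w).
  rewrite (heap_count hp (mem_behead (s := 0 :: _) wB)) bE arity_head // (negPf w0) muln0 addn0 //.
have Lw0 : 0 < size (L w) by have := al w wB; rewrite bE arity_head.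
rewrite bE in sn al tk *.
have dw : {in ord, forall c, dep c <= dep w}.
  move=> c co; rewrite depw; have cB : c \in buckets bs D by rewrite bE in_cons co orbT.
  by have [] := heap_lt hp cB.
have al' : {in ord, forall j, 0 < arity (A 1) (w :: ord) L j}.
  by move=> j jo; apply: al; rewrite in_cons jo orbT.
have uL := all_leaves_uniq sn; have uL' := uL.
rewrite (perm_uniq (all_leaves_cons _ _ _)) in uL'.
have sumS : A 3 (A 1 w) + size (L w) < S.
  rewrite (heap_count hp p0) bE.
  have szo : size (w :: ord) <= N.
    have uo : uniq (w :: ord) by have /andP[] := bottom_up_uniq bu.
    rewrite -[X in _ <= X](size_iota 0 N); apply: uniq_leq_size uo _ => c co.
    by rewrite mem_iota; rewrite -bE in co; have [] := heap_lt hp co.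
  have szl : size (L w) + size (L (A 1 w)) <= n.
    have usw : uniq (L w ++ L (A 1 w)).
      have := uL'; rewrite cat_uniq => /and3P[u1 /hasPn u2 u3].
      rewrite cat_uniq u1 (all_leaves_uniq_at po u3) andbT; apply/hasPn => v vp.
      by apply: u2; exact: all_leaves_mem po vp.
    by rewrite -size_cat -(card_uniqP usw) -[X in _ <= X]card_ord max_card.
  have := count_size (fun c => A 1 c == A 1 w) (w :: ord).
  have b1 : (A 1 w == 0 :> nat) <= 1 by case: (A 1 w == 0).
  by rewrite /arity; lia.
pose a1 := put A 7 D (A 6 w).
apply: halts_wp_seq; apply: (wp_fetch SN cg1 vw); rewrite ?g1D ?g1w //.
move=> g2' M' cg' vw' f20 f21 f22 f23 f24 f25 f26 f27.
have f25' : g2' 25 = size (L w) by rewrite f25 cw.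
have f26' : g2' 26 = arity (A 1) (w :: ord) L (A 1 w) + 2 * (A 1 w == 0).
  by rewrite f26 (heap_count hp p0) bE.
have lk' : linked (a1 8) (g2' 27) (map (@leaf_id n) (L w)) by rewrite f27.
have H := @solve_ok a1 w ord L g2' M' rr rm lg sn al' Lw0 dw cg' vw' pN f22 f23 f24 f25' f26' lk' tk.
apply: halts_seq; apply: halts_conseq H _.
move=> c3 m3 [g3' [M3 [rr3 [rm3 [lg3 [A3 [pre [s [-> [cg3 vw3 A3E] [e20 e21 e22 e25 e26] [Ls lks] [sn3 tk3 cases cc3]]]]]]]]]].
have wpn : A 1 w != w by exact: bottom_up_head bu (mem_head _ _).
have [A31 A33 A34 A35] : [/\ A3 1 = A 1, A3 3 = A 3, A3 4 = A 4 & A3 5 = A 5] by case: A3E => ->.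
have [A36 A37 A38] : [/\ A3 6 = A 6, A3 7 = upd (A 7) D (A 6 w) & A3 8 = A 8] by case: A3E => ->.
have sLw : size s <= size (L w) by rewrite Ls size_cat leq_addl.
have E : wp S merge_prog (Memory g3' M3 rr3 rm3 lg3) (fun m' =>
    main_inv (D + size ord + (size s + size (all_leaves ord L))) m').
  apply: (wp_merge SN cg3 vw3); rewrite ?e22 ?e21 ?f21 //.
  - rewrite A35 => _; rewrite tlw; last by rewrite -size_eq0 -lt0n.
    have : last 0 (map (@leaf_id n) (L w)) \in map (@leaf_id n) (L w).
      by case: (L w) Lw0 => //= a s' _; exact: mem_last.
    by case/mapP => v _ ->; apply: leq_trans nN; rewrite /leaf_id ltn_add2r.
  - by rewrite e25 e26 f26; apply: leq_ltn_trans sumS; rewrite leq_add2l.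
  move=> g5' M4 A4 cg4 vw4 h20 [A41 A42 A46 A47] A43 A458.
  pose L' := upd (upd L w s) (A 1 w) (s ++ L (A 1 w)).
  have L'E : L' = upd (upd L w s) (A 1 w) (upd L w s w ++ upd L w s (A 1 w)).
    by rewrite upd_same (upd_other _ _ wpn).
  have arE j : j != w -> arity (A 1) (w :: ord) (upd L w s) j = arity (A 1) (w :: ord) L j.
    by move=> jw; rewrite /arity upd_other.
  have jw j : j \in ord -> j != w.
    by move=> jo; apply: contraNneq w0' => <-; rewrite in_cons jo orbT.
  have al3 : {in ord, forall j, 0 < arity (A 1) (w :: ord) (upd L w s) j}.
    by move=> j jo; rewrite arE ?al' ?jw.
  have := @lazy_tree_merge _ e (A 1) dep (A 2) (A3 2) w ord (upd L w s) sn3 al3 dw.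
  rewrite -L'E upd_same arE // => /(_ cases)[sn4 al4 pm].
  exists g5', M4, rr3, rm3, lg3, A4, L', (upd bs D rest), D; split=> //.
  - by split=> //; rewrite h20 e20 f20.
  - rewrite /L'; apply: (heap_pop (A := A) (A' := A4) (h := g3' 27) sn3 hp D0 bD Ls).
    + exact: lks.
    + by rewrite A41 A31.
    + by rewrite A46 A36.
    + by rewrite A47 A37.
    + by rewrite A43 A33 e25 e26 f26.
    + by move: A458; rewrite e25 A38 A34 A35.
  - by rewrite A41 A31 A42.
  split.
    case: tk3 => tr [T [U [d [q1 q2 q3 q4 q5]]]]; exists tr, T, U, d; split=> // u.
    by rewrite q3 -(perm_mem pm).
  rewrite (perm_size pm) (perm_size (all_leaves_cons _ _ _)) size_cat upd_same.
  by rewrite all_leaves_upd.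
apply: halts_conseq (wp_halts E) _ => c4 m4 [cc4 inv4] c2 cc2 c1 cc1.
exists (D + size ord + (size s + size (all_leaves ord L))); split=> //.
  by rewrite (perm_size (all_leaves_cons _ _ _)) size_cat /= addnS addSn ltnS -!addnA !leq_add2l leq_add2r.
rewrite (perm_size (all_leaves_cons _ _ _)) size_cat /= /iteration_cost.
rewrite -(subnK sLw) in cc3 *; move: (size (L w) - size s) cc3 => r cc3.
move: (cost (ld _ _ _)) (cost fetch_prog) K1 (cost merge_prog) cc1 cc2 cc3 cc4 => a b c d.
move: (size s) (size ord) (size (all_leaves ord L)) => u v z h1 h2 h3 h4.
by clear -h1 h2 h3 h4; nia.
Qed.

Lemma main_loop_ok k m : main_inv k m ->
  halts S (While (ILt 2 20) process_prog) m (fun c m' =>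
    c <= iteration_cost.+1 * k + 1 /\
    exists g M rr rm lg X, [/\ m' = Memory g M rr rm lg, size X <= 1 & tracks e t0 x rm lg X]).
Proof.
move=> inv; apply: halts_conseq (halts_while process_ok inv) _.
move=> c m' [k' [nh inv' ck]]; split; first by lia.
case: inv' nh => [g [M [rr [rm [lg [A [L [bs [D [-> [cg vw g20 DN] hp [sn al] [tk _]]]]]]]]]]].
have [g2 _ _ _ _] := cg; rewrite /= g2 g20 -leqNgt leqn0 => /eqP D0.
rewrite D0 in sn tk; exists g, M, rr, rm, lg, (all_leaves [::] L); split=> //.
by have := lazy_root sn; rewrite /arity /all_leaves /= cats0 addn0.
Qed.

End MainLoop.

(** * Reading the code of the cotree *)

Lemma uniq_flatten_inj (T : eqType) (f : nat -> seq T) (s : seq nat) i j u :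
  uniq (flatten (map f s)) -> i \in s -> j \in s -> u \in f i -> u \in f j -> i = j.
Proof.
elim: s => //= a s IH; rewrite cat_uniq => /and3P[_ /hasPn dis us].
rewrite !in_cons => /predU1P[->|ia] /predU1P[->|ja] // ui uj; last exact: IH.
  have uf : u \in flatten (map f s) by apply/flatten_mapP; exists j.
  by have := dis u uf; rewrite /= ui.
have uf : u \in flatten (map f s) by apply/flatten_mapP; exists i.
by have := dis u uf; rewrite /= uj.
Qed.

Lemma eq_bottom_up par par' ord : {in ord, par' =1 par} -> bottom_up par ord -> bottom_up par' ord.
Proof.
elim: ord => //= w ord IH H /and3P[-> pw bu]; rewrite H ?mem_head // pw IH // => c co.
by apply: H; rewrite in_cons co orbT.
Qed.

Lemma buckets_insert (bs : nat -> seq nat) D d a : 0 < d <= D ->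
  exists ds ord, [/\ buckets bs D = ds ++ ord,
    buckets (upd bs d (a :: bs d)) D = ds ++ a :: ord
    & forall c, c \in ds -> exists2 d', d < d' <= D & c \in bs d'].
Proof.
move=> /andP[d0]; elim: D => [|D IH]; first by rewrite leqNgt d0.
rewrite leq_eqVlt => /predU1P[->|dD].
  exists [::], (buckets bs D.+1); split=> //=; rewrite eqxx /=; congr (_ :: _ ++ _).
  by apply: eq_buckets => i iD /=; case: eqP => // h; lia.
have [ds [ord [h1 h2 h3]]] := IH dD; exists (bs D.+1 ++ ds), ord; split.
- by rewrite /= h1 catA.
- rewrite [LHS]/= -/(upd bs d (a :: bs d)) h2 catA; congr ((_ ++ _) ++ _).
  by case: eqP => // h; lia.
move=> c; rewrite mem_cat => /orP[cD|/h3[d' /andP[h4 h5] h6]].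
  by exists D.+1 => //; rewrite dD leqnn.
by exists d' => //; rewrite h4 leqW.
Qed.

Definition encode_forest n (ts : seq (cotree 'I_n)) : seq nat := flatten (map (@encode n) ts).

(** The unread part of the code: the trees that are to become children of the open
    node [cur], then those of its ancestors, each preceded by the bracket that
    closes the node before. *)
Definition pending n (pend : nat -> seq (cotree 'I_n)) cur (anc : seq nat) : seq nat :=
  encode_forest (pend cur) ++ flatten [seq 2 :: encode_forest (pend j) | j <- anc].

Lemma encode_neq0 n (t : cotree 'I_n) : encode t <> [::].
Proof. by case: t. Qed.

Lemma buckets_nil D : buckets (fun=> [::]) D = [::].
Proof. by elim: D. Qed.

(** Variables: 20 is the position, 21 the open node, 22 its depth and 23 the
    symbol. *)
Definition open_prog : prog :=
  st 1 20 21 ;; st 2 20 23 ;; ld 24 3 21 ;; Do (IAdd 24 24 3) ;; st 3 21 24 ;;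
  Do (IAdd 21 20 2) ;; Do (IAdd 22 22 3) ;; ld 24 7 22 ;; st 6 20 24 ;; st 7 22 20.

Definition close_prog : prog := ld 21 1 21 ;; Do (ISub 22 22 3).

Definition leaf_prog : prog :=
  ld 24 4 21 ;; st 8 23 24 ;; If (IEq 24 2) (st 5 21 23) Skip ;; st 4 21 23 ;;
  ld 24 3 21 ;; Do (IAdd 24 24 3) ;; st 3 21 24.

Definition parse_prog : prog :=
  ld 23 0 20 ;; Do (IAdd 20 20 3) ;;
  If (ILt 23 4) open_prog (If (IEq 23 4) close_prog leaf_prog).

Section Parse.
Variables (n : nat) (e : rel 'I_n) (t0 : cotree 'I_n).
Notation code := (encode t0).
Notation len := (size code).
Notation N := (len + 3).
Implicit Types (A : nat -> nat -> nat) (L : nat -> seq 'I_n) (bs : nat -> seq nat).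
Implicit Types (pend : nat -> seq (cotree 'I_n)).

(** The leaves that have been read are in front of the pending trees, in the
    order of the input: reading a leaf does not change the list. *)
Definition part L pend (j : nat) : seq (cotree 'I_n) := map (@Leaf _) (rev (L j)) ++ pend j.

(** The tree assembled from the arrays and the pending trees always represents
    the graph. Thus opening a node is one step of [attach] read backwards,
    closing a node changes nothing, and no induction on the tree is needed. *)
Record parsing A q cur anc dep bs L pend (ord := buckets bs len) : Prop := Parsing {
  ps_code : forall i, i < N -> A 0 i = nth 0 code i;
  ps_pending : drop q code = pending pend cur anc;
  ps_pos : q <= len;
  ps_depth : dep cur = size anc /\ size anc <= q;
  ps_path : path (fun a b => A 1 a == b) cur anc /\ last cur anc = 0;
  ps_uniq : uniq (cur :: anc);
  ps_chain : {subset cur :: anc <= 0 :: ord};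
  ps_pend : forall j, pend j != [::] -> j \in cur :: anc;
  ps_heap : heap N dep A L bs len;
  ps_fresh : forall i, q < i -> L i = [::] /\ (i < N -> A 3 i = 0 /\ A 4 i = 0);
  ps_old : {in ord, forall c, c <= q};
  ps_order : bottom_up (A 1) ord;
  ps_dep0 : dep 0 = 0;
  ps_dep : {in ord, forall c, dep c = (dep (A 1 c)).+1};
  ps_lab0 : A 2 0 = 2;
  ps_lab : {in ord, forall c, A 2 c < 2};
  ps_represents : represents e (Node (A 2 0 == 1) (assemble (A 1) (A 2) ord (part L pend)));
  ps_cover : forall u, exists2 j, j \in 0 :: ord & u \in forest_leaves (part L pend j);
  ps_root : arity (A 1) ord (part L pend) 0 <= 1;
  ps_wide : {in ord, forall j, 1 < arity (A 1) ord (part L pend) j};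
  ps_wf : forall j, all (@well_formed _) (pend j);
  ps_unlabelled : {in ord, forall j, ~~ has (labelled (A 2 j == 1)) (pend j)};
  ps_alternating : {in ord, forall c, A 1 c \in ord -> A 2 c != A 2 (A 1 c)} }.

Lemma part_leaves L pend j :
  forest_leaves (part L pend j) = rev (L j) ++ forest_leaves (pend j).
Proof. by rewrite forest_leaves_cat forest_leaves_leaf. Qed.

Lemma parsing_uniq A q cur anc dep bs L pend :
  parsing A q cur anc dep bs L pend ->
  uniq (flatten [seq forest_leaves (part L pend j) | j <- 0 :: buckets bs len]).
Proof.
move=> ps; rewrite -(perm_uniq (leaves_assemble (A 2) _ (ps_order ps))).
exact: (represents_uniq (ps_represents ps)).
Qed.

Lemma parsing_uniq_at A q cur anc dep bs L pend j :
  parsing A q cur anc dep bs L pend -> j \in 0 :: buckets bs len ->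
  uniq (forest_leaves (part L pend j)).
Proof.
move=> /parsing_uniq + jo; case/path.splitPr: jo => s1 s2.
by rewrite map_cat flatten_cat /= !cat_uniq => /and3P[_ _ /and3P[]].
Qed.

Lemma parsing_count S A q cur anc dep bs L pend : n + N + 4 <= S ->
  parsing A q cur anc dep bs L pend -> A 3 cur + 1 < S.
Proof.
move=> NS ps; have co := ps_chain ps (mem_head _ _).
rewrite (heap_count (ps_heap ps) co) /arity.
have uo : uniq (0 :: buckets bs len) by exact: bottom_up_uniq (ps_order ps).
have szo : size (0 :: buckets bs len) <= N.
  rewrite -[X in _ <= X](size_iota 0 N); apply: uniq_leq_size uo _ => c.
  rewrite mem_iota in_cons => /predU1P[-> //|/(ps_old ps)]; have := ps_pos ps; lia.
have szl : size (L cur) <= n.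
  have := parsing_uniq_at ps co; rewrite part_leaves cat_uniq rev_uniq => /andP[ul _].
  by rewrite -(card_uniqP ul) -[X in _ <= X]card_ord max_card.
have := count_size (fun c => A 1 c == cur) (buckets bs len).
by move: szo => /=; case: (cur == 0); lia.
Qed.

Lemma parsing_close A q cur p anc dep bs L pend :
  parsing A q cur (p :: anc) dep bs L pend -> pend cur = [::] ->
  parsing A q.+1 p anc dep bs L pend.
Proof.
move=> ps pc; have [pp pl] := ps_path ps; have /= /andP[cu ua] := ps_uniq ps.
have [dc da] := ps_depth ps.
have c0 : cur != 0.
  apply: contraNneq cu => ->; rewrite -pl /=; exact: mem_last.
have co : cur \in buckets bs len.
  by have := ps_chain ps (mem_head _ _); rewrite in_cons (negPf c0).
have q_lt : q < len.
  have := ps_pending ps; rewrite /pending pc /= => E.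
  by rewrite ltnNge; apply/negP => h; rewrite drop_oversize in E.
move: pp => /= /andP[/eqP pE pp].
have hd := ps_dep ps co; rewrite pE dc in hd.
case: ps => hcode hsuf hpos hdep hpath huniq hchain hpend hheap hfresh hold hord hd0 hd' hl0 hl
  hrep hcov hroot hwide hwf hunl halt.
split=> //.
- by rewrite -add1n -drop_drop hsuf /pending pc /= drop0.
- by split; [case: hd|move: da => /= /ltnW/leqW].
- by move=> j jp; apply: hchain; rewrite in_cons jp orbT.
- move=> j pj; have := hpend j pj; rewrite in_cons => /predU1P[jc|//].
  by rewrite jc pc in pj.
- by move=> i qi; apply: hfresh; exact: ltnW.
- by move=> c /hold cq; exact: leqW.
Qed.

Lemma parsing_leaf A A' q cur anc dep bs L pend v cs :
  parsing A q cur anc dep bs L pend -> pend cur = Leaf v :: cs ->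
  [/\ A' 0 = A 0, A' 1 = A 1, A' 2 = A 2, A' 6 = A 6 & A' 7 = A 7] ->
  A' 3 = upd (A 3) cur (A 3 cur + 1) -> A' 4 = upd (A 4) cur (leaf_id v) ->
  A' 5 = (if A 4 cur == 0 then upd (A 5) cur (leaf_id v) else A 5) ->
  A' 8 = upd (A 8) (leaf_id v) (A 4 cur) ->
  parsing A' q.+1 cur anc dep bs (upd L cur (v :: L cur)) (upd pend cur cs).
Proof.
move=> ps pc [A0 A1 A2 A6 A7] A3 A4 A5 A8.
have uF := parsing_uniq ps; have co := ps_chain ps (mem_head _ _).
have uc := parsing_uniq_at ps co.
have partE : part (upd L cur (v :: L cur)) (upd pend cur cs) = part L pend.
  apply/funext => j; rewrite /part /=; case: (j =P cur) => [->|//].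
  by rewrite pc rev_cons map_rcons cat_rcons.
have vcur : v \in forest_leaves (part L pend cur).
  by rewrite part_leaves pc /forest_leaves /= mem_cat mem_head orbT.
have vL j : j \in 0 :: buckets bs len -> v \notin L j.
  move=> jo; apply/negP => vj; have vF : v \in forest_leaves (part L pend j).
    by rewrite part_leaves mem_cat mem_rev vj.
  have jc := uniq_flatten_inj (f := fun j => forest_leaves (part L pend j)) uF jo co vF vcur.
  subst j; move: uc; rewrite part_leaves pc /forest_leaves /= cat_uniq => /and3P[_ /hasPn h _].
  by have := h v (mem_head _ _); rewrite /= mem_rev vj.
have cq : cur <= q.
  by move: co; rewrite in_cons => /predU1P[->|/(ps_old ps)].
case: ps => hcode hsuf hpos [hdc hda] hpath huniq hchain hpend hheap hfresh hold hord hd0 hd' hl0 hl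
  hrep hcov hroot hwide hwf hunl halt.
have q_lt : q < len.
  move: hsuf; rewrite /pending pc => E; rewrite ltnNge; apply/negP => h.
  by rewrite drop_oversize in E.
split; rewrite ?A0 ?A1 ?A2 ?partE //.
- rewrite -add1n -drop_drop hsuf /pending pc /= eqxx drop0; congr (_ ++ flatten _).
  apply/eq_in_map => j ja; case: (j =P cur) => // jc; subst j.
  by have /= /andP[] := huniq; rewrite ja.
- by split=> //; exact: leqW.
- move=> j /=; case: (j =P cur) => [-> _|_]; [exact: mem_head|exact: hpend].
- case: hheap => h1 h2 h3 h4; split; rewrite ?A1 ?A6 ?A7 //.
    move=> j jo; rewrite A3 /arity /=; have := h3 j jo; rewrite /arity.
    case: (j =P cur) => [->|_ -> //] /= ->.
    by move: (size _) (count _ _) (2 * _) => a c k; clear; lia.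
  move=> j jo; have [lj tj] := h4 j jo; rewrite A8 A4 A5 /=.
  have vid : leaf_id v \notin map (@leaf_id n) (L j).
    by rewrite mem_map; [exact: vL|exact: leaf_id_inj].
  case: (j =P cur) => [jc|jc]; last first.
    split; first exact: linked_upd lj.
    by case: (A 4 cur == 0) => //=; rewrite (introF eqP jc).
  rewrite -jc /= eqxx; split.
    split=> //; first by rewrite /leaf_id addn3.
    exact: linked_upd lj.
  move=> _; have [h0|h0] := eqVneq (A 4 j) 0.
    have -> : L j = [::] by case: (L j) lj => //= a s' [<- /eqP]; rewrite h0.
    by rewrite /= eqxx.
  have Lj0 : L j != [::] by apply: contraNneq h0 => E; move: lj; rewrite E => /eqP.
  by rewrite tj //; case: (L j) Lj0.
- move=> i qi; have [h1 h2] := hfresh i (ltnW qi).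
  have ic : i != cur by apply: contraTneq qi => ->; rewrite -leqNgt leqW.
  by rewrite upd_other // A3 A4 !upd_other.
- by move=> c /hold cq'; exact: leqW.
- move=> j /=; case: (j =P cur) => [_|_]; last exact: hwf.
  by have := hwf cur; rewrite pc => /andP[].
- move=> j jo /=; case: (j =P cur) => [jc|_]; last exact: hunl.
  by have := hunl j jo; rewrite jc pc.
Qed.

(** The new node is inserted at the head of the list for its depth, that is, after all
    deeper nodes in the order of [buckets]; these are unrelated to it, so
    [assemble_swap] applies. *)
Lemma parsing_open A A' q cur anc dep bs L pend b us cs (d := (size anc).+1) :
  parsing A q cur anc dep bs L pend -> pend cur = Node b us :: cs ->
  A' 0 = A 0 -> A' 1 = upd (A 1) q.+1 cur -> A' 2 = upd (A 2) q.+1 (nat_of_bool b) ->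
  A' 3 = upd (A 3) cur (A 3 cur + 1) -> [/\ A' 4 = A 4, A' 5 = A 5 & A' 8 = A 8] ->
  A' 6 = upd (A 6) q.+1 (A 7 d) -> A' 7 = upd (A 7) d q.+1 ->
  parsing A' q.+1 q.+1 (cur :: anc) (upd dep q.+1 d) (upd bs d (q.+1 :: bs d)) L
    (upd (upd pend cur cs) q.+1 us).
Proof.
move=> ps pc A0 A1 A2 A3 [A4 A5 A8] A6 A7.
have co := ps_chain ps (mem_head _ _).
have cq : cur <= q by move: co; rewrite in_cons => /predU1P[->|/(ps_old ps)].
case: ps => hcode hsuf hpos [hdc hda] hpath huniq hchain hpend hheap hfresh hold hord hd0 hd' hl0 hl
  hrep hcov hroot hwide hwf hunl halt.
have q_lt : q < len.
  move: hsuf; rewrite /pending pc => E; rewrite ltnNge; apply/negP => h.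
  by rewrite drop_oversize in E.
set y := q.+1 in A1 A2 A6 A7 *.
have hy : y = q.+1 by []. have qy : q < y by []. clearbody y.
have yN : y < N by rewrite hy; lia.
have cN : cur < N by lia.
have oldy c : c \in 0 :: buckets bs len -> c != y.
  rewrite in_cons => /predU1P[->|/hold cq']; first by rewrite hy.
  by apply: contraTneq cq' => ->; rewrite -ltnNge.
have yo : y \notin 0 :: buckets bs len by apply/negP => /oldy; rewrite eqxx.
have yc : cur != y by exact: oldy.
have dD : 0 < d <= len by rewrite /d /=; lia.
have [ds [rest [oE oE' hds]]] := buckets_insert bs y dD.
have depb c d' : 0 < d' <= len -> c \in bs d' -> dep c = d'.
  by move=> dd cd; have [] := heap_id hheap dd cd.
have cds : cur \notin ds.
  apply/negP => /hds[d' /andP[dd dl] cd]; have := depb cur d'; rewrite hdc.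
  by rewrite dl (ltn_trans (ltn0Sn _) dd) => /(_ isT cd) h; move: dd; rewrite -h /d ltnNge leqnSn.
have yds : y \notin ds by move: yo; rewrite oE in_cons mem_cat !negb_or => /and3P[].
have crest : cur \in 0 :: rest.
  by move: co; rewrite oE !in_cons mem_cat (negPf cds).
have mem' c : (c \in buckets (upd bs d (y :: bs d)) len) = (c == y) || (c \in buckets bs len).
  by rewrite oE' oE !mem_cat in_cons orbCA.
have permo : perm_eq (buckets (upd bs d (y :: bs d)) len) (y :: buckets bs len).
  by rewrite oE' oE -cat1s perm_catCA.
have parE : {in buckets bs len, A' 1 =1 A 1}.
  by move=> c co'; rewrite A1 upd_other // oldy // in_cons co' orbT.
have A1y : A' 1 y = cur by rewrite A1 upd_same.
have labE j : j \in 0 :: buckets bs len -> A' 2 j = A 2 j.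
  by move=> jo; rewrite A2 upd_other // oldy.
pose pend' := upd (upd pend cur cs) y us.
have pendE j : j \in 0 :: buckets bs len -> j != cur -> pend' j = pend j.
  by move=> jo jc; rewrite /pend' !upd_other // oldy.
have pendc : pend' cur = cs by rewrite /pend' upd_other // upd_same.
have pendy : pend' y = us by rewrite /pend' upd_same.
have partE j : j \in 0 :: buckets bs len -> j != cur -> part L pend' j = part L pend j.
  by move=> jo jc; rewrite /part pendE.
have Ly : L y = [::] by have [] := hfresh y qy.
have party : part L pend' y = us by rewrite /part Ly pendy.
have noy : count (fun c => A' 1 c == y) (buckets bs len) = 0.
  rewrite (@eq_in_count _ _ pred0) ?count_pred0 // => c co' /=.
  by rewrite parE //; apply/negbTE; apply: oldy; exact: bottom_up_par hord co'.
have cnt j : count (fun c => A' 1 c == j) (buckets (upd bs d (y :: bs d)) len) =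
    (cur == j) + count (fun c => A 1 c == j) (buckets bs len).
  rewrite (permP permo) /= A1y; congr (_ + _).
  by apply: eq_in_count => c co' /=; rewrite parE.
have arj j : j \in 0 :: buckets bs len ->
    arity (A' 1) (buckets (upd bs d (y :: bs d)) len) (part L pend') j =
    arity (A 1) (buckets bs len) (part L pend) j.
  move=> jo; rewrite /arity cnt; have [->|jc] := eqVneq j cur.
    rewrite /part pendc pc !size_cat /=.
    by move: (size _) (size cs) (count _ _) => a c k; clear; lia.
  by rewrite partE.
have /andP[wfy _] : well_formed (Node b us) && all (@well_formed _) cs.
  by have := hwf cur; rewrite pc.
have ary : 1 < arity (A' 1) (buckets (upd bs d (y :: bs d)) len) (part L pend') y.
  rewrite /arity (permP permo) /= noy A1y (negPf yc) party.
  by move: wfy => /= /and3P[]; rewrite !addn0.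
have bu' : bottom_up (A' 1) (ds ++ y :: rest).
  apply: bottom_up_insert; rewrite -?oE //; first exact: eq_bottom_up hord.
  by rewrite A1 upd_same.
split; rewrite -/pend' ?A0 ?A4 //.
- rewrite [in LHS]hy -add1n -drop_drop hsuf /pending pc pendy /= drop0.
  rewrite pendc -!catA; congr (_ ++ _); rewrite /= /encode_forest; congr (_ :: _ ++ flatten _).
  apply/eq_in_map => j ja; rewrite pendE //; first by apply: hchain; rewrite in_cons ja orbT.
  by apply: contraTneq ja => ->; have /= /andP[] := huniq.
- by rewrite hy.
- by rewrite upd_same hy.
- case: hpath => hp hl'; split=> //=; rewrite A1y eqxx /=.
  elim: (anc) (cur) hp hchain => //= a s IH p /andP[/eqP pa hp] hs; rewrite A1 upd_other.
    rewrite pa eqxx -A1 /=; apply: IH hp _ => j js.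
    by apply: hs; rewrite in_cons js orbT.
  by apply: oldy; apply: hs; exact: mem_head.
- by rewrite cons_uniq huniq andbT; apply: contra yo; exact: hchain.
- move=> j; rewrite [in X in X -> _]in_cons => /predU1P[->|/hchain].
    by rewrite in_cons mem' eqxx orbT.
  by rewrite !in_cons mem' => /orP[->|->]; rewrite ?orbT.
- move=> j; rewrite /pend' /=; case: (j =P y) => [-> _|_]; first exact: mem_head.
  case: (j =P cur) => [-> _|_ /hpend h]; rewrite in_cons ?mem_head ?orbT //.
  by rewrite h orbT.
- case: hheap => h1 h2 h3 h4.
  have yb d' : 0 < d' <= len -> y \notin bs d'.
    move=> dd; apply: contra yo => yd; rewrite in_cons; apply/orP; right.
    by apply/mem_buckets; exists d'.
  split.
  + have old d' c : 0 < d' <= len -> c \in bs d' ->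
        [/\ upd dep y d c = d', c < N & A' 1 c < N].
      move=> dd cd; have cB : c \in buckets bs len by apply/mem_buckets; exists d'.
      have [k1 k2 k3] := h1 d' c dd cd.
      by rewrite upd_other ?oldy ?in_cons ?cB ?orbT // parE.
    move=> d' c dd /=; case: (d' =P d) => [->|_]; last exact: old.
    by rewrite in_cons => /predU1P[->|]; [rewrite A1y eqxx|exact: old].
  + move=> d' dd; rewrite A6 A7 /=; case: (d' =P d) => [d'd|_]; last first.
      by apply: linked_upd (h2 d' dd); exact: yb.
    subst d'; split=> //; [by rewrite hy|rewrite /= ?eqxx].
    by apply: linked_upd (h2 d dd); exact: yb.
  + move=> j; rewrite in_cons mem' orbCA => /predU1P[->|jo].
      have y0 : (y == 0) = false by rewrite hy.
      have yc' : y != cur by rewrite eq_sym.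
      rewrite A3 upd_other // /arity cnt Ly (negPf yc) y0 /=.
      have [_ h] := hfresh y qy; have [-> _] : A 3 y = 0 /\ A 4 y = 0.
        by exact: h.
      rewrite (@eq_in_count _ _ pred0) ?count_pred0 // => c co' /=.
      by apply/negbTE; apply: oldy; exact: bottom_up_par hord co'.
    rewrite -in_cons in jo; rewrite A3 /arity cnt; have := h3 j jo; rewrite /arity /=.
    have [->|jc] := eqVneq j cur; rewrite /= => ->; last by rewrite add0n.
    by move: (size _) (count _ _) (2 * _) => a c k; clear; lia.
  + move=> j; rewrite in_cons mem' orbCA A8 A4 A5 => /predU1P[->|jo].
      rewrite Ly; have [_ h] := hfresh y qy.
      by have [_ ->] : A 3 y = 0 /\ A 4 y = 0 by exact: h.
    by rewrite -in_cons in jo; exact: h4.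
- move=> i yi; have [k1 k2] := hfresh i (ltn_trans qy yi); split=> // /k2[k3 k4].
  rewrite A3 upd_other //; apply: contraTneq yi => ->; rewrite hy -leqNgt; exact: leqW.
- by move=> c; rewrite mem' => /predU1P[->//|/hold cq']; rewrite hy; exact: leqW.
- by rewrite oE'.
- by rewrite upd_other ?hd0 // hy.
- move=> c; rewrite mem' => /predU1P[->|co'].
    by rewrite upd_same A1y upd_other // hdc.
  have co2 : c \in 0 :: buckets bs len by rewrite in_cons co' orbT.
  rewrite parE // (upd_other dep d (oldy _ co2)).
  by rewrite (upd_other dep d (oldy _ (bottom_up_par hord co'))) hd'.
- by rewrite labE ?mem_head.
- move=> c; rewrite mem' => /predU1P[->|co']; first by rewrite A2 upd_same; case: (b).
  by rewrite labE ?hl // in_cons co' orbT.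
- have E : refines e (A 2 0 == 1) (assemble (A 1) (A 2) (buckets bs len) (part L pend))
      (assemble (A' 1) (A' 2) (y :: buckets bs len) (part L pend')).
    apply: (@assemble_refines _ e (A 1) (A' 1) (A 2) (A' 2) (buckets bs len) (part L pend)
      (attach (A' 1) (A' 2) (part L pend') y)) => // j jo.
    left; split; first exact: labE.
    rewrite /attach A1y /=; case: (j =P cur) => [->|/eqP jc]; last first.
      by rewrite partE //; exact: refines_refl.
    have -> : (A' 2 y == 1) = b by rewrite A2 upd_same; case: (b).
    rewrite party; apply: refines_perm; rewrite /part pendc pc.
    by rewrite (perm_catCA _ [:: Node b us] cs).
  rewrite (labE 0) ?mem_head // oE'; move: (E.2 hrep); rewrite oE.
  have := @assemble_swap _ e (A' 1) (A' 2) y ds rest (part L pend') yds.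
  rewrite (labE 0) ?mem_head // => sw; apply: (sw _).2 => c cds'.
  have co' : c \in buckets bs len by rewrite oE mem_cat cds'.
  rewrite A1y parE //; split; first by apply: oldy; exact: bottom_up_par hord co'.
  by apply: contraNneq cds => ->.
- move=> u; have [j jo uj] := hcov u.
  have jo' : j \in 0 :: buckets (upd bs d (y :: bs d)) len.
    by move: jo; rewrite !in_cons mem' => /orP[->|->]; rewrite ?orbT.
  have [jc|jc] := eqVneq j cur; last by exists j; rewrite ?partE.
  subst j; rewrite part_leaves pc [forest_leaves (_ :: _)]/forest_leaves /= !mem_cat in uj.
  case/or3P: uj => h.
  + by exists cur; [exact: jo'|rewrite part_leaves mem_cat h].
  + by exists y; [rewrite in_cons mem' eqxx orbT|rewrite party].
  + by exists cur; [exact: jo'|rewrite part_leaves mem_cat pendc h orbT].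
- by rewrite arj ?mem_head.
- move=> j; rewrite mem' => /predU1P[->//|jo].
  by rewrite arj ?hwide // in_cons jo orbT.
- move=> j; rewrite /pend' /=; case: (j =P y) => [_|_]; first by case/and3P: wfy.
  case: (j =P cur) => [_|_]; last exact: hwf.
  by have := hwf cur; rewrite pc => /andP[].
- move=> j; rewrite mem' => /predU1P[->|jo].
    rewrite pendy A2 upd_same; have -> : (nat_of_bool b == 1) = b by case: (b).
    by case/and3P: wfy.
  have jo' : j \in 0 :: buckets bs len by rewrite in_cons jo orbT.
  rewrite labE //; have [jc|jc] := eqVneq j cur; last by rewrite pendE // hunl.
  by rewrite jc pendc; have := hunl j jo; rewrite jc pc /= negb_or => /andP[].
- move=> c; rewrite mem' => /predU1P[->|co'].
    rewrite A1y mem' (negPf yc) /= => curo; have := hunl cur curo; rewrite pc /= negb_or.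
    have -> : A' 2 y = nat_of_bool b by rewrite A2 upd_same.
    rewrite (labE _ co) => /andP[h _].
    by apply: contraNneq h => <-; case: (b).
  have co2 : c \in 0 :: buckets bs len by rewrite in_cons co' orbT.
  have po := bottom_up_par hord co'.
  rewrite parE // mem' (negPf (oldy _ po)) /= => po'.
  by rewrite !labE //; exact: halt.
Qed.

(** Nothing is pending, and the lists of leaves are those of [part] reversed. *)
Lemma parsing_end A cur anc dep bs L pend :
  parsing A len cur anc dep bs L pend ->
  [/\ heap N dep A L bs len, lazy_tree e (A 1) dep (A 2) (buckets bs len) L,
      {in buckets bs len, forall j, 0 < arity (A 1) (buckets bs len) L j}
    & all_leaves (buckets bs len) L =i [set: 'I_n]].
Proof.
case=> hcode hsuf hpos hdep [hpath hlast] huniq hchain hpend hheap hfresh hold hord hd0 hd' hl0 hl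
  hrep hcov hroot hwide hwf hunl halt.
have [pc a0] : pend cur = [::] /\ anc = [::].
  move: hsuf; rewrite drop_size /pending; case: (anc) => [|p s]; last first.
    by rewrite /=; case: (encode_forest _).
  rewrite cats0; case: (pend cur) => // c s.
  by rewrite /encode_forest /=; case: (encode c) (@encode_neq0 _ c).
have p0 j : pend j = [::].
  apply/eqP; apply: contraT => pj; have := hpend j pj; rewrite a0 inE => /eqP jc.
  by rewrite jc pc in pj.
have arE j : arity (A 1) (buckets bs len) (part L pend) j = arity (A 1) (buckets bs len) L j.
  by rewrite /arity /part p0 cats0 size_map size_rev.
split=> //.
- split=> //.
  + suff h : refines e (A 2 0 == 1) (assemble (A 1) (A 2) (buckets bs len) (part L pend))
      (assemble (A 1) (A 2) (buckets bs len) (leaf_forest L)) by exact: h.2.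
    apply: assemble_refines => // j _; left; split=> //; apply: refines_perm.
    by rewrite /part p0 cats0 /leaf_forest; apply: perm_map; rewrite perm_rev.
  + by rewrite -arE.
  + move=> c co po; have := bottom_up_par hord po; rewrite in_cons => /predU1P[->|ppo].
      by rewrite hl0; have := hl _ po; case: (A 2 _) => [|[]].
    exact: halt.
  + by move=> c co po ppo; rewrite -arE; exact: hwide.
- by move=> j jo; rewrite -arE; exact: ltnW (hwide j jo).
move=> u; rewrite inE; have [j jo] := hcov u; rewrite part_leaves p0 cats0 mem_rev.
exact: all_leaves_mem.
Qed.

(** At first the whole tree is pending at the sentinel. *)
Lemma parsing_start A : well_formed t0 -> represents e t0 -> (forall u, u \in leaves t0) ->
  (forall i, i < N -> A 0 i = nth 0 code i) ->
  (forall f i, 0 < f < 9 -> i < N -> A f i = if (i == 0) && ((f == 2) || (f == 3)) then 2 else 0) ->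
  parsing A 0 0 [::] (fun=> 0) (fun=> [::]) (fun=> [::]) (upd (fun=> [::]) 0 [:: t0]).
Proof.
move=> wf rep cov hA0 hA; have N0 : 0 < N by lia.
split; rewrite ?buckets_nil //.
- by rewrite drop0 /pending /encode_forest /= cats0 cats0.
- by move=> j /=; case: (j =P 0) => [->|] //; rewrite mem_head.
- split; rewrite ?buckets_nil //.
  + by move=> d /andP[d0 dl] /=; rewrite hA // ?andbF //; lia.
  + by move=> j; rewrite inE => /eqP->; rewrite hA.
  + by move=> j; rewrite inE => /eqP->; rewrite hA.
- move=> i i0; split=> // iN; have i0' : (i == 0) = false by rewrite eqn0Ngt i0.
  by rewrite !hA // i0'.
- by rewrite hA.
- by rewrite /= /part /= rep.
- by move=> u; exists 0; rewrite ?mem_head // /part /= /forest_leaves /= cats0.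
- by move=> j /=; case: eqP => //=; rewrite wf.
Qed.

End Parse.

Lemma size_flatten_map (T U : Type) (f : T -> seq U) (s : seq T) :
  size (flatten (map f s)) = \sum_(a <- s) size (f a).
Proof. by rewrite size_flatten /shape -map_comp sumnE big_map. Qed.

(** Interior nodes have at least two children, so there are fewer of them than
    leaves. *)
Lemma size_encode n (t : cotree 'I_n) : well_formed t ->
  size (encode t) + 2 <= 3 * size (leaves t).
Proof.
elim/cotree_nested_ind: t => // b ts IH /and3P[sz _ wf].
rewrite /= size_cat !size_flatten_map /=.
have : \sum_(c <- ts) (size (encode c) + 2) <= \sum_(c <- ts) 3 * size (leaves c).
  rewrite big_seq [X in _ <= X]big_seq; apply: leq_sum => c cts.
  by apply: IH => //; exact: (allP wf).
rewrite big_split /= (big_const_seq 0 addn ts) count_predT iter_addn_0 -big_distrr /=.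
by move: (\sum_(c <- ts) _) (\sum_(c <- ts) _) (size ts) sz => a c k; clear; lia.
Qed.

Lemma encode_lt n (t : cotree 'I_n) : all (fun c => c < n + 3) (encode t).
Proof.
elim/cotree_nested_ind: t => [v|b ts IH] /=; first by rewrite ltn_add2r ltn_ord.
rewrite all_cat /= andbT; apply/and3P; split; [by case: (b); lia| |by lia].
by apply/allP => c /flatten_mapP[s sts cs]; exact: (allP (IH s sts)).
Qed.

Definition setup_prog : prog :=
  Do (IConst 3 1) ;; Do (IConst 4 2) ;; Do (IConst 5 3) ;; Do (IAdd 6 1 5) ;;
  Do (IAdd 11 10 6) ;; Do (IAdd 12 11 6) ;; Do (IAdd 13 12 6) ;; Do (IAdd 14 13 6) ;;
  Do (IAdd 15 14 6) ;; Do (IAdd 16 15 6) ;; Do (IAdd 17 16 6) ;; Do (IAdd 18 17 6).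

Definition fill_prog : prog := Do (RStore 20 0) ;; Do (IAdd 20 20 3).

(** The sentinel gets its label and its two phantom children. *)
Definition sentinel_prog : prog := st 3 2 4 ;; st 2 2 4 ;; Do (ISub 20 20 20) ;; Do (ISub 21 21 21) ;;
  Do (ISub 22 22 22).

Definition diagonalize_prog : prog :=
  setup_prog ;; While (ILt 20 0) fill_prog ;;
  sentinel_prog ;; While (ILt 20 1) parse_prog ;;
  Do (IAdd 20 1 2) ;; While (ILt 2 20) process_prog.

Arguments put A f i v f' /.

Section ParseLoop.
Variables (R : realType) (n : nat) (e : rel 'I_n) (t0 : cotree 'I_n) (x : R).
Variables (S : nat).
Notation code := (encode t0).
Notation len := (size code).
Notation N := (len + 3).
Hypotheses (SN : 9 * N <= S) (nN : n + 3 <= N) (NS : n + N + 4 <= S).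
Implicit Types (A : nat -> nat -> nat) (L : nat -> seq 'I_n) (bs : nat -> seq nat).
Implicit Types (pend : nat -> seq (cotree 'I_n)).
Implicit Types (g : nat -> nat) (M : nat -> nat) (rr rm : nat -> R) (lg : seq (nat * R)).

Definition parse_inv rm lg k (m : memory R) : Prop :=
  exists g M rr A q cur anc dep bs L pend,
  [/\ m = Memory g M rr rm lg,
      [/\ consts N g, view N M A & [/\ g 1 = len, g 20 = q, g 21 = cur & g 22 = size anc]],
      parsing e t0 A q cur anc dep bs L pend & k = len - q].

Lemma parse_ok rm lg k m : parse_inv rm lg k m -> holds (ILt 20 1) m ->
  wp S parse_prog m (fun m' => exists k', k' < k /\ parse_inv rm lg k' m').
Proof.
move=> [g [M [rr [A [q [cur [anc [dep [bs [L [pend [-> [cg vw [g1 g20 g21 g22]] ps ->]]]]]]]]]]]].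
have [g2 g3 g4 g5 gb] := cg; rewrite /= g20 g1 => qlen.
have qN : q < N by lia.
have co := ps_chain ps (mem_head _ _).
have curN : cur < N.
  by move: co; rewrite in_cons => /predU1P[->|/(ps_old ps) h]; lia.
have cntS := parsing_count NS ps.
have sym : A 0 q = nth 0 code q := ps_code ps qN.
have dropE := drop_nth 0 qlen; rewrite (ps_pending ps) in dropE.
have kk : len - q.+1 < len - q by lia.
have [hd1 hd2] := ps_depth ps.
step_load; first by rewrite g20.
rewrite g20 sym; step_do; split; first by rewrite g20 g3; lia.
rewrite g20 g3 addn1.
case pc: (pend cur) => [|[v|b us] cs].
- case: anc => [|p anc] in ps g22 dropE hd1 hd2 *.
    by rewrite /pending pc in dropE.
  have sE : nth 0 code q = 2 by rewrite /pending pc /= in dropE; case: dropE.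
  have [/= /andP[/eqP pE _] _] := ps_path ps.
  rewrite sE; apply: wp_if; rewrite /= g4; [by []|move=> _].
  apply: wp_if; rewrite /= g4; [move=> _|by []].
  apply: wp_seq; (eapply wp_ld; [eassumption|consts_tac|eassumption|by []|by []|by rewrite /= g21|]).
  apply: wp_do; rewrite /safe /=.
  exists (len - q.+1); split=> //.
  do 10 eexists; exists pend; split; [reflexivity| |exact: parsing_close ps pc|by []].
  split; [by consts_tac|eassumption|split=> //=].
    by rewrite g21 pE.
  by rewrite g22 g3 /= subn1.
- have sE : nth 0 code q = leaf_id v by rewrite /pending pc /= in dropE; case: dropE.
  have vN : leaf_id v < N by rewrite /leaf_id; have := ltn_ord v; lia.
  have [v2 v2'] : (leaf_id v < 2) = false /\ (leaf_id v == 2) = false.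
    by rewrite /leaf_id addn3.
  rewrite sE; apply: wp_if; rewrite /= g4 v2; [by []|move=> _].
  apply: wp_if; rewrite /= g4 v2'; [by []|move=> _].
  step_load; first by rewrite g21.
  rewrite g21.
  have fin g' M1 A1 : consts N g' -> view N M1 A1 ->
      [/\ g' 1 = len, g' 20 = q.+1, g' 21 = cur, g' 22 = size anc & g' 23 = leaf_id v] ->
      [/\ A1 0 = A 0, A1 1 = A 1, A1 2 = A 2, A1 6 = A 6 & A1 7 = A 7] ->
      [/\ A1 3 = A 3, A1 4 = A 4,
         A1 5 = (if A 4 cur == 0 then upd (A 5) cur (leaf_id v) else A 5)
         & A1 8 = upd (A 8) (leaf_id v) (A 4 cur)] ->
      wp S (st 4 21 23 ;; ld 24 3 21 ;; Do (IAdd 24 24 3) ;; st 3 21 24) (Memory g' M1 rr rm lg)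
        (fun m' => exists k', k' < len - q /\ parse_inv rm lg k' m').
    move=> cg' vw' [h1 h20 h21 h22 h23] hA [B3 B4 B5 B8]; have [_ h3 _ _ _] := cg'.
    step_store; first by rewrite h21.
    move=> M2 v2''; rewrite h21 h23 in v2''.
    step_load; first by rewrite h21.
    rewrite h21 B3; step_do; split; first by rewrite h3.
    rewrite h3; eapply wp_st; [eassumption|consts_tac|eassumption|by []|by []|by []|by rewrite /= h21|].
    move=> M3 v3; rewrite /= h21 in v3.
    exists (len - q.+1); split=> //.
    do 4 eexists; exists q.+1, cur, anc, dep, bs, (upd L cur (v :: L cur)), (upd pend cur cs).
    split; [reflexivity| | |by []].
      by split; [by consts_tac|exact: v3|split].
    apply: (parsing_leaf ps pc) => //.
    + by rewrite /put /= B3.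
    + by rewrite /put /= B4.
  step_store; first exact: vN.
  move=> M1 v1; apply: wp_seq; apply: wp_if; rewrite /= g2 => h0.
    eapply wp_st; [eassumption|consts_tac|eassumption|by []|by []|by []|by rewrite /= g21|].
    move=> M2 v2''; rewrite /= g21 in v2''; apply: (fin _ _ _ _ v2''); first by consts_tac.
    + by split.
    + by split.
    + by rewrite h0.
  apply: wp_skip; apply: (fin _ _ _ _ v1); first by consts_tac.
  + by split.
  + by split.
  + by rewrite (negPf h0).
have sE : nth 0 code q = nat_of_bool b by rewrite /pending pc /= in dropE; case: dropE.
have bN : b < 2 by case: (b).
have dN : (size anc).+1 < N by lia.
rewrite sE; apply: wp_if; rewrite /= g4 bN; [move=> _|by []].
have yN : q.+1 < N by lia.
have yS : q.+1 < S by lia.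
have dS : (size anc).+1 < S by lia.
step_store; first exact: yN.
move=> M1 v1; step_store; first exact: yN.
move=> M2 v2; step_load; first by rewrite g21.
step_do; split; first by rewrite g21 g3.
step_store; first by rewrite g21.
move=> M3 v3; step_do; split; first by rewrite g2 addn0.
step_do; split; first by rewrite g22 g3 addn1.
step_load; first by rewrite g22 g3 addn1.
step_store; first exact: yN.
move=> M4 v4; eapply wp_st; [eassumption|consts_tac|eassumption|by []|by []|by []|by rewrite /= g22 g3 addn1|].
move=> M5 v5; rewrite /= ?g22 ?g21 ?g2 ?g3 ?addn1 ?addn0 in v5.
exists (len - q.+1); split=> //.
move: v5; set A' := put _ _ _ _ => v5.
have P := parsing_open (A' := A') ps pc; cbv zeta in P.
do 3 eexists; exists A', q.+1, q.+1, (cur :: anc), (upd dep q.+1 (size anc).+1),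
  (upd bs (size anc).+1 (q.+1 :: bs (size anc).+1)), L, (upd (upd pend cur cs) q.+1 us).
split; [reflexivity| | |by []].
  split; [by consts_tac|exact: v5|split=> /=].
  - exact: g1.
  - by [].
  - by rewrite g2 addn0.
  - by rewrite g22 g3 addn1.
apply: P => //.
by rewrite addn1.
Qed.

Lemma parse_loop_ok rm lg k m : parse_inv rm lg k m ->
  halts S (While (ILt 20 1) parse_prog) m (fun c m' =>
    c <= (cost parse_prog).+1 * k + 1 /\
    exists g M rr A cur anc dep bs L pend,
    [/\ m' = Memory g M rr rm lg, [/\ consts N g, view N M A & g 1 = len]
      & parsing e t0 A len cur anc dep bs L pend]).
Proof.
move=> inv; apply: halts_conseq (halts_while (K := cost parse_prog) (I := parse_inv rm lg) _ inv) _.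
  move=> {}k {inv}m inv h; apply: halts_conseq (wp_halts (parse_ok inv h)) _.
  move=> c m' [cc [k' [kk inv']]]; exists k'; split=> //.
  by move: (cost _) cc => K cc; clear -kk cc; nia.
move=> c m' [k' [nh inv' ck]]; split; first by apply: leq_trans ck; exact: leq_addr.
move: inv' nh => [g [M [rr [A [q [cur [anc [dep [bs [L [pend [-> [cg vw [g1 g20 g21 g22]] ps _]]]]]]]]]]]].
rewrite /= g20 g1 -leqNgt => h; have E : q = len.
  by apply/eqP; rewrite eqn_leq (ps_pos ps).
rewrite E in ps.
by exists g, M, rr, A, cur, anc, dep, bs, L, pend.
Qed.

End ParseLoop.

(** * The whole program *)

Section WholeProgram.
Variables (R : realType) (n : nat) (e : rel 'I_n) (t0 : cotree 'I_n) (x : R).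
Variables (S : nat).
Notation code := (encode t0).
Notation len := (size code).
Notation N := (len + 3).
Hypotheses (SN : 9 * N <= S) (nN : n + 3 <= N) (NS : n + N + 4 <= S).
Implicit Types (A : nat -> nat -> nat) (L : nat -> seq 'I_n) (bs : nat -> seq nat).
Implicit Types (g : nat -> nat) (M : nat -> nat) (rr rm : nat -> R) (lg : seq (nat * R)).

Lemma bounded_input : bounded S (input t0 x).
Proof.
split=> [[|[|r]]|a] /=; try by lia.
  by rewrite nth_nil; lia.
have [al|al] := ltnP a len; last by rewrite nth_default //; lia.
by have := allP (encode_lt t0) _ (mem_nth 0 al) => /= h; apply: leq_trans h _; lia.
Qed.

Lemma setup_ok : wp S setup_prog (input t0 x) (fun m => exists g,
  [/\ m = Memory g (nth 0 code) (nth 0%R [:: x]) (fun=> 0%R) [::], consts N g, g 0 = n,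
      g 1 = len & g 20 = 0]).
Proof.
rewrite /input /setup_prog.
step_do; split; first by lia.
step_do; split; first by lia.
step_do; split; first by lia.
do 8 (step_do; split; first by lia).
apply: wp_do; rewrite /safe /=; split; first by lia.
eexists; split=> //; split=> //= f f9.
by do 9 (case: f f9 => [|f] f9; first by rewrite /=; lia).
Qed.

Definition fill_inv k (m : memory R) : Prop := exists g i rm,
  [/\ m = Memory g (nth 0 code) (nth 0%R [:: x]) rm [seq (j, x) | j <- iota 0 i],
      consts N g /\ [/\ g 0 = n, g 1 = len & g 20 = i], i <= n,
      forall j, j < i -> rm j = x & k = n - i].

Lemma fill_ok k m : fill_inv k m ->
  halts S (While (ILt 20 0) fill_prog) m (fun c m' =>
    c <= (cost fill_prog).+1 * k + 1 /\
    exists g rm, [/\ m' = Memory g (nth 0 code) (nth 0%R [:: x]) rm [seq (j, x) | j <- iota 0 n],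
      consts N g, g 1 = len, g 20 = n & forall j, j < n -> rm j = x]).
Proof.
move=> inv; apply: halts_conseq (halts_while (K := cost fill_prog) (I := fill_inv) _ inv) _.
  move=> {}k {inv}m [g [i [rm [-> [cg [g0 g1 g20]] i_n rmx ->]]]]; rewrite /= g20 g0 => lt_in.
  have E : wp S fill_prog (Memory g (nth 0 code) (nth 0%R [:: x]) rm [seq (j, x) | j <- iota 0 i])
     (fun m' => fill_inv (n - i.+1) m').
    have [_ g3 _ _ _] := cg.
    step_do; split; first by lia.
    apply: wp_do; rewrite /safe /= g20 g3; split; first by lia.
    eexists; exists i.+1; eexists; split; first by rewrite -[i.+1]addn1 iotaD map_cat cats1 /=.
    - by split; [consts_tac|split=> //=; rewrite addn1].
    - exact: lt_in.
    - move=> j; rewrite ltnS leq_eqVlt => /predU1P[->|ji]; first by rewrite /= eqxx.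
      by rewrite upd_other ?rmx // neq_ltn ji.
    - by [].
  apply: halts_conseq (wp_halts E) _ => c m' [cc inv']; exists (n - i.+1); split=> //.
    by lia.
  by move: (cost _) cc => K cc; clear -lt_in cc; nia.
move=> c m' [k' [nh [g [i [rm [E [cg [g0 g1 g20]] i_n rmx kE]]]] ck]]; subst m'.
split; first by apply: leq_trans ck; exact: leq_addr.
move: nh; rewrite /= g20 g0 -leqNgt => ni; have En : i = n by apply/eqP; rewrite eqn_leq i_n.
by subst i; exists g, rm; rewrite En in rmx *.
Qed.

Lemma init_log : to_log (diag_init_trace n x) = [seq (j, x) | j <- iota 0 n].
Proof.
rewrite /to_log /diag_init_trace -map_comp -val_enum_ord -map_comp.
by apply/eq_map.
Qed.

(** The main potential is at most [2 * len + n]: depths and nodes are bounded by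
    the length of the code. *)
Lemma diagonalize_ok : cotree_on e [set: 'I_n] t0 ->
  halts S diagonalize_prog (input t0 x) (fun c m =>
    c <= 200 + (cost fill_prog).+1 * n + (cost parse_prog).+1 * len
         + iteration_cost.+1 * (2 * len + n) /\
    exists g M rr rm lg X, [/\ m = Memory g M rr rm lg, size X <= 1
      & @tracks R n e t0 x rm lg X]).
Proof.
move=> cT; have [wf lT rep] := (cotree_onP _ _ _).1 cT.
have cov u : u \in leaves t0 by rewrite lT inE.
apply: halts_seq; apply: halts_conseq (wp_halts setup_ok) _ => c1 m1 [cc1 [g1 [-> cg1 g10 g11 g120]]].
have inv : fill_inv n (Memory g1 (nth 0 code) (nth 0%R [:: x]) (fun=> 0%R) [::]).
  by exists g1, 0, (fun=> 0%R); split=> //; rewrite subn0.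
apply: halts_seq; apply: halts_conseq (fill_ok inv) _.
move=> c2 m2 [cc2 [g2 [rm [-> cg2 g21 g220 rmx]]]].
set lg := [seq (j, x) | j <- iota 0 n].
pose A0 f i := if f == 0 then nth 0 code i else 0.
have v0 : view N (nth 0 code) A0.
  move=> f i f9 iN; rewrite /A0; case: (f =P 0) => [-> //|/eqP f0].
  by rewrite nth_default //; nia.
have N0 : 0 < N by lia.
have E : wp S sentinel_prog (Memory g2 (nth 0 code) (nth 0%R [:: x]) rm lg)
    (fun m => parse_inv e t0 rm lg len m).
  have [g22 g23 g24 _ _] := cg2.
  step_store; first by rewrite g22.
  move=> M1 v1; step_store; first by rewrite g22.
  move=> M2 v2; step_do; step_do; apply: wp_do; rewrite /safe /=.
  rewrite /= g22 g24 in v2; move: v2; set A := put _ _ _ _ => v2.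
  do 3 eexists; exists A, 0, 0, [::], (fun=> 0), (fun=> [::]), (fun=> [::]), (upd (fun=> [::]) 0 [:: t0]).
  split; [reflexivity| | |by rewrite subn0].
    by split; [consts_tac|exact: v2|split=> //=; rewrite subnn].
  apply: parsing_start => // f i /andP[f0 f9] iN; rewrite /A /put /A0.
  by case: f f0 f9 => [|[|[|[|[|[|[|[|[|f]]]]]]]]] //= _ _; rewrite ?andbF //; case: (i == 0).
apply: halts_seq; apply: halts_conseq (wp_halts E) _ => c3 m3 [cc3 pinv].
apply: halts_seq; apply: halts_conseq (parse_loop_ok SN nN NS pinv) _.
move=> c4 m4 [cc4 [g4 [M4 [rr4 [A [cur [anc [dep [bs [L [pend [-> [cg4 vw4 g41] ps]]]]]]]]]]]].
have [hp sn al allT] := parsing_end ps.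
have uo : uniq (0 :: buckets bs len) by exact: bottom_up_uniq (ps_order ps).
have szo : size (buckets bs len) <= len.
  have [_ g42 _ _ _] := cg4.
  have /andP[_ uo'] := uo; rewrite -[X in _ <= X](size_iota 1 len); apply: uniq_leq_size uo' _ => c co.
  rewrite mem_iota add1n ltnS (ps_old ps co) andbT lt0n.
  by apply: contraTneq co => ->; case/andP: uo.
have szl : size (all_leaves (buckets bs len) L) <= n.
  have ul := all_leaves_uniq sn.
  by rewrite -(card_uniqP ul) -[X in _ <= X]card_ord max_card.
have E4 : wp S (Do (IAdd 20 1 2)) (Memory g4 M4 rr4 rm lg) (fun m => main_inv e t0 x N dep
   (len + size (buckets bs len) + size (all_leaves (buckets bs len) L)) m).
  have [g42 _ _ _ _] := cg4.
  apply: wp_do; rewrite /safe /= g41 g42 addn0; split; first by lia.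
  do 4 eexists; exists lg, A, L, bs, len; split; [reflexivity| | | |].
  - by split; [consts_tac|exact: vw4|by []|lia].
  - exact: hp.
  - by split.
  split=> //; exists [::], (Some t0), [set: 'I_n], [ffun=> x]; split.
  - exact: DiagRunNil.
  - exact: cT.
  - by move=> u; rewrite allT.
  - by rewrite cats0 init_log.
  - by move=> i; rewrite ffunE rmx.
apply: halts_seq; apply: halts_conseq (wp_halts E4) _ => c5 m5 [cc5 minv].
have S3 : 3 < S by lia.
have NS' : n + N + 3 <= S by lia.
apply: halts_conseq (main_loop_ok SN S3 nN NS' minv) _.
move=> c6 m6 [cc6 fin]; split; last exact: fin.
have k1 : c1 <= 20 := leq_trans cc1 (isT : cost setup_prog <= 20).
have k3 : c3 <= 20 := leq_trans cc3 (isT : cost sentinel_prog <= 20).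
have k5 : c5 <= 1 := cc5.
have k6 : iteration_cost.+1 * (len + size (buckets bs len) + size (all_leaves (buckets bs len) L))
    <= iteration_cost.+1 * (2 * len + n) by rewrite leq_mul2l; lia.
move: (iteration_cost.+1 * _) (iteration_cost.+1 * _) cc6 k6 => a b cc6 k6.
move: ((cost fill_prog).+1 * _) ((cost parse_prog).+1 * _) cc2 cc4 => c d cc2 cc4.
by clear -k1 cc2 k3 cc4 k5 cc6 k6; lia.
Qed.

End WholeProgram.

Local Open Scope ring_scope.

Lemma size_leaves_encode n (t : cotree 'I_n) : (size (leaves t) <= size (encode t))%N.
Proof.
elim/cotree_nested_ind: t => // b ts IH.
rewrite /= size_cat !size_flatten_map /= leqW // addn1 leqW //.
by rewrite big_seq [X in (_ <= X)%N]big_seq; apply: leq_sum.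
Qed.

Theorem theorem1 (R : realType) :
  exists (p : prog) (C : nat),
    forall (n : nat) (e : rel 'I_n) (t : cotree 'I_n) (x : R),
      cograph e -> cotree_on e [set: 'I_n] t ->
      (forall (tr : seq ('I_n * R)) (s : diag_state R n),
         diag_run e (diag_start t x) tr s ->
         [/\ (size tr <= C * n)%N,
             (1 < num_leaves s.1)%N -> exists tr' s', diag_step e s tr' s'
           & (num_leaves s.1 <= 1)%N ->
             congruent (diag_mx (\row_i s.2 i)) (adjacency R e + x%:M)])
      /\
      (exists (time : nat) (m : memory R) (tr : seq ('I_n * R))
              (s : diag_state R n),
         [/\ runs (C * n) p (input t x) time m,
             (time <= C * n)%N,
             diag_run e (diag_start t x) tr s,
             (num_leaves s.1 <= 1)%N
           & log m = [seq (nat_of_ord a.1, a.2)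
                     | a <- diag_init_trace n x ++ tr]
             /\ forall i : 'I_n, rmem m i = s.2 i]).
Proof.
(* The code has length at most [3 * n], so nine arrays fit into [54 * n] cells; the
   time is below [850 * n]. *)
exists diagonalize_prog, 1000%N => n e t x cg cT; split=> [tr s run|].
  have [sz pr co] := diag_run_correct (cograph_irreflexive cg) cT run; split=> //.
  by apply: leq_trans sz _; rewrite leq_mul2r orbT.
have [wf ut lT _] := cT.
have sl : size (leaves t) = n.
  rewrite -(card_uniqP ut) -[RHS]card_ord; apply: eq_card => u.
  by rewrite lT inE.
have n0 : (0 < n)%N.
  have [u ut'] := well_formed_leaf wf.
  by rewrite -sl; case: (leaves t) ut'.
have len3 : (size (encode t) + 2 <= 3 * n)%N by rewrite -[in X in (_ <= X)%N]sl size_encode.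
have nlen : (n <= size (encode t))%N by rewrite -{1}sl size_leaves_encode.
have SN : (9 * (size (encode t) + 3) <= 1000 * n)%N by lia.
have nN : (n + 3 <= size (encode t) + 3)%N by lia.
have NS : (n + (size (encode t) + 3) + 4 <= 1000 * n)%N by lia.
have [c [m [run _ [cc [g [M [rr [rm [lg [X [mE X1 tk]]]]]]]]]]] :=
  @diagonalize_ok R n e t x _ SN nN NS cT (bounded_input x SN nN NS).
case: tk => tr [T [U [d [drun cU UX lgE rmE]]]].
exists c, m, tr, (T, d); split=> //.
- apply: leq_trans cc _; rewrite /iteration_cost /cost /=; lia.
- rewrite (option_cotree_on_num cU); apply: leq_trans X1.
  by rewrite (eq_card UX); exact: card_size.
- by rewrite mE; split.
Qed.
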